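(* Let $M$ be a transitive model of ZF and let $N$ be a transitive model of ZFC extending $M$. Let $A=(\mathbb{Z}^\omega)^M$ and $B=(\mathbb{Z}^\omega)^N$ be the Baer-Specker groups of $M$ and $N$. Then, in $N$, the Baer-Specker quotient group $B/A$ is pure-injective. If moreover $A$ is countable in $N$, then, in $N$, the cardinal invariants of $B/A$ are $\alpha_{p,n}=0$, $\beta_p=2^{\aleph_0}$, $\gamma_p=0$ (for all primes $p$ and all $n\geq 1$) and $\delta=2^{\aleph_0}$, and ${}^\perp(B/A)=\bigcap_{p\in P}{}^\perp J_p$, where $P$ is the set of all primes.
   Context: All groups are abelian. $\mathbb{Z}^\omega$ is the direct product of countably many copies of $\mathbb{Z}$; by transitivity $(\mathbb{Z}^\omega)^M=\mathbb{Z}^\omega\cap M$, a subgroup of $(\mathbb{Z}^\omega)^N$. For a group $X$, ${}^\perp X$ is the class of all abelian groups $G$ with $\mathrm{Ext}(G,X)=0$ (here computed in $N$). $J_p$ is the group of $p$-adic integers. Pure-injective is the same as algebraically compact. By Kaplansky's theorem, every pure-injective group is isomorphic to $\prod_{p\in P}A_p\oplus\bigoplus_{p\in P}\mathbb{Z}(p^\infty)^{(\gamma_p)}\oplus\mathbb{Q}^{(\delta)}$, where for each prime $p$, $A_p$ is the $p$-adic completion of $\bigoplus_{n\ge1}(\mathbb{Z}/p^n\mathbb{Z})^{(\alpha_{p,n})}\oplus J_p^{(\beta_p)}$, and the cardinals $\alpha_{p,n},\beta_p,\gamma_p,\delta$ are uniquely determined invariants of the group. ($X^{(\mu)}$ denotes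 a direct sum of $\mu$ copies of $X$.) *)

(* Defs.v *)
From Stdlib Require List.
From mathcomp Require Import all_boot all_algebra.

Set Implicit Arguments.
Unset Strict Implicit.
Unset Printing Implicit Defensive.

(* Throughout, sets are elements of an epsilon-structure [S].  Notions taking
   [S] as an argument are evaluated "in S": all their set quantifiers range over
   elements of [S].  In particular a function, homomorphism or group "in S" is an
   element of [S]. *)

Record structure := Structure {
  sort :> Type;
  isin : sort -> sort -> Prop }.

Notation "x '∈' y" := (isin x y) (at level 70, no associativity).

Definition restrict (V : structure) (C : V -> Prop) : structure :=
  @Structure {x : V | C x} (fun x y => sval x ∈ sval y).

Definition extensional (V : structure) : Prop :=
  forall x y : V, (forall z, z ∈ x <-> z ∈ y) -> x = y.

Definition transitive_class (V : structure) (C : V -> Prop) : Prop :=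
  forall x y : V, C x -> y ∈ x -> C y.

(** * First-order set theory *)

(* Variables are de Bruijn indices; [All] binds index 0. *)
Inductive formula :=
  | Mem of nat & nat
  | Eq of nat & nat
  | Bot
  | Imp of formula & formula
  | All of formula.

Definition scons (T : Type) (x : T) (e : nat -> T) : nat -> T :=
  fun i => if i is j.+1 then e j else x.

Fixpoint sat (S : structure) (e : nat -> S) (phi : formula) : Prop :=
  match phi with
  | Mem i j => e i ∈ e j
  | Eq i j => e i = e j
  | Bot => False
  | Imp a b => sat e a -> sat e b
  | All a => forall x : S, sat (scons x e) a
  end.

Section SetTheory.
Variable S : structure.

Definition is_empty (o : S) : Prop := forall z, ~ z ∈ o.

Definition is_upair (s a b : S) : Prop := forall w, w ∈ s <-> w = a \/ w = b.

Definition is_succ (y x : S) : Prop := forall w, w ∈ y <-> w ∈ x \/ w = x.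

Definition subset (x y : S) : Prop := forall z, z ∈ x -> z ∈ y.

Definition ax_foundation : Prop :=
  forall x : S, (exists y, y ∈ x) ->
    exists y, y ∈ x /\ forall z, z ∈ y -> ~ z ∈ x.

Definition ax_pairing : Prop := forall a b : S, exists s, is_upair s a b.

Definition ax_union : Prop :=
  forall x : S, exists u, forall z, z ∈ u <-> exists y, y ∈ x /\ z ∈ y.

Definition ax_powerset : Prop :=
  forall x : S, exists u, forall z, z ∈ u <-> subset z x.

Definition ax_infinity : Prop :=
  exists x : S, (exists o, is_empty o /\ o ∈ x) /\
    forall y, y ∈ x -> exists z, is_succ z y /\ z ∈ x.

Definition ax_separation : Prop :=
  forall (phi : formula) (e : nat -> S) (a : S),
    exists b, forall x, x ∈ b <-> x ∈ a /\ sat (scons x e) phi.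

Definition ax_replacement : Prop :=
  forall (phi : formula) (e : nat -> S) (a : S),
    (forall x y y', x ∈ a -> sat (scons x (scons y e)) phi ->
       sat (scons x (scons y' e)) phi -> y = y') ->
    exists b, forall y,
      y ∈ b <-> exists x, x ∈ a /\ sat (scons x (scons y e)) phi.

Definition ax_choice : Prop :=
  forall x : S,
    (forall y, y ∈ x -> exists z, z ∈ y) ->
    (forall y y' z, y ∈ x -> y' ∈ x -> z ∈ y -> z ∈ y' -> y = y') ->
    exists c, forall y, y ∈ x -> exists! z, z ∈ c /\ z ∈ y.

Definition ZF : Prop :=
  extensional S /\ ax_foundation /\ ax_pairing /\ ax_union /\ ax_powerset /\
  ax_infinity /\ ax_separation /\ ax_replacement.

Definition ZFC : Prop := ZF /\ ax_choice.

End SetTheory.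

(** * Pairs, functions, numbers and cardinals *)

Section Coding.
Variable S : structure.

Definition is_pair (p a b : S) : Prop :=
  exists s t : S, is_upair s a a /\ is_upair t a b /\ is_upair p s t.

(* [v] is the von Neumann numeral of [n].  The structures of interest are
   transitive, hence well-founded, so these are exactly the elements of their
   omega, and the type [nat] indexes it faithfully. *)
Fixpoint is_num (v : S) (n : nat) : Prop :=
  if n is m.+1 then exists u, is_num u m /\ is_succ v u else is_empty v.

Definition omega (v : S) : Prop := exists n, is_num v n.

(* An integer is coded as the reduced pair (a, b) of naturals standing for
   a - b; a rational is coded as the pair (numerator, denominator). *)
Definition is_int (v : S) (z : int) : Prop :=
  exists a b, is_pair v a b /\
    match z with
    | Posz n => is_num a n /\ is_num b 0
    | Negz n => is_num a 0 /\ is_num b n.+1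
    end.

Definition is_rat (v : S) (q : rat) : Prop :=
  exists a b, is_pair v a b /\ is_int a (numq q) /\ is_int b (denq q).

Definition is_set (C : S -> Prop) : Prop := exists x : S, forall v, v ∈ x <-> C v.

Definition app (f a b : S) : Prop := exists w, w ∈ f /\ is_pair w a b.

Definition is_map (f : S) (D C : S -> Prop) : Prop :=
  (forall w, w ∈ f -> exists a b, D a /\ C b /\ is_pair w a b) /\
  (forall a, D a -> exists! b, app f a b).

Definition map_inj (f : S) : Prop :=
  forall a a' b, app f a b -> app f a' b -> a = a'.

Definition map_onto (f : S) (C : S -> Prop) : Prop :=
  forall b, C b -> exists a, app f a b.

Definition equinumerous (C D : S -> Prop) : Prop :=
  exists f : S, is_map f C D /\ map_inj f /\ map_onto f D.

Definition countable_in (C : S -> Prop) : Prop :=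
  exists f : S, is_map f C omega /\ map_inj f.

Definition is_ordinal (k : S) : Prop :=
  (forall x, x ∈ k -> subset x k) /\
  (forall x, x ∈ k -> forall y, y ∈ x -> subset y x).

Definition is_cardinal (k : S) : Prop :=
  is_ordinal k /\
  forall x, x ∈ k -> ~ equinumerous (fun v => v ∈ x) (fun v => v ∈ k).

Definition is_continuum (c : S) : Prop :=
  is_cardinal c /\
  equinumerous (fun v => v ∈ c) (fun x => forall u, u ∈ x -> omega u).

(* [v] is the graph in [S] of the family [x], where [rep u i] means that the
   element [u] of [S] codes the index [i]. *)
Definition is_graph (I : Type) (rep : S -> I -> Prop) (v : S) (x : I -> S) : Prop :=
  forall w, w ∈ v <-> exists i u, rep u i /\ is_pair w u (x i).

End Coding.

(** * Abelian groups in a structure *)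

(* A carrier and the graph of an addition, as classes of [S]; [is_grp] says
   that they are sets of [S] and form an abelian group. *)
Record grp (S : structure) := Grp {
  car : S -> Prop;
  add : S -> S -> S -> Prop }.

Section Groups.
Variable S : structure.
Implicit Types (G H X E : grp S) (f i q : S).

Definition is_zero G (z : S) : Prop := car G z /\ forall a, car G a -> add G z a a.

Definition is_grp G : Prop :=
  is_set (car G) /\
  is_set (fun w => exists a b c u, add G a b c /\ is_pair u a b /\ is_pair w u c) /\
  (forall a b c, add G a b c -> car G a /\ car G b /\ car G c) /\
  (forall a b, car G a -> car G b -> exists! c, add G a b c) /\
  (forall a b c, add G a b c -> add G b a c) /\
  (forall a b c ab bc s, add G a b ab -> add G b c bc ->
     add G ab c s -> add G a bc s) /\
  (exists z, is_zero G z /\ forall a, car G a -> exists b, add G a b z).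

(* y = n x *)
Fixpoint nmul G (n : nat) (x y : S) : Prop :=
  if n is m.+1 then exists z, nmul G m x z /\ add G z x y else is_zero G y.

Definition is_hom f G H : Prop :=
  is_map f (car G) (car H) /\
  forall a b c a' b' c', add G a b c -> app f a a' -> app f b b' -> app f c c' ->
    add H a' b' c'.

Definition isomorphic G H : Prop :=
  exists f, is_hom f G H /\ map_inj f /\ map_onto f (car H).

(* i : G -> H is injective and n (i G) = i G ∩ n H for every n *)
Definition pure_mono i G H : Prop :=
  is_hom i G H /\ map_inj i /\
  forall (n : nat) (g h g' : S), car H h -> nmul H n h g' -> app i g g' ->
    exists x, car G x /\ nmul G n x g.

Definition pure_injective X : Prop :=
  is_grp X /\
  forall G H i f, is_grp G -> is_grp H -> pure_mono i G H -> is_hom f G X ->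
    exists g, is_hom g H X /\
      forall a b c, app i a b -> app f a c -> app g b c.

(* 0 -> X -i-> E -q-> G -> 0 is exact *)
Definition extension X G E i q : Prop :=
  is_grp E /\ is_hom i X E /\ map_inj i /\ is_hom q E G /\ map_onto q (car G) /\
  forall e, car E e ->
    ((exists x, app i x e) <-> (exists z, is_zero G z /\ app q e z)).

(* Equivalence of extensions; by the five lemma [f] is an isomorphism. *)
Definition ext_equiv E i q E' i' q' : Prop :=
  exists f, is_hom f E E' /\
    (forall x e e', app i x e -> app f e e' -> app i' x e') /\
    (forall e e' g, app f e e' -> app q e g -> app q' e' g).

(* Ext(G, X) = 0, where Ext(G, X) is the group of equivalence classes of
   extensions of G by X *)
Definition Ext_trivial G X : Prop :=
  forall E i q E' i' q',
    extension X G E i q -> extension X G E' i' q' -> ext_equiv E i q E' i' q'.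

Definition perp X G : Prop := is_grp G /\ Ext_trivial G X.

(** ** Constructions of groups *)

Definition subgrp G (P : S -> Prop) : grp S :=
  Grp (fun x => car G x /\ P x) (fun x y z => add G x y z /\ P x /\ P y /\ P z).

Definition is_coset G (P : S -> Prop) (v g : S) : Prop :=
  forall u, u ∈ v <-> exists h, P h /\ add G g h u.

Definition quot G (P : S -> Prop) : grp S :=
  Grp (fun v => exists g, car G g /\ is_coset G P v g)
      (fun u v w => exists a b c, add G a b c /\
         is_coset G P u a /\ is_coset G P v b /\ is_coset G P w c).

Definition multiples G (n : nat) : S -> Prop :=
  fun x => exists y, car G y /\ nmul G n y x.

Definition osum G H : grp S :=
  Grp (fun v => exists a b, car G a /\ car H b /\ is_pair v a b)
      (fun u v w => exists a b a' b' c d, is_pair u a b /\ is_pair v a' b' /\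
         is_pair w c d /\ add G a a' c /\ add H b b' d).

(* The product in [S] of a family of groups: only families of elements whose
   graph belongs to [S] are taken. *)
Definition gprod (I : Type) (rep : S -> I -> Prop) (F : I -> grp S) : grp S :=
  Grp (fun v => exists x, is_graph rep v x /\ forall i : I, car (F i) (x i))
      (fun u v w => exists x y z, is_graph rep u x /\ is_graph rep v y /\
         is_graph rep w z /\ forall i : I, add (F i) (x i) (y i) (z i)).

Definition gsum (I : Type) (rep : S -> I -> Prop) (F : I -> grp S) : grp S :=
  subgrp (gprod rep F) (fun v => exists (x : I -> S) (l : list I),
    is_graph rep v x /\ forall i : I, ~ List.In i l -> is_zero (F i) (x i)).

(* G^(k), the direct sum of copies of G indexed by the elements of k *)
Definition copies G (k : S) : grp S :=
  gsum (fun u (i : {x : S | x ∈ k}) => u = sval i) (fun=> G).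

(* The p-adic completion lim_k G / p^k G.  For cosets a of p^k G and b of
   p^(k+1) G, b maps to a if and only if b is included in a. *)
Definition padic_completion (p : nat) G : grp S :=
  subgrp (gprod (@is_num S) (fun k => quot G (multiples G (p ^ k))))
    (fun v => exists x : nat -> S, is_graph (@is_num S) v x /\
       forall k, subset (x k.+1) (x k)).

Definition coded (T : zmodType) (rep : S -> T -> Prop) : grp S :=
  Grp (fun v => exists x, rep v x)
      (fun u v w => exists x y, rep u x /\ rep v y /\ rep w (x + y)%R).

Definition Zgrp : grp S := coded (@is_int S).

Definition Qgrp : grp S := coded (@is_rat S).

Definition Zmod (n : nat) : grp S := quot Zgrp (multiples Zgrp n).

Definition padic (p : nat) : grp S := padic_completion p Zgrp.

Definition QmodZ : grp S := quot Qgrp (fun v => exists z : int, is_rat v z%:~R%R).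

(* Z(p^oo) is the p-primary component of Q/Z. *)
Definition pruefer (p : nat) : grp S :=
  subgrp QmodZ (fun x => exists k z, nmul QmodZ (p ^ k) x z /\ is_zero QmodZ z).

Definition baer_specker : grp S := gprod (@is_num S) (fun _ : nat => Zgrp).

(** ** Kaplansky's invariants of pure-injective groups *)

Definition prime_index := {p : nat | prime p}.
Definition pos_index := {n : nat | 0 < n}.

Definition kaplansky_group (alpha : nat -> nat -> S) (beta gamma : nat -> S)
    (delta : S) : grp S :=
  let A (p : nat) := padic_completion p
    (osum (gsum (fun u (n : pos_index) => is_num u (sval n))
             (fun n : pos_index => copies (Zmod (p ^ sval n)) (alpha p (sval n))))
          (copies (padic p) (beta p))) in
  let rep (u : S) (p : prime_index) := is_num u (sval p) in
  osum (osum (gprod rep (fun p => A (sval p)))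
             (gsum rep (fun p => copies (pruefer (sval p)) (gamma (sval p)))))
       (copies Qgrp delta).

(* Values of [alpha], [beta] and [gamma] at indices other than primes p and
   n >= 1 are irrelevant. *)
Definition has_invariants X (alpha : nat -> nat -> S) (beta gamma : nat -> S)
    (delta : S) : Prop :=
  (forall p, prime p ->
     (forall n, 0 < n -> is_cardinal (alpha p n)) /\
     is_cardinal (beta p) /\ is_cardinal (gamma p)) /\
  is_cardinal delta /\
  isomorphic X (kaplansky_group alpha beta gamma delta).

End Groups.

(** * The Baer-Specker quotient of two classes M and N *)

Section BaerSpeckerQuotient.
Variables (V : structure) (M N : V -> Prop).

(* (Z^omega)^M, computed in M, as a class of N *)
Definition bs_sub : restrict N -> Prop :=
  fun v => exists w : restrict M,
    sval w = sval v /\ car (baer_specker (restrict M)) w.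

Definition bs_quotient : grp (restrict N) := quot (baer_specker (restrict N)) bs_sub.

End BaerSpeckerQuotient.

(* Main.v *)
Require Import Defs.
From HB Require Import structures.
From mathcomp Require Import all_boot all_order all_algebra boolp zify ring.

(* Multiplying by n is injective modulo A, because division of sequences is the
   same in M and N; so B/A is torsion-free.  Since A contains the finitely
   supported sequences, a coherent system of congruences modulo successively
   dividing integers is solved in B/A by a diagonal limit, and for torsion-free
   groups this is algebraic compactness.  When A is countable in N, a sequence
   can be made to differ from every element of A; coding finite approximations
   of the subsets of omega into the coordinates gives 2^aleph_0 sequences
   independent modulo pB + A for a prime p, and 2^aleph_0 independent ones in
   the divisible part.  Extending these to bases of size 2^aleph_0, an element
   of B/A is determined by its coordinates modulo all p^k and by those of its
   divisible component, and all coherent coordinates occur by the Chinese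
   remainder theorem and compactness.  Finally, both orthogonality classes consist
   of the torsion-free groups: such a G has Ext(G, X) = 0 by pure-injectivity of
   X, and p-torsion in G is detected by any X not divisible by p. *)

Set Implicit Arguments.
Unset Strict Implicit.
Unset Printing Implicit Defensive.
Import GRing.Theory.

(** Every function, family and subgroup must be an element of N, while separation and replacement
    apply only to formulas. So the algebra is done on Rocq types identified with definable classes,
    and each construction is shown definable with parameters before it becomes an element of the
    structure. Well-foundedness makes the numerals of both models standard, hence integers and
    rationals are coded alike in M and N, and A, a set of M, serves as a parameter in N. Chains of
    congruences suffice for pure-injectivity: extending a homomorphism to an element h with no
    nonzero multiple in the domain imposes conditions modulo every n, but those modulo j! amount to
    a single congruence modulo some L_j, with L_j dividing L_(j+1), and together these imply all the
    others. In the final isomorphism the completed factors are types depending on the prime p; their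
    elements are therefore represented in one type that does not depend on p, so that the family of
    all coordinates is definable at once. *)

Class zf (S : structure) : Prop := {
  zf_axioms : ZF S;
  zf_wf : well_founded (@isin S) }.

(** * Definability with parameters *)

Fixpoint ren (r : nat -> nat) (phi : formula) : formula :=
  match phi with
  | Defs.Mem i j => Defs.Mem (r i) (r j)
  | Eq i j => Eq (r i) (r j)
  | Bot => Bot
  | Imp a b => Imp (ren r a) (ren r b)
  | All a => All (ren (fun i => if i is j.+1 then (r j).+1 else 0) a)
  end.

Definition mix (T : Type) (e q : nat -> T) (i : nat) : T :=
  if odd i then q i./2 else e i./2.

Section EnvDefinable.
Context {S : structure} {HS : zf S}.
Implicit Types (e q : nat -> S) (P Q : (nat -> S) -> Prop).

Lemma sat_ren r e phi : sat e (ren r phi) <-> sat (fun i => e (r i)) phi.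
Proof.
elim: phi r e => [i j|i j||a IHa b IHb|a IHa] r e //=.
  by rewrite IHa IHb.
have E (x : S) : (fun i => scons x e (if i is j.+1 then (r j).+1 else 0)) =
   scons x (fun i => e (r i)) by apply: funext => -[].
by split=> H x; move: (H x); rewrite IHa E.
Qed.

Lemma set_inhabited : exists x : S, True.
Proof. by case: (zf_axioms) => _ [_ [_ [_ [_ [[x _] _]]]]]; exists x. Qed.

(* The variables are the even places of the environment and the parameters the
   odd ones. *)
Definition dn P := exists phi q, forall e, P e <-> sat (mix e q) phi.

Lemma dn_ext P Q : (forall e, P e <-> Q e) -> dn Q -> dn P.
Proof. by move=> PQ [phi [q Hq]]; exists phi, q => e; rewrite PQ. Qed.

Lemma mix_even e q i : mix e q i.*2 = e i.
Proof. by rewrite /mix odd_double doubleK. Qed.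

Lemma mix_odd e q i : mix e q i.*2.+1 = q i.
Proof. by rewrite /mix /= odd_double /= uphalf_double. Qed.

Lemma dn_mem i j : dn (fun e => e i ∈ e j).
Proof.
have [x _] := set_inhabited.
by exists (Defs.Mem i.*2 j.*2), (fun=> x) => e /=; rewrite !mix_even.
Qed.

Lemma dn_eq i j : dn (fun e => e i = e j).
Proof.
have [x _] := set_inhabited.
by exists (Eq i.*2 j.*2), (fun=> x) => e /=; rewrite !mix_even.
Qed.

Lemma dn_const_mem a i : dn (fun e => e i ∈ a).
Proof.
by exists (Defs.Mem i.*2 1), (fun=> a) => e /=; rewrite mix_even.
Qed.

Lemma dn_bot : dn (fun=> False).
Proof. by have [x _] := set_inhabited; exists Bot, (fun=> x). Qed.

Lemma dn_imp P Q : dn P -> dn Q -> dn (fun e => P e -> Q e).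
Proof.
move=> [phi [q Hp]] [psi [q' Hq]].
(* The parameters of the two formulas are interleaved: those of [phi] go to the even parameter
   places, those of [psi] to the odd ones. *)
pose r1 i := if odd i then i./2.*2.*2.+1 else i.
pose r2 i := if odd i then i./2.*2.+1.*2.+1 else i.
exists (Imp (ren r1 phi) (ren r2 psi)), (mix q q') => e /=.
rewrite !sat_ren Hp Hq.
suff [-> ->] : (fun i => mix e (mix q q') (r1 i)) = mix e q /\
   (fun i => mix e (mix q q') (r2 i)) = mix e q' by [].
split; apply: funext => i; rewrite /r1 /r2 {3}/mix; case: ifP => Hi.
- by rewrite mix_odd mix_even.
- by rewrite /mix Hi.
- by rewrite mix_odd mix_odd.
- by rewrite /mix Hi.
Qed.

Lemma dn_all (P : (nat -> S) -> S -> Prop) :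
  dn (fun e => P (fun i => e i.+1) (e 0)) -> dn (fun e => forall x, P e x).
Proof.
move=> [phi [q Hp]].
(* Under the binder the environment is shifted by one: a parameter moves up one place, variable 0
   becomes the bound variable, and a variable e_(j+1), formerly at place 2j+2, is found at 2j+1. *)
pose r i := if odd i then i.+1 else if i is 0 then 0 else i.-1.
exists (All (ren r phi)), q => e /=.
have E x : (fun i => scons x (mix e q) (r i)) = mix (scons x e) q.
  apply: funext => i; rewrite /r {2}/mix; case: ifP => //.
    by case: i => [|i] //= Hi; rewrite /mix /= Hi.
  by case: i => [|[|i]] //= Hi; rewrite /mix /= -(negbK (odd i)) Hi.
by split=> H x; move: (H x); rewrite sat_ren E -(Hp (scons x e)) /=.
Qed.

Lemma dn_ren (r : nat -> nat) P : dn P -> dn (fun e => P (fun i => e (r i))).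
Proof.
move=> [phi [q Hp]].
exists (ren (fun i => if odd i then i else (r i./2).*2) phi), q => e.
rewrite Hp sat_ren.
suff -> : mix (fun i => e (r i)) q =
  fun i => mix e q (if odd i then i else (r i./2).*2) by [].
apply: funext => i; rewrite {1}/mix; case: ifP => Hi; last by rewrite mix_even.
by rewrite /mix Hi.
Qed.

Lemma dn_not P : dn P -> dn (fun e => ~ P e).
Proof. by move=> H; apply: (dn_imp H); apply: dn_bot. Qed.

Lemma dn_and P Q : dn P -> dn Q -> dn (fun e => P e /\ Q e).
Proof.
move=> HP HQ; apply: (@dn_ext _ (fun e => ~ (P e -> ~ Q e))).
  move=> e; split=> [[p q] H|]; first exact: H.
  by move=> H; apply: contrapT => H'; apply: H => p q; apply: H'.
by apply: dn_not; apply: dn_imp => //; apply: dn_not.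
Qed.

Lemma dn_or P Q : dn P -> dn Q -> dn (fun e => P e \/ Q e).
Proof.
move=> HP HQ; apply: (@dn_ext _ (fun e => ~ P e -> Q e)).
  by move=> e; split=> [[]//|H]; case: (pselect (P e)) => p; [left|right; apply: H].
by apply: dn_imp => //; apply: dn_not.
Qed.

Lemma dn_iff P Q : dn P -> dn Q -> dn (fun e => P e <-> Q e).
Proof. by move=> HP HQ; apply: dn_and; apply: dn_imp. Qed.

Lemma dn_ex (P : (nat -> S) -> S -> Prop) :
  dn (fun e => P (fun i => e i.+1) (e 0)) -> dn (fun e => exists x, P e x).
Proof.
move=> H; apply: (@dn_ext _ (fun e => ~ (forall x, ~ P e x))).
  by move=> e; split=> [[x p] H'|/existsNP [x /contrapT p]]; [apply: (H' x)|exists x].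
by apply: dn_not; apply: dn_all; apply: dn_not.
Qed.

Definition dcl (C : S -> Prop) := dn (fun e => C (e 0)).

Lemma dn_dcl C i : dcl C -> dn (fun e => C (e i)).
Proof. exact: (dn_ren (fun=> i)). Qed.

Lemma separation (C : S -> Prop) (a : S) : dcl C ->
  exists b, forall x, x ∈ b <-> x ∈ a /\ C x.
Proof.
move=> [phi [q Hp]].
have [_ [_ [_ [_ [_ [_ [Hsep _]]]]]]] := zf_axioms (S := S).
(* [C] reads variable 0 alone, so every even place may be sent to x. *)
pose r i := if odd i then i./2.+1 else 0.
have [b Hb] := Hsep (ren r phi) q a.
exists b => x; rewrite Hb sat_ren (Hp (fun=> x)).
suff -> : (fun i => scons x q (r i)) = mix (fun=> x) q by [].
by apply: funext => i; rewrite /r /mix; case: ifP.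
Qed.

Lemma replacement (R : S -> S -> Prop) (a : S) :
  dn (fun e => R (e 0) (e 1)) ->
  (forall x y y', x ∈ a -> R x y -> R x y' -> y = y') ->
  exists b, forall y, y ∈ b <-> exists x, x ∈ a /\ R x y.
Proof.
move=> [phi [q Hp]] Rfun.
have [_ [_ [_ [_ [_ [_ [_ Hrep]]]]]]] := zf_axioms (S := S).
pose r i := if odd i then i./2.+2 else if i is 0 then 0 else 1.
have E x y : sat (scons x (scons y q)) (ren r phi) <-> R x y.
  rewrite sat_ren (Hp (fun i => if i is 0 then x else y)).
  suff -> : (fun i => scons x (scons y q) (r i)) =
    mix (fun i => if i is 0 then x else y) q by [].
  by apply: funext => i; rewrite /r /mix; case: ifP => //; case: i => [|[|i]].
have [|b Hb] := Hrep (ren r phi) q a.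
  by move=> x y y' xa; rewrite !E; apply: Rfun.
exists b => y; rewrite Hb.
by split=> -[x [xa H]]; exists x; split=> //; apply/E.
Qed.

End EnvDefinable.

Ltac dn_step :=
  first [ match goal with H : dcl _ |- _ => let X := constr:(fun i => dn_dcl i H) in solve [apply X] end
  | lazymatch goal with
    | |- dn (fun e => ?A /\ ?B) => apply: dn_and
    | |- dn (fun e => ?A \/ ?B) => apply: dn_or
    | |- dn (fun e => ?A <-> ?B) => apply: dn_iff
    | |- dn (fun e => ~ ?A) => apply: dn_not
    | |- dn (fun e => exists x, _) => apply: dn_ex
    | |- dn (fun e => (e _) ∈ (e _)) => apply: dn_mem
    | |- dn (fun e => (e _) = (e _)) => apply: dn_eq
    | |- dn (fun e => ?A -> ?B) => apply: dn_imp
    | |- dn (fun e => forall x, _) => apply: dn_all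
    end ].
Ltac dn := cbv beta; repeat (dn_step; cbv beta).

(** * Pairs and numerals *)

Section Coding.
Context {S : structure} {HS : zf S}.
Implicit Types x y z a b v : S.

Lemma set_ext x y : (forall z, z ∈ x <-> z ∈ y) -> x = y.
Proof. by move: x y; have [] := zf_axioms (S := S). Qed.

Lemma dn_pair i j k : dn (fun e : nat -> S => is_pair (e i) (e j) (e k)).
Proof. rewrite /is_pair /is_upair; dn. Qed.

Lemma upair_ex a b : exists s, is_upair s a b.
Proof. by have [_ [_ [H _]]] := zf_axioms (S := S); exact: H. Qed.

Lemma upair_uniq s s' a b : is_upair s a b -> is_upair s' a b -> s = s'.
Proof. by move=> H H'; apply: set_ext => z; rewrite H H'. Qed.

Lemma pair_ex a b : exists p, is_pair p a b.
Proof.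
have [s Hs] := upair_ex a a; have [t Ht] := upair_ex a b.
by have [p Hp] := upair_ex s t; exists p, s, t.
Qed.

Lemma pair_uniq p p' a b : is_pair p a b -> is_pair p' a b -> p = p'.
Proof.
move=> [s [t [Hs [Ht Hp]]]] [s' [t' [Hs' [Ht' Hp']]]].
move: Hp'; rewrite (upair_uniq Hs' Hs) (upair_uniq Ht' Ht).
exact: upair_uniq.
Qed.

Lemma pair_inj p a b a' b' : is_pair p a b -> is_pair p a' b' -> a = a' /\ b = b'.
Proof.
move=> [s [t [Hs [Ht Hp]]]] [s' [t' [Hs' [Ht' Hp']]]].
have sp : s ∈ p by apply/Hp; left.
have tp : t ∈ p by apply/Hp; right.
have sp' : s' ∈ p by apply/Hp'; left.
have tp' : t' ∈ p by apply/Hp'; right.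
have aa : a' = a.
  have : a' ∈ s.
    have /Hp' [->|->] := sp; [apply/Hs'|apply/Ht']; by left.
  by move/Hs => [].
subst a'; split=> //.
have ab : b = a \/ b = b'.
  have bt : b ∈ t by apply/Ht; right.
  have /Hp' [E|E] := tp; move: bt; rewrite E.
    by move/Hs' => [|]; left.
  by move/Ht'.
have ab' : b' = a \/ b' = b.
  have bt : b' ∈ t' by apply/Ht'; right.
  have /Hp [E|E] := tp'; move: bt; rewrite E.
    by move/Hs => [|]; left.
  by move/Ht.
by case: ab => [E|//]; subst b; case: ab' => ->.
Qed.

Definition opair a b : S := sval (cid (pair_ex a b)).

Lemma opairP p a b : is_pair p a b <-> p = opair a b.
Proof.
rewrite /opair; case: cid => q Hq /=; split=> [H|->//]; exact: pair_uniq H Hq.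
Qed.

Lemma opair_inj a b a' b' : opair a b = opair a' b' -> a = a' /\ b = b'.
Proof. by move=> E; apply: (@pair_inj (opair a b)); apply/opairP. Qed.

Lemma empty_ex : exists x, is_empty x.
Proof.
have [_ [_ [_ [_ [_ [Hi _]]]]]] := zf_axioms (S := S).
by have [x [[o [oe _]] _]] := Hi; exists o.
Qed.

Lemma empty_uniq x y : is_empty x -> is_empty y -> x = y.
Proof. by move=> ex ey; apply: set_ext => z; split=> H; [case: (ex z)|case: (ey z)]. Qed.

Lemma union_ex x : exists u, forall z, z ∈ u <-> exists y, y ∈ x /\ z ∈ y.
Proof. by have [_ [_ [_ [H _]]]] := zf_axioms (S := S); exact: H. Qed.

Lemma adjoin_ex x a : exists y, forall z, z ∈ y <-> z ∈ x \/ z = a.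
Proof.
have [s Hs] := upair_ex a a; have [t Ht] := upair_ex x s.
have [u Hu] := union_ex t; exists u => z; rewrite Hu; split.
  by move=> [y [/Ht [->|->]]]; [left|move/Hs; case; right].
case=> H; first by exists x; split=> //; apply/Ht; left.
by exists s; split; [apply/Ht; right|apply/Hs; left].
Qed.

Lemma mem_irrefl x : ~ x ∈ x.
Proof. by elim/(well_founded_ind zf_wf): x => x IH xx; exact: (IH x xx xx). Qed.

Lemma mem_asym x y : x ∈ y -> ~ y ∈ x.
Proof.
elim/(well_founded_ind zf_wf): x y => x IH y xy yx.
exact: (IH y yx x).
Qed.

Lemma succ_inj y x x' : is_succ y x -> is_succ y x' -> x = x'.
Proof.
move=> H H'.
have /H' [xx'|//] : x ∈ y by apply/H; right.
have /H [x'x|//] : x' ∈ y by apply/H'; right.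
by case: (mem_asym xx').
Qed.

Lemma num_ex n : exists v : S, is_num v n.
Proof.
elim: n => [|n [u Hu]]; first exact: empty_ex.
by have [v Hv] := adjoin_ex u u; exists v, u.
Qed.

Lemma num_uniq n u v : is_num u n -> is_num v n -> u = v.
Proof.
elim: n u v => [|n IH] u v; first exact: empty_uniq.
move=> [u' [Hu Su]] [v' [Hv Sv]].
by apply: set_ext => z; rewrite Su Sv (IH _ _ Hu Hv).
Qed.

Lemma num_inj m n v : is_num v m -> is_num v n -> m = n.
Proof.
elim: m n v => [|m IH] [|n] v //=.
- by move=> H [u [_ Su]]; case: (H u); apply/Su; right.
- by move=> [u [_ Su]] H; case: (H u); apply/Su; right.
move=> [u [Hu Su]] [u' [Hu' Su']]; move: Hu'; rewrite -(succ_inj Su Su') => Hu'.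
by rewrite (IH _ _ Hu Hu').
Qed.

Lemma num_trans n v x y : is_num v n -> x ∈ v -> y ∈ x -> y ∈ v.
Proof.
elim: n v => [|n IH] v /=; first by move=> H /H.
move=> [u [Hu Su]] /Su [xu|->] yx; apply/Su; left => //; exact: IH yx.
Qed.

(** [omega] is defined by recursion over [nat], outside the language of set theory. This is a
    first-order description of the same class; well-foundedness excludes nonstandard solutions. *)
Definition natlike v :=
  (forall x y, x ∈ v -> y ∈ x -> y ∈ v) /\
  forall x, x ∈ v \/ x = v -> is_empty x \/ exists y, y ∈ v /\ is_succ x y.

Lemma omegaP v : omega v <-> natlike v.
Proof.
split=> [[n]|].
  move=> H; split; first by move=> x y; apply: num_trans H.
  elim: n v H => [|n IH] v /=; first by move=> H x [/H//|->]; left.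
  move=> [u [Hu Su]] x; have uv : u ∈ v by apply/Su; right.
  case=> [/Su xu|->]; last by right; exists u.
  by have [|[y [yu Hy]]] := IH _ Hu _ xu; [left|right; exists y; split=> //; apply/Su; left].
elim/(well_founded_ind zf_wf): v => v IH [Htr Hs].
have [He|[y [yv Sy]]] := Hs v (or_intror erefl); first by exists 0.
suff [n Hn] : omega y by exists n.+1, y.
apply: IH => //; split=> [x z xy zx|x Hx].
  have xv : x ∈ v by apply: Htr xy.
  have /Sy [//|E] : z ∈ v by apply: Htr zx.
  by subst z; case: (mem_asym xy).
have xv : x ∈ v by case: Hx => [|-> //]; move=> xy; apply: Htr xy.
have [|[z [zv Sz]]] := Hs x (or_introl xv); first by left.
right; exists z; split=> //.
have /Sy [//|E] := zv; subst z.
have yx : y ∈ x by apply/Sz; right.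
case: Hx => [xy|E]; first by case: (mem_asym xy).
by subst x; case: (mem_irrefl yx).
Qed.

Lemma dcl_omega : dcl (@omega S).
Proof.
apply: (@dn_ext _ _ (fun e => natlike (e 0))) => [e|]; first exact: omegaP.
by rewrite /natlike /is_empty /is_succ; dn.
Qed.

(** * Encoded types *)

(* An encoded type is a type of Rocq identified with a definable class of [S].
   For these, [dP P] and [dF f] say that the predicate [P] and the function [f]
   are definable in [S] with parameters, and [small T] that the class is a set. *)
Class Enc (T : Type) := {
  enc : T -> S;
  enc_inj : injective enc;
  enc_dom : dcl (fun x => exists t, x = enc t) }.

#[local] Hint Mode Enc + : typeclass_instances.

Lemma encI T {ET : Enc T} (t t' : T) : enc t = enc t' -> t = t'.
Proof. exact: enc_inj. Qed.

Ltac einj := repeat match goal with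
  | H : opair _ _ = opair _ _ |- _ => case/opair_inj: H => ? ?
  | H : @enc ?T ?E ?a = @enc _ _ ?b |- _ => move/(@encI T E a b): H => H
  end; subst => //.

Definition dP (T : Type) {ET : Enc T} (P : T -> Prop) :=
  dcl (fun x => exists t, x = enc t /\ P t).

#[global] Instance Enc_set : Enc S.
Proof.
refine {| enc := id |}; first by [].
apply: (@dn_ext _ _ (fun e => e 0 = e 0)); last by dn.
by move=> e; split=> // _; exists (e 0).
Defined.

Lemma dcl_eq (C D : S -> Prop) : (forall x, C x <-> D x) -> dcl D -> dcl C.
Proof. by move=> H; apply: dn_ext => e. Qed.

Lemma dP_ext T {ET : Enc T} (P Q : T -> Prop) :
  (forall t, P t <-> Q t) -> dP Q -> dP P.
Proof. by move=> PQ; apply: dcl_eq => x; split=> -[t [-> /PQ Pt]]; exists t. Qed.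

Lemma dcl_is_pair (C D : S -> Prop) : dcl C -> dcl D ->
  dcl (fun x => exists a b, C a /\ D b /\ x = opair a b).
Proof.
move=> HC HD.
apply: (@dcl_eq _ (fun x => exists a b, C a /\ D b /\ is_pair x a b)).
  by move=> x; split=> -[a [b [Ca [Db /opairP H]]]]; exists a, b.
by rewrite /dcl; dn; apply: dn_pair.
Qed.

#[global] Instance Enc_prod T U {ET : Enc T} {EU : Enc U} : Enc (T * U).
Proof.
refine {| enc := fun p => opair (enc p.1) (enc p.2) |}.
  by move=> [t u] [t' u'] /= E; einj.
apply: dcl_eq (dcl_is_pair (@enc_dom T ET) (@enc_dom U EU)) => x; split.
  by move=> [[t u] ->]; exists (enc t), (enc u); split; [exists t|split; [exists u|]].
by move=> [_ [_ [[t ->] [[u ->] ->]]]]; exists (t, u).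
Defined.

Definition num n : S := sval (cid (num_ex n)).

Lemma numP u n : is_num u n <-> u = num n.
Proof.
rewrite /num; case: cid => v Hv /=; split=> [H|->//]; exact: num_uniq H Hv.
Qed.

Lemma num_injective : injective num.
Proof. by move=> m n E; apply: (@num_inj _ _ (num m)); apply/numP. Qed.

#[global] Instance Enc_nat : Enc nat.
Proof.
refine {| enc := num; enc_inj := num_injective |}.
by apply: dcl_eq dcl_omega => x; split=> -[n H]; exists n; apply/numP.
Defined.

Section Closure.
Context {T U W : Type} {ET : Enc T} {EU : Enc U} {EW : Enc W}.
Implicit Types (P Q : T -> Prop).

Definition dF (f : T -> U) := dP (fun p : T * U => p.2 = f p.1).

Ltac dn_enc := unfold dF, dP in *; rewrite /dcl; dn; try apply: dn_pair.

Lemma dP_not P : dP P -> dP (fun t => ~ P t).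
Proof.
move=> H; have H' := @enc_dom T ET.
apply: (@dcl_eq _ (fun x => (exists t : T, x = enc t) /\ ~ exists t, x = enc t /\ P t)).
  move=> x; split=> [[t [-> nP]]|[[t ->] nP]].
    by split; [exists t|move=> [t' [E Pt]]; einj].
  by exists t; split=> // Pt; apply: nP; exists t.
by dn_enc.
Qed.

Lemma dP_imp P Q : dP P -> dP Q -> dP (fun t => P t -> Q t).
Proof.
move=> HP HQ; have H' := @enc_dom T ET.
apply: (@dcl_eq _ (fun x => (exists t : T, x = enc t) /\
   ((exists t, x = enc t /\ P t) -> exists t, x = enc t /\ Q t))).
  move=> x; split=> [[t [-> nP]]|[[t ->] nP]].
    split; first by exists t.
    by move=> [t' [E Pt]]; einj; eexists; split; [reflexivity|apply: nP].
  exists t; split=> // Pt; case: nP; first by exists t.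
  by move=> t' [E Qt]; einj.
by dn_enc.
Qed.

Lemma dP_all (P : T -> U -> Prop) :
  dP (fun p : T * U => P p.1 p.2) -> dP (fun t => forall u, P t u).
Proof.
move=> H; have HT := @enc_dom T ET; have HU := @enc_dom U EU.
apply: (@dcl_eq _ (fun x => (exists t : T, x = enc t) /\
   forall y, (exists u : U, y = enc u) -> forall z, is_pair z x y ->
     exists p : T * U, z = enc p /\ P p.1 p.2)).
  move=> x; split=> [[t [-> Pt]]|[[t ->] Pt]].
    by split; [exists t|move=> _ [u ->] z /opairP ->; exists (t, u)].
  exists t; split=> // u.
  case: (Pt (enc u) _ (opair (enc t) (enc u))); [by exists u|by apply/opairP|].
  by move=> [t' u'] /= [E]; einj.
by dn_enc.
Qed.

Lemma dP_comp (f : T -> U) (Q : U -> Prop) : dF f -> dP Q -> dP (fun t => Q (f t)).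
Proof.
move=> Hf HQ; have HT := @enc_dom T ET.
apply: (@dcl_eq _ (fun x => (exists t : T, x = enc t) /\ exists y z, is_pair z x y /\
   (exists u, y = enc u /\ Q u) /\ exists p : T * U, z = enc p /\ p.2 = f p.1));
  last by dn_enc.
move=> x; split.
  move=> [t [-> Qt]]; split; first by exists t.
  exists (enc (f t)), (opair (enc t) (enc (f t))); split; first exact/opairP.
  by split; [exists (f t)|exists (t, f t)].
move=> [[t ->] [_ [_ [/opairP -> [[u [-> Qu]] [[t' u'] /= [E E']]]]]]]; einj.
by exists t'.
Qed.

Lemma dF_const (u : U) : dF (fun=> u).
Proof.
have HT := @enc_dom T ET.
have Hu : dcl (fun x => x = enc u).
  apply: (@dcl_eq _ (fun x => forall z, z ∈ x <-> z ∈ enc u)).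
    by move=> x; split=> [->//|]; apply: set_ext.
  by rewrite /dcl; dn; apply: dn_const_mem.
apply: dcl_eq (dcl_is_pair HT Hu) => x; split.
  move=> [[t u'] /= [-> ->]]; exists (enc t), (enc u); split=> //; by exists t.
by move=> [_ [_ [[t ->] [-> ->]]]]; exists (t, u).
Qed.

Lemma dF_comp (f : T -> U) (g : U -> W) : dF f -> dP (fun p : U * W => p.2 = g p.1) ->
  dP (fun p : T * W => p.2 = g (f p.1)).
Proof.
move=> Hf Hg; have HT := @enc_dom T ET.
apply: (@dcl_eq _ (fun x => exists a b, is_pair x a b /\ exists c z z', 
  is_pair z a c /\ is_pair z' c b /\ (exists p : T * U, z = enc p /\ p.2 = f p.1) /\
   exists p : U * W, z' = enc p /\ p.2 = g p.1)).
  move=> x; split.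
    move=> [[t w] /= [-> E]]; exists (enc t), (enc w); split; first exact/opairP.
    exists (enc (f t)), (enc (t, f t)), (enc (f t, w)).
    split; first exact/opairP. split; first exact/opairP.
    by split; [exists (t, f t)|exists (f t, w)].
  move=> [a [b [/opairP -> [c [_ [_ [/opairP -> [/opairP -> [H1 H2]]]]]]]]].
  case: H1 => -[t u] /= [E1 E2]; einj.
  case: H2 => -[u' w] /= [E3 E4]; einj.
  by exists (t, g (f t)).
by dn_enc.
Qed.

Lemma dF_pair (f : T -> U) (g : T -> W) : dF f -> dP (fun p : T * W => p.2 = g p.1) ->
  dP (fun p : T * (U * W) => p.2 = (f p.1, g p.1)).
Proof.
move=> Hf Hg; have HT := @enc_dom T ET.
apply: (@dcl_eq _ (fun x => exists a b, is_pair x a b /\ exists c d z z', 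
  is_pair b c d /\
  is_pair z a c /\ is_pair z' a d /\ (exists p : T * U, z = enc p /\ p.2 = f p.1) /\
   exists p : T * W, z' = enc p /\ p.2 = g p.1)).
  move=> x; split.
    move=> [[t [u w]] /= [-> [E E']]]; exists (enc t), (enc (u, w)); split; first exact/opairP.
    exists (enc u), (enc w), (enc (t, u)), (enc (t, w)).
    split; first exact/opairP. split; first exact/opairP. split; first exact/opairP.
    by split; [exists (t, u)|exists (t, w)].
  move=> [a [b [/opairP -> [c [d [_ [_ [/opairP -> [/opairP -> [/opairP -> [H1 H2]]]]]]]]]]].
  case: H1 => -[t u] /= [E1 E2]; einj.
  case: H2 => -[u' w] /= [E3 E4]; einj.
  by exists (u', (f u', g u')).
by dn_enc.
Qed.

Lemma dF_fst : dP (fun p : (T * U) * T => p.2 = p.1.1).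
Proof.
have HT := @enc_dom T ET; have HU := @enc_dom U EU.
apply: (@dcl_eq _ (fun x => exists a b c, (exists t : T, a = enc t) /\
   (exists t : U, c = enc t) /\ is_pair x b a /\ is_pair b a c)).
  move=> x; split.
    move=> [[[t u] t'] /= [-> ->]]; exists (enc t), (enc (t, u)), (enc u).
    by split; [exists t|split; [exists u|split; apply/opairP]].
  move=> [_ [b [_ [[t ->] [[u ->] [/opairP -> /opairP ->]]]]]].
  by exists (t, u, t).
by dn_enc.
Qed.

Lemma dF_snd : dP (fun p : (T * U) * U => p.2 = p.1.2).
Proof.
have HT := @enc_dom T ET; have HU := @enc_dom U EU.
apply: (@dcl_eq _ (fun x => exists a b c, (exists t : T, a = enc t) /\
   (exists t : U, c = enc t) /\ is_pair x b c /\ is_pair b a c)).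
  move=> x; split.
    move=> [[[t u] t'] /= [-> ->]]; exists (enc t), (enc (t, u)), (enc u).
    by split; [exists t|split; [exists u|split; apply/opairP]].
  move=> [_ [b [_ [[t ->] [[u ->] [/opairP -> /opairP ->]]]]]].
  by exists (t, u, u).
by dn_enc.
Qed.

Lemma dF_id : dP (fun p : T * T => p.2 = p.1).
Proof.
have HT := @enc_dom T ET.
apply: (@dcl_eq _ (fun x => exists a, (exists t : T, a = enc t) /\ is_pair x a a)).
  move=> x; split.
    by move=> [[t t'] /= [-> ->]]; exists (enc t); split; [exists t|apply/opairP].
  by move=> [_ [[t ->] /opairP ->]]; exists (t, t).
by dn_enc.
Qed.

Lemma dP_eq (f g : T -> U) : dF f -> dF g -> dP (fun t => f t = g t).
Proof.
move=> Hf Hg; have HT := @enc_dom T ET.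
apply: (@dcl_eq _ (fun x => exists b z, 
  is_pair z x b /\ (exists p : T * U, z = enc p /\ p.2 = f p.1) /\
   exists p : T * U, z = enc p /\ p.2 = g p.1)).
  move=> x; split.
    move=> [t [-> E]]; exists (enc (f t)), (enc (t, f t)); split; first exact/opairP.
    by split; exists (t, f t).
  move=> [b [z [/opairP -> [H1 H2]]]].
  case: H1 => -[t u] /= [E1 E2]; einj.
  case: H2 => -[t' u'] /= [E H]; einj.
  by exists t'.
by dn_enc.
Qed.

Lemma dF_enc : dP (fun p : T * S => p.2 = enc p.1).
Proof.
have HT := @enc_dom T ET.
apply: (@dcl_eq _ (fun x => exists a, (exists t : T, a = enc t) /\ is_pair x a a)).
  move=> x; split.
    by move=> [[t t'] /= [-> ->]]; exists (enc t); split; [exists t|apply/opairP].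
  by move=> [_ [[t ->] /opairP ->]]; exists (t, enc t).
by dn_enc.
Qed.
End Closure.

Lemma dP_mem0 : dP (fun p : S * S => p.1 ∈ p.2).
Proof.
apply: (@dcl_eq _ (fun x => exists a b, is_pair x a b /\ a ∈ b)).
  move=> x; split=> [[[a b] /= [-> ab]]|[a [b [/opairP -> ab]]]].
    by exists a, b; split=> //; apply/opairP.
  by exists (a, b).
by rewrite /dcl; dn; apply: dn_pair.
Qed.

End Coding.
Arguments Enc S T : clear implicits.
#[global] Hint Mode Enc - + : typeclass_instances.

Arguments enc : simpl never.

Lemma pairI T U (a c : T) (b d : U) : (a, b) = (c, d) -> a = c /\ b = d.
Proof. by case. Qed.

Ltac einj := repeat match goal with
  | H : (_, _) = (_, _) |- _ => destruct (pairI H); clear H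
  | H : opair _ _ = opair _ _ |- _ => destruct (opair_inj H); clear H
  | H : @enc ?S ?T ?E ?a = @enc ?S ?T ?E ?b |- _ => move/(@encI S T E a b): H => H
  end; subst => //.

(** * Closure properties of definable predicates and functions *)

Section Composite.
Context {S : structure} {HS : zf S}.
Context {T U W : Type} {ET : Enc S T} {EU : Enc S U} {EW : Enc S W}.
Implicit Types (P Q : T -> Prop).

Lemma dP_and P Q : dP P -> dP Q -> dP (fun t => P t /\ Q t).
Proof.
move=> HP HQ; apply: (@dP_ext _ _ _ _ (fun t => ~ (P t -> ~ Q t))).
  move=> t; split=> [[p q] H|H]; first exact: H.
  by apply: contrapT => H'; apply: H => p q; apply: H'.
by apply: dP_not; apply: dP_imp => //; apply: dP_not.
Qed.

Lemma dP_or P Q : dP P -> dP Q -> dP (fun t => P t \/ Q t).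
Proof.
move=> HP HQ; apply: (@dP_ext _ _ _ _ (fun t => ~ P t -> Q t)).
  by move=> t; split=> [[]//|H]; case: (pselect (P t)) => p; [left|right; apply: H].
by apply: dP_imp => //; apply: dP_not.
Qed.

Lemma dP_iff P Q : dP P -> dP Q -> dP (fun t => P t <-> Q t).
Proof. by move=> HP HQ; apply: dP_and; apply: dP_imp. Qed.

Lemma dP_ex (P : T -> U -> Prop) :
  dP (fun p : T * U => P p.1 p.2) -> dP (fun t => exists u, P t u).
Proof.
move=> H; apply: (@dP_ext _ _ _ _ (fun t => ~ (forall u, ~ P t u))).
  by move=> t; split=> [[x p] H'|/existsNP [x /contrapT p]]; [apply: (H' x)|exists x].
by apply: dP_not; apply: dP_all; apply: dP_not.
Qed.

Lemma dP_const (A : Prop) : dP (fun _ : T => A).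
Proof.
have HT := @enc_dom S T ET; rewrite /dP.
case: (pselect A) => HA.
  by apply: dcl_eq HT => x; split=> -[t]; [case=> ->|]; exists t.
apply: (@dcl_eq _ _ (fun x => x ∈ x)); last by rewrite /dcl; dn.
by move=> x; split=> [[t [_ //]]|/mem_irrefl].
Qed.

Lemma dF_idT : dF (fun t : T => t).
Proof. exact: dF_id. Qed.

Lemma dF_app1 (g : U -> W) (f : T -> U) : dF g -> dF f -> dF (fun t => g (f t)).
Proof. move=> Hg Hf; exact (dF_comp Hf Hg). Qed.

Lemma dF_prod (f : T -> U) (g : T -> W) : dF f -> dF g -> dF (fun t => (f t, g t)).
Proof. move=> Hf Hg; exact (dF_pair Hf Hg). Qed.

Lemma dF_rel (f : T -> U) (R : T -> U -> Prop) :
  (forall t u, u = f t <-> R t u) -> dP (fun p : T * U => R p.1 p.2) -> dF f.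
Proof. by move=> H; apply: dP_ext => -[t u]; apply: H. Qed.

Lemma dP_app1 (Q : U -> Prop) (f : T -> U) : dP Q -> dF f -> dP (fun t => Q (f t)).
Proof. by move=> Hg Hf; apply: dP_comp. Qed.

End Composite.

Section Composite2.
Context {S : structure} {HS : zf S}.
Context {T U V W : Type} {ET : Enc S T} {EU : Enc S U} {EV : Enc S V} {EW : Enc S W}.

Lemma dF_encT (f : T -> U) : dF f -> dF (fun t => (enc (f t) : S)).
Proof. by move=> Hf; apply: (dF_app1 (g := enc)) => //; apply: dF_enc. Qed.

Lemma dF_fstT (f : T -> U * W) : dF f -> dF (fun t => (f t).1).
Proof. move=> Hf; exact: (dF_app1 (g := fst) dF_fst Hf). Qed.

Lemma dF_sndT (f : T -> U * W) : dF f -> dF (fun t => (f t).2).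
Proof. move=> Hf; exact: (dF_app1 (g := snd) dF_snd Hf). Qed.

Lemma dF_app2 (h : U -> V -> W) (f : T -> U) (g : T -> V) :
  dF (fun p : U * V => h p.1 p.2) -> dF f -> dF g -> dF (fun t => h (f t) (g t)).
Proof.
by move=> Hh Hf Hg; apply: (dF_app1 (f := fun t => (f t, g t)) Hh); apply: dF_prod.
Qed.

Lemma dP_app2 (Q : U -> V -> Prop) (f : T -> U) (g : T -> V) :
  dP (fun p : U * V => Q p.1 p.2) -> dF f -> dF g -> dP (fun t => Q (f t) (g t)).
Proof.
by move=> Hh Hf Hg; apply: (dP_app1 (f := fun t => (f t, g t)) Hh); apply: dF_prod.
Qed.

Lemma dF_ifT (P : T -> Prop) (b : T -> bool) (f g : T -> U) :
  (forall t, b t <-> P t) -> dP P -> dF f -> dF g ->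
  dF (fun t => if b t then f t else g t).
Proof.
move=> bP HP Hf Hg.
apply: (dF_rel (R := fun t u => (P t /\ u = f t) \/ (~ P t /\ u = g t))).
  move=> t u; case: ifP => [/bP Pt|/negP nP]; split.
  - by left.
  - by case=> -[].
  - by move=> ->; right; split=> // /bP.
  - by case=> -[] // /bP.
have H1 : dP (fun p : T * U => P p.1) by apply: dP_app1 => //; apply: dF_fst.
by apply: dP_or; apply: dP_and => //; apply: dP_not.
Qed.
End Composite2.

Lemma dP_memT {S : structure} {HS : zf S} (T : Type) {ET : Enc S T} (f g : T -> S) :
  dF f -> dF g -> dP (fun t => f t ∈ g t).
Proof. move=> Hf Hg; exact: dP_app2 dP_mem0 Hf Hg. Qed.

(* Hooks of the tactic [dfn], extended as operations are shown definable. *)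
Ltac dfn_fun := fail.
Ltac dfn_pred := fail.

Ltac dF_hyp := match goal with
  | H : dF ?f |- dF (fun t => ?f (@?g t)) => apply (dF_app1 (g := f) (f := g) H)
  | H : dF (fun p => ?f (fst p) (snd p)) |- dF (fun t => ?f (@?a t) (@?b t)) =>
    apply (dF_app2 (h := f) (f := a) (g := b) H)
  | H : dF (fun p => ?f (fst (fst p)) (snd (fst p)) (snd p)) |-
      dF (fun t => ?f (@?a t) (@?b t) (@?c t)) =>
    apply (dF_app1 (g := fun p => f (fst (fst p)) (snd (fst p)) (snd p))
      (f := fun t => (a t, b t, c t)) H)
  | H : dF ?f |- dF ?f => exact H
  end.
Ltac dP_hyp := match goal with
  | H : dP ?f |- dP (fun t => ?f (@?g t)) => apply (dP_app1 (Q := f) (f := g) H)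
  | H : dP (fun p => ?f (fst p) (snd p)) |- dP (fun t => ?f (@?a t) (@?b t)) =>
    apply (dP_app2 (Q := f) (f := a) (g := b) H)
  | H : dP (fun p => ?f (fst (fst p)) (snd (fst p)) (snd p)) |-
      dP (fun t => ?f (@?a t) (@?b t) (@?c t)) =>
    apply (dP_app1 (Q := fun p => f (fst (fst p)) (snd (fst p)) (snd p))
      (f := fun t => (a t, b t, c t)) H)
  | H : dP ?f |- dP ?f => exact H
  end.

Ltac dF_step :=
  lazymatch goal with
  | |- dF fst => exact dF_fst
  | |- dF snd => exact dF_snd
  | |- dF (fun t => t) => apply dF_idT
  | |- dF (fun _ => ?c) => apply dF_const
  | |- dF (fun t => fst (@?f t)) => apply (@dF_fstT _ _ _ _ _ _ _ _ f)
  | |- dF (fun t => snd (@?f t)) => apply (@dF_sndT _ _ _ _ _ _ _ _ f)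
  | |- dF (fun t => (@?f t, @?g t)) => apply (@dF_prod _ _ _ _ _ _ _ _ f g)
  | |- dF (fun t => enc (@?f t)) => apply (@dF_encT _ _ _ _ _ _ f)
  | |- dF _ => first [dF_hyp | dfn_fun]
  end.

Ltac dP_step :=
  lazymatch goal with
  | |- dP (fun t => @?A t /\ @?B t) => apply (@dP_and _ _ _ _ A B)
  | |- dP (fun t => [/\ @?A t, @?B t & @?C t]) =>
      apply (@dP_ext _ _ _ _ (fun t => A t /\ B t /\ C t)); [by move=> ?; split; [case|case=> ? []]|]
  | |- dP (fun t => @?A t \/ @?B t) => apply (@dP_or _ _ _ _ A B)
  | |- dP (fun t => @?A t <-> @?B t) => apply (@dP_iff _ _ _ _ A B)
  | |- dP (fun t => ~ @?A t) => apply (@dP_not _ _ _ _ A)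
  | |- dP (fun t => exists u : ?U, @?B t u) => apply (@dP_ex _ _ _ U _ _ B)
  | |- dP (fun t => @?f t = @?g t) => apply (@dP_eq _ _ _ _ _ _ f g)
  | |- dP (fun t => (@?f t) ∈ (@?g t)) => apply (@dP_memT _ _ _ _ f g)
  | |- dP (fun t => is_true (@?A t && @?B t)) =>
      apply (@dP_ext _ _ _ _ (fun t => A t /\ B t)); [move=> ?; exact: (iff_sym (rwP andP))|]
  | |- dP (fun t => @?A t -> @?B t) =>
     first [ apply (@dP_imp _ _ _ _ A B)
           | apply (@dP_all _ _ _ _ _ _ (fun t _ => B t))]
  | |- dP (fun t => forall u : ?U, @?B t u) => apply (@dP_all _ _ _ U _ _ B)
  | |- dP (fun _ => ?A) => apply dP_const
  | |- dP _ => first [dP_hyp | dfn_pred]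
  end.
Ltac dfn := cbv beta; repeat (first [dP_step | dF_step]; cbv beta).

(** * Natural numbers and definition by recursion *)

Section NatEnc.
Context {S : structure} {HS : zf S}.

Lemma enc_numP (v : S) n : is_num v n <-> v = enc n.
Proof. exact: numP. Qed.

Lemma ltn_enc m n : m < n <-> (enc m : S) ∈ enc n.
Proof.
elim: n => [|n IH]; first by split=> // H; case: (proj2 (enc_numP (enc 0) 0) erefl _ H).
have [u [/enc_numP -> Hs]] := proj2 (enc_numP (enc n.+1) n.+1) erefl.
rewrite Hs ltnS leq_eqVlt; split; first by case/orP => [/eqP ->|/IH]; [right|left].
by case=> [/IH ->|E]; [rewrite orbT|einj; rewrite eqxx].
Qed.

Context {T : Type} {ET : Enc S T}.

Lemma dP_ltn (f g : T -> nat) : dF f -> dF g -> dP (fun t => f t < g t).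
Proof.
move=> Hf Hg; apply: (@dP_ext _ _ _ _ (fun t => enc (f t) ∈ enc (g t))).
  by move=> t; apply: ltn_enc.
by dfn.
Qed.

Lemma dF_succ (f : T -> nat) : dF f -> dF (fun t => (f t).+1).
Proof.
move=> Hf; apply: (dF_app1 (g := succn)) => //.
apply: (dF_rel (R := fun n m => forall k, (enc k : S) ∈ enc m <-> (enc k : S) ∈ enc n \/ k = n)).
  move=> n m; split=> [-> k|H].
    rewrite -!ltn_enc ltnS leq_eqVlt; split; first by case/orP => [/eqP|]; [right|left].
    by case=> [|->]; rewrite ?eqxx // => ->; rewrite orbT.
  have E k : (k < m) = (k <= n).
    apply/idP/idP; rewrite ltn_enc H -ltn_enc; first by case=> [/ltnW|->].
    by rewrite leq_eqVlt => /orP[/eqP|]; [right|left].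
  by apply/eqP; rewrite eqn_leq [n < m]E leqnn andbT leqNgt E ltnn.
by dfn.
Qed.

End NatEnc.
Ltac dfn_nat0 := lazymatch goal with
  | |- dF (fun t => Datatypes.S (@?f t)) => apply (@dF_succ _ _ _ _ f)
  end.
Ltac dfn_ltn := lazymatch goal with
  | |- dP (fun t => is_true (leq (Datatypes.S (@?f t)) (@?g t))) => apply (@dP_ltn _ _ _ _ f g)
  end.
Ltac dfn_fun ::= dfn_nat0.
Ltac dfn_pred ::= dfn_ltn.

Section NatRec.
Context {S : structure} {HS : zf S}.
Context {G T : Type} {EG : Enc S G} {ET : Enc S T}.

(** The value at n is certified by a set of pairs in which each pair is initial or comes from a pair
    one step before. By induction on n such a set can hold only the right value at n, and the finite
    initial segment of the graph is one. *)
Lemma dF_natrec (h : G -> nat -> T) (F : G -> nat -> T -> T) :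
  (forall g n, h g n.+1 = F g n (h g n)) ->
  dF (fun g => h g 0) -> dF (fun p : G * nat * T => F p.1.1 p.1.2 p.2) ->
  dF (fun p : G * nat => h p.1 p.2).
Proof.
move=> hF H0 HF.
pose H0' g := h g 0.
apply: (dF_rel (R := fun p x => exists s : S, enc (p.2, x) ∈ s /\
   forall m y, enc (m, y) ∈ s -> (m = 0 /\ y = H0' p.1) \/
     exists m' y', m = m'.+1 /\ enc (m', y') ∈ s /\ y = F p.1 m' y')).
  move=> [g n] x /=; split=> [->|[s [xs Hs]]].
    have [s [Hs Hs']] : exists s : S, enc (n, h g n) ∈ s /\ 
        forall w, w ∈ s <-> exists m, m <= n /\ w = enc (m, h g m).
    elim: n => [|n [s [ns Hs]]].
      have [o Ho] := @empty_ex S HS; have [s Hs] := adjoin_ex o (enc (0, h g 0)).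
      exists s; split; first by apply/Hs; right.
      move=> w; rewrite Hs; split; first by case=> [/Ho//|->]; exists 0.
      by case=> m []; rewrite leqn0 => /eqP -> ->; right.
    have [s' Hs'] := adjoin_ex s (enc (n.+1, h g n.+1)).
    exists s'; split; first by apply/Hs'; right.
    move=> w; rewrite Hs' Hs; split.
      by case=> [[m [le ->]]|->]; [exists m; split=> //; apply: leqW|exists n.+1].
    case=> m [le ->]; move: le; rewrite leq_eqVlt => /orP[/eqP ->|le]; first by right.
    by left; exists m.
    exists s; split=> // m y /Hs' [m' [le E]]; einj.
    case: m' le => [|k] le; first by left.
    right; exists k, (h g k); split=> //; split=> //.
    by apply/Hs'; exists k; split=> //; apply: ltnW.
  elim: n x xs => [|n IH] x /Hs [[//]|[m' [y' [//]]]].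
  by move=> [<-] [/IH -> ->]; rewrite hF.
have H0'' : dF H0' by [].
dfn.
Qed.
End NatRec.

(** * Classes that are sets *)

Section Small.
Context {S : structure} {HS : zf S}.

Lemma is_set_sub (C : S -> Prop) (a : S) : dcl C -> (forall x, C x -> x ∈ a) -> is_set C.
Proof.
move=> HC Ca; have [b Hb] := separation a HC; exists b => x; rewrite Hb.
by split=> [[]|Cx]; last by split=> //; apply: Ca.
Qed.

Definition small (T : Type) {ET : Enc S T} := is_set (fun x : S => exists t : T, x = enc t).
Arguments small T {ET}.

Section S2.
Context {T U : Type} {ET : Enc S T} {EU : Enc S U}.

Lemma sep_set (P : T -> Prop) : small T -> dP P -> is_set (fun x : S => exists t, x = enc t /\ P t).
Proof.
move=> [a Ha] HP; apply: (@is_set_sub _ a) => [|_ [t [-> _]]]; first by [].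
by apply/Ha; exists t.
Qed.

Lemma repl_set (R : T -> U -> Prop) : small T -> dP (fun p : T * U => R p.1 p.2) ->
  (forall t u u', R t u -> R t u' -> u = u') ->
  is_set (fun y : S => exists u, y = enc u /\ exists t, R t u).
Proof.
move=> [a Ha] HR Rf.
have [|x y y' _ [t [u [Ex [Ey Rt]]]] [t' [u' [Ex' [Ey' Rt']]]]|b Hb] :=
    @replacement S HS (fun x y => exists t u, x = enc t /\ y = enc u /\ R t u) a.
- move: HR; rewrite /dP => HR.
  apply: (@dn_ext _ _ (fun e => exists z, is_pair z (e 0) (e 1) /\
     exists p : T * U, z = enc p /\ R p.1 p.2)); last by dn; apply: dn_pair.
  move=> e; split.
    move=> [t [u [-> [-> H]]]]; exists (enc (t, u)); split; first exact/opairP.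
    by exists (t, u).
  move=> [_ [/opairP -> [[t u] [E H]]]]; exists t, u.
  by case/opair_inj: E.
- by subst; einj; apply: congr1; apply: Rf Rt Rt'.
exists b => y; rewrite Hb; split=> [[x [_ [t [u [_ [-> H]]]]]]|[u [-> [t H]]]].
  by exists u; split=> //; exists t.
by exists (enc t); split; [apply/Ha; exists t|exists t, u].
Qed.

Lemma image_set (f : T -> U) : small T -> dF f -> is_set (fun y : S => exists t, y = enc (f t)).
Proof.
move=> sT Hf; have [|t u u' -> ->|b Hb] // := @repl_set (fun t u => u = f t) sT _.
exists b => y; rewrite Hb; split; first by move=> [_ [-> [t ->]]]; exists t.
by move=> [t ->]; exists (f t); split=> //; exists t.
Qed.

Lemma small_surj (f : T -> U) : dF f -> (forall u, exists t, u = f t) -> small T -> small U.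
Proof.
move=> Hf Hs sT; have [b Hb] := image_set sT Hf; exists b => y; rewrite Hb.
split=> [[t ->]|[u ->]]; first by exists (f t).
by have [t ->] := Hs u; exists t.
Qed.

Lemma small_inj (f : U -> T) : dF f -> injective f -> small T -> small U.
Proof.
move=> Hf Hi sT.
have [||b Hb] := @repl_set (fun t u => t = f u) sT.
- by dfn.
- by move=> t u u' -> /Hi.
exists b => y; rewrite Hb; split=> [[u [-> _]]|[u ->]]; first by exists u.
by exists u; split=> //; exists (f u).
Qed.
End S2.

(** Replacement gives each set {t} x U and then the set of all of these; the product is its
    union. *)
Lemma small_prod T U {ET : Enc S T} {EU : Enc S U} : small T -> small U -> small (T * U).
Proof.
move=> sT sU.
have H (t : T) : is_set (fun y : S => exists u : U, y = enc (t, u)).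
  by apply: (@image_set _ _ _ _ (fun u => (t, u))) => //; dfn.
pose s t := sval (cid (H t)).
have sP t w : w ∈ s t <-> exists u : U, w = enc (t, u) by exact: (svalP (cid (H t)) w).
have ds : dF s.
  apply: (dF_rel (R := fun t x => forall w, w ∈ x <-> exists u : U, w = enc (t, u))).
    move=> t x; split=> [-> w|E]; first exact: sP.
    by apply: set_ext => w; rewrite sP E.
  by dfn.
have [b Hb] := image_set sT ds.
have [u Hu] := union_ex b; exists u => z; rewrite Hu; split.
  by move=> [_ [/Hb [t ->] /sP [w ->]]]; exists (t, w).
move=> [[t w] ->]; exists (s t); split; first by apply/Hb; exists t.
by apply/sP; exists w.
Qed.

Lemma small_nat : small nat.
Proof.
have [_ [_ [_ [_ [_ [[x [[o [oe ox]] xs]] _]]]]]] := @zf_axioms S HS.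
apply: (@is_set_sub _ x); first exact: (@enc_dom S nat _).
move=> _ [n ->]; elim: n => [|n IH].
  by rewrite (empty_uniq (proj2 (enc_numP (enc 0) 0) erefl) oe).
have [y [Sy yx]] := xs _ IH.
have /enc_numP <- // : is_num y n.+1.
by exists (enc n); split=> //; apply/enc_numP.
Qed.

(** * Types encoded through an injection *)

Definition enc_via T U {EU : Enc S U} (f : T -> U) (fi : injective f)
  (Hf : dP (fun u => exists t, u = f t)) : Enc S T.
Proof.
refine {| enc := fun t => enc (f t) |}; first by move=> t t' E; apply: fi; einj.
move: Hf; rewrite /dP => Hf.
apply: dcl_eq Hf => x; split=> [[t ->]|[u [-> [t ->]]]]; last by exists t.
by exists (f t); split=> //; exists t.
Defined.

Lemma dF_via T U {EU : Enc S U} (f : T -> U) (fi : injective f)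
  (Hf : dP (fun u => exists t, u = f t)) : @dF S HS T U (enc_via fi Hf) EU f.
Proof.
set ET := enc_via fi Hf.
apply: (@dcl_eq _ _ (fun x => exists a, (exists t : T, a = enc t) /\ is_pair x a a)).
  move=> x; split.
    by move=> [[t t'] /= [-> ->]]; exists (enc t); split; [exists t|apply/opairP].
  by move=> [_ [[t ->] /opairP ->]]; exists (t, f t).
by have H := @enc_dom S T ET; rewrite /dcl; dn; apply: dn_pair.
Qed.

Lemma dF_lift G T U {EG : Enc S G} {ET : Enc S T} {EU : Enc S U} (f : T -> U) (g : G -> T) :
  injective f -> dF f -> dF (fun x => f (g x)) -> dF g.
Proof.
move=> fi Hf Hg; pose h x := f (g x); have Hh : dF h by [].
apply: (dF_rel (R := fun x t => f t = h x)) => [x t|]; last by dfn.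
by split=> [->|/fi].
Qed.

End Small.

Arguments small {S} T {ET}.

(** * Internal functions and internal subsets *)

Section InternalFunctions.
Context {S : structure} {HS : zf S}.

Section Types.
Variables (T U : Type).
Context {ET : Enc S T} {EU : Enc S U}.

Record ifun := IFun {
  ifun_val :> T -> U;
  ifun_set : is_set (fun w : S => exists t, w = enc (t, ifun_val t)) }.

Lemma ifunP (f g : ifun) : (forall t, f t = g t) -> f = g.
Proof.
case: f g => [f Hf] [g Hg] /= E; have {}E : f = g by exact: funext.
by subst; congr IFun.
Qed.

Definition graph (f : ifun) : S := sval (cid (ifun_set f)).

Lemma graphP f w : w ∈ graph f <-> exists t, w = enc (t, f t).
Proof. exact: (svalP (cid (ifun_set f)) w). Qed.

Lemma graph_mem f t u : enc (t, u) ∈ graph f <-> u = f t.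
Proof.
rewrite graphP; split=> [[t' E]|->]; last by exists t.
by einj.
Qed.

Lemma graph_inj : injective graph.
Proof. by move=> f g E; apply: ifunP => t; apply/graph_mem; rewrite -E; apply/graph_mem. Qed.

Lemma graph_dom : dP (fun x : S => exists f, x = graph f).
Proof.
apply: (@dP_ext _ _ _ _ (fun x : S => (forall w, w ∈ x -> exists p : T * U, w = enc p) /\
  forall t : T, exists u : U, enc (t, u) ∈ x /\ forall u', enc (t, u') ∈ x -> u' = u));
  last by dfn.
move=> x; split=> [[f ->]|[Hx Hf]].
  split=> [w /graphP [t ->]|t]; first by exists (t, f t).
  by exists (f t); split=> [|u']; rewrite graph_mem.
pose f t := sval (cid (Hf t)).
have fP t : enc (t, f t) ∈ x /\ forall u', enc (t, u') ∈ x -> u' = f t.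
  exact: (svalP (cid (Hf t))).
have Hs : is_set (fun w : S => exists t, w = enc (t, f t)).
  exists x => w; split=> [wx|[t ->]]; last by case: (fP t).
  have [[t u] E] := Hx _ wx; subst w; exists t.
  by have [_ /(_ u wx) ->] := fP t.
exists (IFun Hs); apply: set_ext => w; rewrite graphP /=.
split=> [wx|[t ->]]; last by case: (fP t).
have [[t u] E] := Hx _ wx; subst w; exists t.
by have [_ /(_ u wx) ->] := fP t.
Qed.

#[global] Instance Enc_ifun : Enc S ifun := enc_via graph_inj graph_dom.

Lemma ifun_ex (f : T -> U) : small T -> dF f -> exists g : ifun, forall t, g t = f t.
Proof.
move=> sT Hf.
have Hs : is_set (fun w : S => exists t, w = enc (t, f t)).
  by apply: (@image_set _ _ _ _ _ _ (fun t => (t, f t))) => //; dfn.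
by exists (IFun Hs).
Qed.

Record iset := ISet {
  iset_val :> T -> Prop;
  iset_set : is_set (fun w : S => exists t, w = enc t /\ iset_val t) }.

Lemma isetP (A B : iset) : (forall t, A t <-> B t) -> A = B.
Proof.
case: A B => [f Hf] [g Hg] /= E.
have {}E : f = g by apply: funext => t; apply: propext.
by subst; congr ISet.
Qed.

Definition ext (A : iset) : S := sval (cid (iset_set A)).

Lemma extP A w : w ∈ ext A <-> exists t, w = enc t /\ A t.
Proof. exact: (svalP (cid (iset_set A)) w). Qed.

Lemma ext_mem A t : enc t ∈ ext A <-> A t.
Proof. by rewrite extP; split=> [[t' [E At]]|At]; [einj|exists t]. Qed.

Lemma ext_inj : injective ext.
Proof. by move=> A B E; apply: isetP => t; rewrite -!ext_mem E. Qed.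

Lemma ext_dom : dP (fun x : S => exists A, x = ext A).
Proof.
apply: (@dP_ext _ _ _ _ (fun x : S => forall w, w ∈ x -> exists t : T, w = enc t));
  last by dfn.
move=> x; split=> [[A ->] w /extP [t [-> _]]|Hx]; first by exists t.
have H : is_set (fun w : S => exists t : T, w = enc t /\ enc t ∈ x).
  by exists x => w; split=> [wx|[t [-> //]]]; have [t E] := Hx _ wx; exists t; rewrite -E.
exists (ISet H); apply: set_ext => w; rewrite extP /=.
by split=> [wx|[t [-> //]]]; have [t E] := Hx _ wx; exists t; rewrite -E.
Qed.

#[global] Instance Enc_iset : Enc S iset := enc_via ext_inj ext_dom.

Lemma iset_ex (P : T -> Prop) : small T -> dP P -> exists A : iset, forall t, A t <-> P t.
Proof. by move=> sT HP; exists (ISet (sep_set sT HP)). Qed.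

Lemma small_iset : small T -> small iset.
Proof.
move=> [a Ha]; have [_ [_ [_ [_ [Hp _]]]]] := @zf_axioms S HS.
have [b Hb] := Hp a.
apply: (@is_set_sub _ _ _ b); first exact: (@enc_dom S iset _).
move=> _ [A ->]; apply/Hb => z /extP [t [-> _]]; apply/Ha; by exists t.
Qed.

Lemma small_ifun : small T -> small U -> small ifun.
Proof.
move=> sT sU; have [a Ha] := small_prod sT sU.
have [_ [_ [_ [_ [Hp _]]]]] := @zf_axioms S HS.
have [b Hb] := Hp a.
apply: (@is_set_sub _ _ _ b); first exact: (@enc_dom S ifun _).
move=> _ [A ->]; apply/Hb => z /graphP [t ->]; apply/Ha; by exists (t, A t).
Qed.
End Types.
Arguments ifun T U {ET EU}.
Arguments iset T {ET}.

Section Closure.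
Context {G T U : Type} {EG : Enc S G} {ET : Enc S T} {EU : Enc S U}.

Lemma dF_apT (f : G -> ifun T U) (t : G -> T) : dF f -> dF t -> dF (fun g => f g (t g)).
Proof.
move=> Hf Ht.
have Hg : dF (@graph T U ET EU) by exact: dF_via.
apply: (dF_rel (R := fun g u => enc (t g, u) ∈ graph (f g))); last by dfn.
by move=> g u; rewrite graph_mem.
Qed.

Lemma dF_ifun (f : G -> ifun T U) : dF (fun p : G * T => f p.1 p.2) -> dF f.
Proof.
move=> Hf; pose h g t := f g t.
have Hh : dF (fun p : G * T => h p.1 p.2) by [].
apply: (dF_rel (R := fun g (k : ifun T U) => forall t, k t = h g t)).
  by move=> g k; split=> [-> //|H]; apply: ifunP.
have Ha : dF (fun p : ifun T U * T => (fun k t => ifun_val k t) p.1 p.2).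
  have Hg : dF (@graph T U ET EU) by exact: dF_via.
  apply: (dF_rel (R := fun g u => enc (g.2, u) ∈ graph g.1)); last by dfn.
  by move=> g u; rewrite graph_mem.
by dfn.
Qed.

Lemma dP_isetT (A : G -> iset T) (t : G -> T) : dF A -> dF t -> dP (fun g => A g (t g)).
Proof.
move=> Hf Ht.
have Hg : dF (@ext T ET) by exact: dF_via.
apply: (@dP_ext _ _ _ _ (fun g => enc (t g) ∈ ext (A g))); last by dfn.
by move=> g; rewrite ext_mem.
Qed.

Lemma dF_iset (A : G -> iset T) : dP (fun p : G * T => A p.1 p.2) -> dF A.
Proof.
move=> Hf; pose h g t := iset_val (A g) t.
have Hh : dP (fun p : G * T => h p.1 p.2) by [].
apply: (dF_rel (R := fun g (k : iset T) => forall t, iset_val k t <-> h g t)).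
  by move=> g k; split=> [-> //|H]; apply: isetP.
have Ha : dP (fun p : iset T * T => (fun k t => iset_val k t) p.1 p.2).
  have Hg : dF (@ext T ET) by exact: dF_via.
  apply: (@dP_ext _ _ _ _ (fun p : iset T * T => enc p.2 ∈ ext p.1)); last by dfn.
  by move=> g; rewrite ext_mem.
by dfn.
Qed.

End Closure.
End InternalFunctions.
Arguments ifun {S HS} T U {ET EU}.
Arguments iset {S} T {ET}.
Ltac dfn_ifun := lazymatch goal with
  | |- dF (fun t => ifun_val (@?f t) (@?g t)) => apply (@dF_apT _ _ _ _ _ _ _ _ f g)
  end.
Ltac dfn_iset := lazymatch goal with
  | |- dP (fun t => iset_val (@?f t) (@?g t)) => apply (@dP_isetT _ _ _ _ _ _ f g)
  end.
Ltac dfn_fun ::= first [dfn_nat0 | dfn_ifun].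
Ltac dfn_pred ::= first [dfn_ltn | dfn_iset].

(** * Arithmetic in the structure *)

Section Arithmetic.
Context {S : structure} {HS : zf S}.

Section Nat.
Context {T : Type} {ET : Enc S T}.

Lemma dF_addn (f g : T -> nat) : dF f -> dF g -> dF (fun t => f t + g t)%N.
Proof.
move=> Hf Hg; apply: (dF_app2 (h := addn)) => //.
apply: (dF_natrec (F := fun _ _ x => x.+1)) => [m n||]; first exact: addnS.
  by apply: (dF_rel (R := fun g x => x = g)) => [? ?|]; [rewrite addn0|dfn].
by dfn.
Qed.

Lemma dP_leq (f g : T -> nat) : dF f -> dF g -> dP (fun t => f t <= g t)%N.
Proof.
move=> Hf Hg; apply: (@dP_ext _ _ _ _ (fun t => f t < (g t).+1)%N) => //.
by apply: dP_ltn => //; apply: dF_succ.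
Qed.

Lemma dF_muln (f g : T -> nat) : dF f -> dF g -> dF (fun t => f t * g t)%N.
Proof.
move=> Hf Hg; apply: (dF_app2 (h := muln)) => //.
have H : dF (fun p : nat * nat => addn p.1 p.2).
  apply: (dF_natrec (F := fun _ _ x => x.+1)) => [m n||]; first exact: addnS.
    by apply: (dF_rel (R := fun g x => x = g)) => [? ?|]; [rewrite addn0|dfn].
  by dfn.
apply: (dF_natrec (F := fun m _ x => m + x)%N) => [m n||]; first exact: mulnS.
  by apply: (dF_rel (R := fun g x => x = 0%N)) => [? ?|]; [rewrite muln0|dfn].
by dfn.
Qed.
End Nat.

Ltac dfn_nat1 := lazymatch goal with
  | |- dF (fun t => Datatypes.S (@?f t)) => apply (@dF_succ _ _ _ _ f)
  | |- dF (fun t => addn (@?f t) (@?g t)) => apply (@dF_addn _ _ f g)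
  | |- dF (fun t => muln (@?f t) (@?g t)) => apply (@dF_muln _ _ f g)
  end.
Ltac dfn_fun ::= dfn_nat1.

Section Nat2.
Context {T : Type} {ET : Enc S T}.

Lemma dF_expn (f g : T -> nat) : dF f -> dF g -> dF (fun t => f t ^ g t)%N.
Proof.
move=> Hf Hg; apply: (dF_app2 (h := expn)) => //.
apply: (dF_natrec (F := fun m _ x => m * x)%N) => [m n||]; first exact: expnS.
  by apply: (dF_rel (R := fun g x => x = 1%N)) => [? ?|]; dfn.
by dfn.
Qed.

Lemma dP_dvdn (f g : T -> nat) : dF f -> dF g -> dP (fun t => f t %| g t)%N.
Proof.
move=> Hf Hg; apply: (@dP_ext _ _ _ _ (fun t => exists k, g t = k * f t)%N); last by dfn.
by move=> t; split=> /dvdnP.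
Qed.
End Nat2.

Ltac dfn_nat2 := lazymatch goal with
  | |- dP (fun t => is_true (dvdn (@?f t) (@?g t))) => apply (@dP_dvdn _ _ f g)
  | |- dP (fun t => is_true (leq (Datatypes.S (@?f t)) (@?g t))) => apply (@dP_ltn _ _ _ _ f g)
  | |- dP (fun t => is_true (leq (@?f t) (@?g t))) => apply (@dP_leq _ _ f g)
  end.
Ltac dfn_pred ::= dfn_nat2.

Lemma dF_fact T {ET : Enc S T} (f : T -> nat) : dF f -> dF (fun t => (f t)`!).
Proof.
move=> Hf; apply: (dF_app1 (g := factorial)) => //.
have H : dF (fun p : nat * nat => (fun _ n => n`!) p.1 p.2).
  apply: (dF_natrec (h := fun (_ : nat) n => n`!) (F := fun m n x => n.+1 * x)%N) => [m n||]; first exact: factS.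
    by dfn.
  by dfn.
by apply: (dF_app1 (g := fun p : nat * nat => p.2`!) (f := fun n => (n, n))) => //; dfn.
Qed.

Lemma dP_prime T {ET : Enc S T} (f : T -> nat) : dF f -> dP (fun t => prime (f t)).
Proof.
move=> Hf; apply: (@dP_ext _ _ _ _ (fun t => 1 < f t /\
   forall d, d %| f t -> d = 1 \/ d = f t)%N); last by dfn.
move=> t; split=> [p|[p1 H]].
  by have /primeP [p1 H] := p; split=> // d /H /orP[/eqP|/eqP]; auto.
apply/primeP; split=> // d /H [->|->]; rewrite eqxx ?orbT //.
Qed.

Definition bool_enc : dP (fun n => exists b : bool, n = nat_of_bool b).
Proof.
apply: (@dP_ext _ _ _ _ (fun n => n = 0 \/ n = 1)); last by dfn.
by move=> n; split=> [[[] ->]|[->|->]]; [right|left|exists false|exists true].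
Qed.

Lemma nat_of_bool_inj : injective nat_of_bool.
Proof. by do 2 case. Qed.

#[global] Instance Enc_bool : Enc S bool := enc_via nat_of_bool_inj bool_enc.

Lemma dP_bool T {ET : Enc S T} (b : T -> bool) : dF b -> dP (fun t => is_true (b t)).
Proof. by move=> Hb; apply: dP_eq => //; apply: dF_const. Qed.

Lemma dF_asbool T {ET : Enc S T} (P : T -> Prop) : dP P -> dF (fun t => `[< P t >]).
Proof.
move=> Hb; apply: (dF_rel (R := fun t b => (b = true /\ P t) \/ (b = false /\ ~ P t))).
  by move=> t u; case: asboolP => Pt; split=> [->|[[-> //]|[-> //]]]; [left|right].
by dfn.
Qed.

(** ** Integers *)

Definition int_pair (z : int) : nat * nat :=
  match z with Posz n => (n, 0%N) | Negz n => (0%N, n.+1) end.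

Lemma int_pair_inj : injective int_pair.
Proof. by case=> m [] n //= [->]. Qed.

Lemma int_enc : dP (fun p => exists z, p = int_pair z).
Proof.
apply: (@dP_ext _ _ _ _ (fun p => p.2 = 0 \/ p.1 = 0)); last by dfn.
move=> [m n] /=; split=> [[[z|z] [-> ->]]|]; [by left|by right|].
case=> ->; first by exists (Posz m).
by case: n => [|n]; [exists (Posz 0)|exists (Negz n)].
Qed.

#[global] Instance Enc_int : Enc S int := enc_via int_pair_inj int_enc.

Lemma enc_intP (v : S) z : is_int v z <-> v = enc z.
Proof.
rewrite /is_int; split.
  by move=> [a [b [/opairP ->]]]; case: z => n [/enc_numP -> /enc_numP ->].
move=> ->; exists (enc (int_pair z).1), (enc (int_pair z).2).
split; first exact/opairP.
by case: z => n; split; apply/enc_numP.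
Qed.

(** Differences that need not be reduced: through them the sum, product and order of integers are
    expressed by natural numbers without cases on signs. *)
Definition isub (a b : nat) : int := (a%:Z - b%:Z)%R.

Lemma isubP z : exists a b, z = isub a b.
Proof.
by case: z => n; [exists n, 0%N; rewrite /isub subr0|exists 0%N, n.+1; rewrite /isub sub0r NegzE].
Qed.

Section Int.
Context {T : Type} {ET : Enc S T}.

Lemma dF_isub (f g : T -> nat) : dF f -> dF g -> dF (fun t => isub (f t) (g t)).
Proof.
move=> Hf Hg; apply: (dF_app2 (h := isub)) => //.
have Hi : dF int_pair by exact: dF_via.
apply: (dF_rel (R := fun p z => (p.1 + (int_pair z).2 = p.2 + (int_pair z).1)%N)); last by dfn.
by move=> [a b] z; rewrite /isub /=; case: z => n /=; lia.
Qed.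
End Int.

Ltac dfn_int1 := lazymatch goal with
  | |- dF (fun t => isub (@?f t) (@?g t)) => apply (@dF_isub _ _ f g)
  end.
Ltac dfn_fun ::= first [dfn_nat1 | dfn_int1].

Section Int2.
Context {T : Type} {ET : Enc S T}.

Lemma dF_addz (f g : T -> int) : dF f -> dF g -> dF (fun t => f t + g t)%R.
Proof.
move=> Hf Hg; apply: (dF_rel (R := fun t z => exists a b c d,
  f t = isub a b /\ g t = isub c d /\ z = isub (a + c) (b + d))); last by dfn.
move=> t z; split.
  have [a [b E]] := isubP (f t); have [c [d E']] := isubP (g t); move=> ->.
  by exists a, b, c, d; rewrite E E' /isub; split=> //; split=> //; lia.
by move=> [a [b [c [d [-> [-> ->]]]]]]; rewrite /isub; lia.
Qed.

Lemma dF_mulz (f g : T -> int) : dF f -> dF g -> dF (fun t => f t * g t)%R.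
Proof.
move=> Hf Hg; apply: (dF_rel (R := fun t z => exists a b c d,
  f t = isub a b /\ g t = isub c d /\ z = isub (a * c + b * d) (a * d + b * c))); last by dfn.
have E a b c d : isub (a * c + b * d) (a * d + b * c) = (isub a b * isub c d)%R.
  by rewrite /isub !PoszD !PoszM; ring.
move=> t z; split.
  have [a [b E1]] := isubP (f t); have [c [d E2]] := isubP (g t); move=> ->.
  by exists a, b, c, d; rewrite E E1 E2.
by move=> [a [b [c [d [-> [-> ->]]]]]]; rewrite E.
Qed.

Lemma dF_Posz (f : T -> nat) : dF f -> dF (fun t => Posz (f t)).
Proof.
move=> Hf; apply: (dF_rel (R := fun t z => z = isub (f t) 0)); last by dfn.
by move=> t u; rewrite /isub subr0.
Qed.

Lemma dF_absz (f : T -> int) : dF f -> dF (fun t => `|f t|%N).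
Proof.
move=> Hf; apply: (dF_rel (R := fun t n => f t = isub n 0 \/ f t = isub 0 n)); last by dfn.
move=> t u; rewrite /isub; split; first by move=> ->; lia.
by case=> ->; lia.
Qed.

Lemma dP_lez (f g : T -> int) : dF f -> dF g -> dP (fun t => f t <= g t)%R.
Proof.
move=> Hf Hg; apply: (@dP_ext _ _ _ _ (fun t => exists a b c, f t = isub a b /\ g t = isub (a + c) b)); last by dfn.
move=> t; split; last by move=> [a [b [c [-> ->]]]]; rewrite /isub; lia.
move=> H; have [a [b E]] := isubP (f t); exists a, b, `|g t - f t|%N.
by move: E H; rewrite /isub; lia.
Qed.
End Int2.

Ltac dfn_int2 := lazymatch goal with
  | |- dF (fun t => GRing.add (@?f t) (@?g t)) => apply (@dF_addz _ _ f g)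
  | |- dF (fun t => GRing.mul (@?f t) (@?g t)) => apply (@dF_mulz _ _ f g)
  | |- dF (fun t => Posz (@?f t)) => apply (@dF_Posz _ _ f)
  | |- dF (fun t => absz (@?f t)) => apply (@dF_absz _ _ f)
  end.
Ltac dfn_lez := lazymatch goal with
  | |- dP (fun t => is_true (@?f t <= @?g t)%R) => apply (@dP_lez _ _ f g)
  end.
Ltac dfn_fun ::= first [dfn_nat1 | dfn_int2].
Ltac dfn_pred ::= first [dfn_nat2 | dfn_lez].

Lemma dP_dvdz T {ET : Enc S T} (f g : T -> int) : dF f -> dF g -> dP (fun t => f t %| g t)%Z.
Proof.
move=> Hf Hg; apply: (@dP_ext _ _ _ _ (fun t => exists k, g t = k * f t)%R); last by dfn.
by move=> t; split=> /dvdzP.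
Qed.

Lemma small_int : small int.
Proof. by apply: (small_inj (f := int_pair)); [exact: dF_via|exact: int_pair_inj|apply: small_prod; apply: small_nat]. Qed.

(** ** Rational numbers *)

Definition rat_pair (q : rat) : int * int := (numq q, denq q).

Lemma rat_pair_inj : injective rat_pair.
Proof. by move=> q r [E1 E2]; rewrite -[q]divq_num_den -[r]divq_num_den E1 E2. Qed.

Lemma rat_enc : dP (fun p => exists q, p = rat_pair q).
Proof.
apply: (@dP_ext _ _ _ _ (fun p => (1 <= p.2)%R /\
  forall d : nat, (d %| `|p.1| -> d %| `|p.2| -> d = 1)%N)); last by dfn.
move=> [a b]; split.
  move=> [q [-> ->]] /=; split; first by move: (denq_gt0 q); lia.
  move=> d da db; have := dvdn_gcd d `|numq q| `|denq q|; rewrite da db /=.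
  by have := coprime_num_den q; rewrite /coprime => /eqP ->; rewrite dvdn1 => /eqP.
move=> /= [b1 H]; exists (a%:Q / b%:Q)%R.
have b0 : (0 < b)%R by move: b1; lia.
have cp : coprime `|a| `|b| by rewrite /coprime; apply/eqP/H; [apply: dvdn_gcdl|apply: dvdn_gcdr].
rewrite /rat_pair coprimeq_num // coprimeq_den // Num.Theory.gtr0_sg // mul1r.
by rewrite Num.Theory.gtr0_norm //; case: eqP b0 => // ->.
Qed.

#[global] Instance Enc_rat : Enc S rat := enc_via rat_pair_inj rat_enc.

Lemma enc_ratP (v : S) q : is_rat v q <-> v = enc q.
Proof.
rewrite /is_rat; split.
  by move=> [a [b [/opairP ->]]] [/enc_intP -> /enc_intP ->].
move=> ->; exists (enc (numq q)), (enc (denq q)).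
by split; [exact/opairP|split; apply/enc_intP].
Qed.

Lemma small_rat : small rat.
Proof. by apply: (small_inj (f := rat_pair)); [exact: dF_via|exact: rat_pair_inj|apply: small_prod; apply: small_int]. Qed.

Section Rat.
Context {T : Type} {ET : Enc S T}.

Lemma dF_numq (f : T -> rat) : dF f -> dF (fun t => numq (f t)).
Proof.
have H : dF rat_pair by exact: dF_via.
by move=> Hf; apply: (@dP_ext _ _ _ _ (fun p => p.2 = (rat_pair (f p.1)).1)) => //; dfn.
Qed.

Lemma dF_denq (f : T -> rat) : dF f -> dF (fun t => denq (f t)).
Proof.
have H : dF rat_pair by exact: dF_via.
by move=> Hf; apply: (@dP_ext _ _ _ _ (fun p => p.2 = (rat_pair (f p.1)).2)) => //; dfn.
Qed.
End Rat.

Ltac dfn_rat := lazymatch goal with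
  | |- dF (fun t => numq (@?f t)) => apply (@dF_numq _ _ f)
  | |- dF (fun t => denq (@?f t)) => apply (@dF_denq _ _ f)
  end.
Ltac dfn_fun ::= first [dfn_int2 | dfn_rat].

Lemma dF_addq T {ET : Enc S T} (f g : T -> rat) : dF f -> dF g -> dF (fun t => f t + g t)%R.
Proof.
move=> Hf Hg; apply: (dF_rel (R := fun t q => numq q * (denq (f t) * denq (g t)) =
  (numq (f t) * denq (g t) + numq (g t) * denq (f t)) * denq q)%R); last by dfn.
move=> t q.
have D (r : rat) : ((denq r)%:Q != 0)%R by rewrite intr_eq0 denq_neq0.
have -> : (q = f t + g t)%R <-> ((numq q)%:Q / (denq q)%:Q = (numq (f t))%:Q / (denq (f t))%:Q +
   (numq (g t))%:Q / (denq (g t))%:Q)%R by rewrite !divq_num_den.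
split=> [E|E].
  apply: (@intr_inj rat); rewrite !(intrM, intrD).
  have {}E : ((numq q)%:Q = ((numq (f t))%:Q / (denq (f t))%:Q +
   (numq (g t))%:Q / (denq (g t))%:Q) * (denq q)%:Q)%R by rewrite -E divfK.
  by rewrite E; field; rewrite !D.
have /= := congr1 (fun z : int => z%:Q%R) E; rewrite !(intrM, intrD) => {}E.
apply: (mulIf (D q)); rewrite divfK //; apply: (mulIf (D (f t))); apply: (mulIf (D (g t))).
by rewrite -mulrA E; field; rewrite !D.
Qed.

End Arithmetic.
Ltac dfn_fun0 := lazymatch goal with
  | |- dF (fun t => ifun_val (@?f t) (@?g t)) => apply (@dF_apT _ _ _ _ _ _ _ _ f g)
  | |- dF (fun t => Datatypes.S (@?f t)) => apply (@dF_succ _ _ _ _ f)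
  | |- dF (fun t => addn (@?f t) (@?g t)) => apply (@dF_addn _ _ _ _ f g)
  | |- dF (fun t => muln (@?f t) (@?g t)) => apply (@dF_muln _ _ _ _ f g)
  | |- dF (fun t => expn (@?f t) (@?g t)) => apply (@dF_expn _ _ _ _ f g)
  | |- dF (fun t => factorial (@?f t)) => apply (@dF_fact _ _ _ _ f)
  | |- dF (fun t => isub (@?f t) (@?g t)) => apply (@dF_isub _ _ _ _ f g)
  | |- dF (fun t => Posz (@?f t)) => apply (@dF_Posz _ _ _ _ f)
  | |- dF (fun t => absz (@?f t)) => apply (@dF_absz _ _ _ _ f)
  | |- dF (fun t => numq (@?f t)) => apply (@dF_numq _ _ _ _ f)
  | |- dF (fun t => denq (@?f t)) => apply (@dF_denq _ _ _ _ f)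
  | |- dF (fun t => asbool (@?f t)) => apply (@dF_asbool _ _ _ _ f)
  | |- dF (fun t => GRing.mul (@?f t) (@?g t)) => apply (@dF_mulz _ _ _ _ f g)
  | |- dF (fun t => @GRing.add _ (@?f t) (@?g t)) =>
    first [apply (@dF_addz _ _ _ _ f g) | apply (@dF_addq _ _ _ _ f g)]
  end.
Ltac dfn_pred0 := lazymatch goal with
  | |- dP (fun t => iset_val (@?f t) (@?g t)) => apply (@dP_isetT _ _ _ _ _ _ f g)
  | |- dP (fun t => is_true (dvdn (@?f t) (@?g t))) => apply (@dP_dvdn _ _ _ _ f g)
  | |- dP (fun t => is_true (in_mem _ _)) => apply dP_dvdz
  | |- dP (fun t => is_true (leq (Datatypes.S (@?f t)) (@?g t))) => apply (@dP_ltn _ _ _ _ f g)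
  | |- dP (fun t => is_true (leq (@?f t) (@?g t))) => apply (@dP_leq _ _ _ _ f g)
  | |- dP (fun t => is_true (prime (@?f t))) => apply (@dP_prime _ _ _ _ f)
  | |- dP (fun t => is_true (@?f t <= @?g t)%R) => apply (@dP_lez _ _ _ _ f g)
  | |- dP (fun t => is_true (@?f t)) => apply (@dP_bool _ _ _ _ f)
  end.
Ltac dfn_fun ::= dfn_fun0.
Ltac dfn_pred ::= dfn_pred0.

Local Open Scope ring_scope.

(** * Internal abelian groups *)

Class igrp {S : structure} {HS : zf S} (V : zmodType) {EV : Enc S V} : Prop := {
  igrp_add : dF (fun p : V * V => p.1 + p.2);
  igrp_small : small V }.
Arguments igrp {S HS} V {EV}.
#[global] Hint Mode igrp - - + - : typeclass_instances.

Definition gdvd (V : zmodType) (n : nat) (x : V) := exists z, x = z *+ n.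

Section GroupOps.
Context {S : structure} {HS : zf S} {V : zmodType} {EV : Enc S V} {IV : igrp V}.
Context {T : Type} {ET : Enc S T}.

Lemma dF_add (f g : T -> V) : dF f -> dF g -> dF (fun t => f t + g t).
Proof. by have H := @igrp_add S HS V EV IV; move=> Hf Hg; apply: (dF_app2 (h := fun x y : V => x + y)). Qed.

Lemma dF_opp (f : T -> V) : dF f -> dF (fun t => - f t).
Proof.
move=> Hf; apply: (dF_rel (R := fun t u => u + f t = 0)).
  by move=> t u; rewrite -[- _]add0r; split=> [->|<-]; rewrite ?subrK ?addrK.
have H := @igrp_add S HS V EV IV; have H' : dF (fun p : V * V => (fun x y => x + y) p.1 p.2) by [].
by dfn.
Qed.
End GroupOps.
Ltac dfn_add := lazymatch goal with
  | |- @dF _ _ _ ?U _ _ (fun t => GRing.add (@?f t) (@?g t)) =>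
    apply (@dF_add _ _ U _ _ _ _ f g)
  | |- @dF _ _ _ ?U _ _ (fun t => GRing.opp (@?f t)) => apply (@dF_opp _ _ U _ _ _ _ f)
  end.
Ltac dfn_fun ::= first [dfn_fun0 | dfn_add].

Section GroupOps2.
Context {S : structure} {HS : zf S} {V : zmodType} {EV : Enc S V} {IV : igrp V}.
Context {T : Type} {ET : Enc S T}.

Lemma dF_mulrn (f : T -> V) (n : T -> nat) : dF f -> dF n -> dF (fun t => f t *+ n t).
Proof.
move=> Hf Hn; apply: (dF_app2 (h := fun (x : V) m => x *+ m)) => //.
apply: (dF_natrec (h := fun (x : V) m => x *+ m) (F := fun x _ y => x + y)).
- by move=> x m; rewrite mulrS.
- apply: (@dP_ext _ _ _ _ (fun p : V * V => p.2 = 0)); last by dfn.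
  by move=> p; rewrite mulr0n.
by dfn.
Qed.

Lemma dP_gdvd (f : T -> V) (n : T -> nat) : dF f -> dF n -> dP (fun t => gdvd (n t) (f t)).
Proof.
move=> Hf Hn.
have H : dF (fun p : V * nat => (fun (x : V) m => x *+ m) p.1 p.2).
  apply: (dF_natrec (h := fun (x : V) m => x *+ m) (F := fun x _ y => x + y)).
  - by move=> x m; rewrite mulrS.
  - apply: (@dP_ext _ _ _ _ (fun p : V * V => p.2 = 0)); last by dfn.
    by move=> p; rewrite mulr0n.
  by dfn.
apply: (@dP_ext _ _ _ _ (fun t => exists z, f t = z *+ n t)) => //; by dfn.
Qed.
End GroupOps2.
Ltac dfn_natmul := lazymatch goal with
  | |- @dF _ _ _ ?U _ _ (fun t => GRing.natmul (@?f t) (@?n t)) =>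
    apply (@dF_mulrn _ _ U _ _ _ _ f n)
  end.
Ltac dfn_gdvd := lazymatch goal with
  | |- dP (fun t => gdvd _ _) => apply dP_gdvd
  end.
Ltac dfn_fun ::= first [dfn_fun0 | dfn_add | dfn_natmul].
Ltac dfn_pred ::= first [dfn_gdvd | dfn_pred0].

Section GroupOps3.
Context {S : structure} {HS : zf S} {V : zmodType} {EV : Enc S V} {IV : igrp V}.
Context {T : Type} {ET : Enc S T}.

Lemma dF_mulrz (f : T -> V) (n : T -> int) : dF f -> dF n -> dF (fun t => f t *~ n t).
Proof.
move=> Hf Hn.
apply: (dF_rel (R := fun t u => exists a b, n t = isub a b /\ u = f t *+ a - f t *+ b));
  last by dfn.
have E x a b : x *~ isub a b = x *+ a - x *+ b :> V by rewrite /isub mulrzBr.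
move=> t u; split; last by move=> [a [b [-> ->]]].
by have [a [b Eab]] := isubP (n t); move=> ->; exists a, b; rewrite Eab.
Qed.

Lemma dF_sumn (F : T -> nat -> V) (n : T -> nat) :
  dF (fun p : T * nat => F p.1 p.2) -> dF n -> dF (fun t => \sum_(0 <= i < n t) F t i).
Proof.
move=> HF Hn; pose h t m : V := \sum_(0 <= i < m) F t i.
have H : dF (fun p : T * nat => h p.1 p.2).
  apply: (dF_natrec (F := fun t m y => y + F t m)).
  - by move=> t m; rewrite /h big_nat_recr.
  - apply: (@dP_ext _ _ _ _ (fun p : T * V => p.2 = 0)); last by dfn.
    by move=> p; rewrite /h big_nil.
  by dfn.
apply: (@dP_ext _ _ _ _ (fun p => p.2 = h p.1 (n p.1))) => //; by dfn.
Qed.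
End GroupOps3.
Ltac dfn_intmul := lazymatch goal with
  | |- @dF _ _ _ ?U _ _ (fun t => intmul (@?f t) (@?n t)) =>
    apply (@dF_mulrz _ _ U _ _ _ _ f n)
  | |- @dF _ _ _ ?U _ _ (fun t => \sum_(0 <= i < @?n t) (@?F t i)) =>
    apply (@dF_sumn _ _ U _ _ _ _ F n)
  end.
Ltac dfn_fun ::= first [dfn_fun0 | dfn_add | dfn_natmul | dfn_intmul].

#[global] Instance igrp_int {S} {HS : zf S} : @igrp S HS int Enc_int.
Proof. by split; [dfn|apply: small_int]. Qed.

#[global] Instance igrp_rat {S} {HS : zf S} : @igrp S HS rat Enc_rat.
Proof. by split; [dfn|apply: small_rat]. Qed.

#[global] Instance igrp_prod {S} {HS : zf S} (V W : zmodType) {EV : Enc S V} {EW : Enc S W}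
  {IV : igrp V} {IW : igrp W} : @igrp S HS (V * W)%type (Enc_prod (ET := EV) (EU := EW)).
Proof.
split; last by apply: small_prod; apply: igrp_small.
by apply: (@dP_ext _ _ _ _ (fun p => p.2 = (p.1.1.1 + p.1.2.1, p.1.1.2 + p.1.2.2))) => //; dfn.
Qed.

(** ** The groups of the structure as types *)

Section Coded.
Context {S : structure} {HS : zf S}.

Definition cgrp (V : zmodType) {EV : Enc S V} : grp S := coded (fun u (x : V) => u = enc x).
Arguments cgrp V {EV}.

Lemma grp_ext (G H : grp S) : (forall x, car G x <-> car H x) ->
  (forall x y z, Defs.add G x y z <-> Defs.add H x y z) -> G = H.
Proof.
case: G H => c a [c' a'] /= Hc Ha; congr Grp.
  by apply: funext => x; apply: propext.
by apply: funext => x; apply: funext => y; apply: funext => z; apply: propext.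
Qed.

Lemma cgrp_add (V : zmodType) {EV : Enc S V} (x y z : V) :
  Defs.add (cgrp V) (enc x) (enc y) (enc z) <-> z = x + y.
Proof. by split=> [[x' [y' [E [E' E2]]]]|->]; [einj|exists x, y]. Qed.

Lemma cgrp_zero (V : zmodType) {EV : Enc S V} (x : S) : is_zero (cgrp V) x <-> x = enc (0 : V).
Proof.
split=> [[[z ->] H]|->]; last first.
  by split=> [|_ [a ->]]; [exists 0|apply/cgrp_add; rewrite add0r].
have /H/cgrp_add/eqP : car (cgrp V) (enc z) by exists z.
by rewrite -subr_eq0 opprD addrA subrr sub0r oppr_eq0 => /eqP ->.
Qed.

Lemma cgrp_is_grp (V : zmodType) {EV : Enc S V} {IV : igrp V} : is_grp (cgrp V).
Proof.
split; first exact: igrp_small.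
split.
  have [b Hb] := @image_set S HS _ _ _ _ (fun p : V * V => (p.1, p.2, p.1 + p.2))
    (small_prod igrp_small igrp_small) ltac:(dfn).
  exists b => w; rewrite Hb; split.
    move=> [[x y] ->]; exists (enc x), (enc y), (enc (x + y)), (enc (x, y)).
    by split; [exact/cgrp_add|split; apply/opairP].
  move=> [_ [_ [_ [u [[x [y [-> [-> ->]]]] [/opairP -> /opairP ->]]]]]].
  by exists (x, y).
split; first by move=> _ _ _ [x [y [-> [-> ->]]]]; split; [exists x|split; [exists y|exists (x + y)]].
split.
  move=> _ _ [x ->] [y ->]; exists (enc (x + y)); split; first exact/cgrp_add.
  by move=> _ [x' [y' [E [E' ->]]]]; einj.
split; first by move=> a b c [x [y [-> [-> ->]]]]; apply/cgrp_add; rewrite addrC.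
split.
  move=> a b c ab bc s [x [y [? [? ?]]]] [y' [z [? [? ?]]]] [t [z' [? [? ?]]]].
  by subst; einj; apply/cgrp_add; rewrite addrA.
exists (enc (0 : V)); split; first exact/cgrp_zero.
by move=> _ [x ->]; exists (enc (- x)); apply/cgrp_add; rewrite subrr.
Qed.

Lemma cgrp_nmul (V : zmodType) {EV : Enc S V} n (x y : V) :
  nmul (cgrp V) n (enc x) (enc y) <-> y = x *+ n.
Proof.
elim: n y => [|n IH] y /=; first by rewrite cgrp_zero mulr0n; split=> [E|->]; einj.
split=> [[w [H [z [x' [Ew [E E']]]]]]|->]; last first.
  by exists (enc (x *+ n)); split; [exact/IH|apply/cgrp_add; rewrite mulrSr].
by subst w; einj; move/IH: H => ->; rewrite mulrSr.
Qed.

Lemma app_graph T U {ET : Enc S T} {EU : Enc S U} (f : ifun T U) x y :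
  app (graph f) x y <-> exists t, x = enc t /\ y = enc (f t).
Proof.
split=> [[w [/graphP [t ->] /opairP E]]|[t [-> ->]]].
  by rewrite /enc /= in E; case/opair_inj: E => <- <-; exists t.
by exists (enc (t, f t)); split; [apply/graphP; exists t|apply/opairP].
Qed.

Lemma app_graph_enc T U {ET : Enc S T} {EU : Enc S U} (f : ifun T U) t y :
  app (graph f) (enc t) y <-> y = enc (f t).
Proof.
rewrite app_graph; split=> [[t' [E ->]]|->]; last by exists t.
by einj.
Qed.

Lemma is_map_graph T U {ET : Enc S T} {EU : Enc S U} (f : S) :
  is_map f (fun x => exists t : T, x = enc t) (fun y => exists u : U, y = enc u) <->
  exists g : ifun T U, f = graph g.
Proof.
split=> [[Hf Ha]|[g ->]]; last first.
  split=> [w /graphP [t ->]|_ [t ->]].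
    exists (enc t), (enc (g t)); split; first by exists t.
    by split; [exists (g t)|apply/opairP].
  by exists (enc (g t)); split=> [|y]; rewrite app_graph_enc.
have H (t : T) : exists u : U, app f (enc t) (enc u).
  have [|y [[w [wf Hp]] _]] := Ha (enc t); first by exists t.
  have [a [b [_ [[u Eb] Hp']]]] := Hf _ wf.
  have [_ E] := pair_inj Hp Hp'; exists u; exists w; split=> //.
  by rewrite -Eb -E.
pose g t := sval (cid (H t)).
have gP t : app f (enc t) (enc (g t)) by exact: (svalP (cid (H t))).
have Hs : forall w, w ∈ f <-> exists t, w = enc (t, g t).
  move=> w; split=> [wf|[t ->]]; last by have [w' [Hw /opairP E]] := gP t; rewrite /enc /= -E.
  have [_ [_ [[t ->] [[u ->] Hp]]]] := Hf _ wf; exists t.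
  have [|y [_ Hy]] := Ha (enc t); first by exists t.
  have E1 := Hy _ (gP t); have E2 : y = enc u by apply: Hy; exists w.
  by move/opairP: Hp => ->; rewrite -E2 E1.
have Hg : is_set (fun w : S => exists t, w = enc (t, g t)) by exists f.
by exists (IFun Hg); apply: set_ext => w; rewrite Hs graphP.
Qed.

Lemma map_inj_graph T U {ET : Enc S T} {EU : Enc S U} (f : ifun T U) : map_inj (graph f) <-> injective f.
Proof.
split=> [H x y E|H a a' b /app_graph [t [-> ->]] /app_graph [t' [-> E]]].
  have : (enc x : S) = enc y; last by move=> ?; einj.
  by apply: (H _ _ (enc (f x))); apply/app_graph_enc; rewrite ?E.
by einj; rewrite (H _ _ E).
Qed.

Lemma map_onto_graph T U {ET : Enc S T} {EU : Enc S U} (f : ifun T U) :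
  map_onto (graph f) (fun y => exists u : U, y = enc u) <-> forall y, exists x, y = f x.
Proof.
split=> [H y|H _ [y ->]].
  have [|a /app_graph [x [_ E]]] := H (enc y); first by exists y.
  by exists x; einj.
by have [x ->] := H y; exists (enc x); apply/app_graph_enc.
Qed.
Section Homs.
Context {V W : zmodType} {EV : Enc S V} {EW : Enc S W}.

Definition ihom (f : ifun V W) := forall x y, f (x + y) = f x + f y.

Lemma is_hom_graph (f : S) : is_hom f (cgrp V) (cgrp W) <->
  exists g : ifun V W, f = graph g /\ ihom g.
Proof.
rewrite /is_hom; split=> [[/is_map_graph [g ->] H]|[g [-> H]]].
  exists g; split=> // x y; apply/cgrp_add; apply: (H (enc x) (enc y) (enc (x + y))).
  - by apply/cgrp_add.
  - by apply/app_graph_enc.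
  - by apply/app_graph_enc.
  - by apply/app_graph_enc.
split; first by apply/is_map_graph; exists g.
move=> _ _ _ a' b' c' [x [y [-> [-> ->]]]] /app_graph_enc -> /app_graph_enc -> /app_graph_enc ->.
by apply/cgrp_add; rewrite H.
Qed.

Lemma ihom0 f : ihom f -> f 0 = 0.
Proof. by move=> Hf; have /eqP := Hf 0 0; rewrite addr0 -subr_eq0 opprD addrA subrr sub0r oppr_eq0 => /eqP. Qed.

Lemma ihomN f x : ihom f -> f (- x) = - f x.
Proof.
by move=> Hf; apply/eqP; rewrite -addr_eq0 -Hf addNr ihom0.
Qed.

Lemma ihomB f x y : ihom f -> f (x - y) = f x - f y.
Proof. by move=> Hf; rewrite Hf ihomN. Qed.

Lemma ihomMn f x n : ihom f -> f (x *+ n) = f x *+ n.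
Proof. by move=> Hf; elim: n => [|n IH]; rewrite ?mulr0n ?ihom0 // !mulrS Hf IH. Qed.

Lemma ihom_dvd f n x : ihom f -> gdvd n x -> gdvd n (f x).
Proof. by move=> Hf [z ->]; exists (f z); rewrite ihomMn. Qed.

End Homs.
End Coded.
Arguments cgrp {S} V {EV}.

Section FromGrp.
Context {S : structure} {HS : zf S} (G : grp S) (HG : is_grp G).

(** The dummy [let] makes the type mention [HG], so that the group structure below, built from this
    proof, can be attached to it. *)
Definition gel : Type := let _ := HG in {v : S | car G v}.
HB.instance Definition _ := gen_eqMixin gel.
HB.instance Definition _ := gen_choiceMixin gel.

Lemma gel_dom : dP (fun v : S => exists x : gel, v = sval x).
Proof.
have [[a Ha] _] := HG.
apply: (@dP_ext _ _ _ _ (fun v : S => v ∈ a)); last by dfn.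
by move=> v; rewrite Ha; split=> [[[w Hw] -> //]|Hv]; exists (exist _ v Hv).
Qed.

Lemma gel_inj : injective (fun x : gel => sval x).
Proof. by move=> [x Hx] [y Hy] /= E; subst; congr exist. Qed.

#[global] Instance Enc_gel : Enc S gel := enc_via gel_inj gel_dom.

Lemma gel_add_ex (x y : gel) : exists z : gel, Defs.add G (sval x) (sval y) (sval z).
Proof.
have [_ [_ [Hc [Hf _]]]] := HG.
have [z [Hz _]] := Hf _ _ (svalP x) (svalP y).
by have [_ [_ cz]] := Hc _ _ _ Hz; exists (exist _ z cz).
Qed.

Definition gel_add (x y : gel) : gel := sval (cid (gel_add_ex x y)).

Lemma gel_addP x y (z : gel) : Defs.add G (sval x) (sval y) (sval z) <-> z = gel_add x y.
Proof.
have H : Defs.add G (sval x) (sval y) (sval (gel_add x y)) by exact: (svalP (cid (gel_add_ex x y))).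
split=> [H'|-> //]; apply: gel_inj.
have [_ [_ [Hc [Hf _]]]] := HG.
have [w [_ Hw]] := Hf _ _ (svalP x) (svalP y).
by rewrite -(Hw _ H) -(Hw _ H').
Qed.

Lemma gel_addC : commutative gel_add.
Proof.
have [_ [_ [_ [_ [Hc _]]]]] := HG.
by move=> x y; apply/gel_addP/Hc/gel_addP.
Qed.

Lemma gel_addA : associative gel_add.
Proof.
have [_ [_ [_ [_ [_ [Ha _]]]]]] := HG.
move=> x y z; apply/esym/gel_addP; apply: (Ha _ _ _ (sval (gel_add x y)) _ _ _ _ _).
- exact/gel_addP.
- exact/gel_addP.
- exact/gel_addP.
Qed.

Lemma gel_zero_ex : exists z : gel, is_zero G (sval z) /\
  forall a : gel, exists b : gel, z = gel_add a b.
Proof.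
have [_ [_ [Hc [_ [_ [_ [z [Hz H]]]]]]]] := HG.
exists (exist _ z (proj1 Hz)); split=> // a; have [b Hb] := H _ (svalP a).
have [_ [cb _]] := Hc _ _ _ Hb.
by exists (exist _ b cb); apply/gel_addP.
Qed.

Definition gel_zero : gel := sval (cid gel_zero_ex).

Lemma gel_add0 : left_id gel_zero gel_add.
Proof.
move=> x; apply/esym/gel_addP.
have [H _] := svalP (cid gel_zero_ex); exact: (proj2 H _ (svalP x)).
Qed.

Lemma gel_opp_ex (x : gel) : exists y, gel_zero = gel_add x y.
Proof. by have [_ H] := svalP (cid gel_zero_ex); apply: H. Qed.

Definition gel_opp x : gel := sval (cid (gel_opp_ex x)).

Lemma gel_addN : left_inverse gel_zero gel_opp gel_add.
Proof. by move=> x; rewrite gel_addC; have := svalP (cid (gel_opp_ex x)). Qed.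

HB.instance Definition _ := GRing.isZmodule.Build gel gel_addA gel_addC gel_add0 gel_addN.

Lemma gel_addE (x y : gel) : x + y = gel_add x y. Proof. by []. Qed.

#[global] Instance igrp_gel : igrp gel.
Proof.
have Hs : dF (fun x : gel => sval x) by exact: dF_via.
split; last by have [[a Ha] _] := HG; exists a => v; rewrite Ha; split=> [Hv|[[x Hx] ->]//]; exists (exist _ v Hv).
have [_ [[a Ha] [Hc _]]] := HG.
apply: (@dP_ext _ _ _ _ (fun p => enc (sval p.1.1, sval p.1.2, sval p.2) ∈ a)); last by dfn.
move=> [[x y] z] /=; rewrite gel_addE -gel_addP Ha; split=> [H|].
  by exists (sval x), (sval y), (sval z), (enc (sval x, sval y)); split=> //; split; apply/opairP.
move=> [b [c [d [u [H [/opairP E /opairP E']]]]]].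
subst u; have [E1 E2] := opair_inj (E' : opair (opair (sval x) (sval y)) (sval z) = _).
by have [-> ->] := opair_inj E1; rewrite E2.
Qed.

Lemma cgrp_gel : cgrp gel = G.
Proof.
have [_ [_ [Hc _]]] := HG.
apply: grp_ext => [v|u v w].
  by split=> [[[x Hx] ->]//|Hv]; exists (exist _ v Hv).
split=> [[x [y [-> [-> ->]]]]|H]; first by apply/gel_addP.
have [cu [cv cw]] := Hc _ _ _ H.
exists (exist _ u cu), (exist _ v cv); split=> //; split=> //.
rewrite gel_addE; have <- // : exist _ w cw = gel_add (exist _ u cu) (exist _ v cv).
by apply/gel_addP.
Qed.
End FromGrp.

Section Pure.
Context {S : structure} {HS : zf S}.

Definition ipure (V W : zmodType) {EV : Enc S V} {EW : Enc S W} (i : ifun V W) :=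
  ihom i /\ injective i /\ forall n x, gdvd n (i x) -> gdvd n x.

Lemma pure_mono_graph (V W : zmodType) {EV : Enc S V} {EW : Enc S W} (i : ifun V W) :
  pure_mono (graph i) (cgrp V) (cgrp W) -> ipure i.
Proof.
move=> [/is_hom_graph [g [/graph_inj <- Hi]] [/map_inj_graph ii Hp]]; split=> //; split=> //.
move=> n x [z E].
have [|||y [[w ->] H]] := Hp n (enc x) (enc z) (enc (i x)).
- by exists z.
- exact/cgrp_nmul.
- exact/app_graph_enc.
by exists w; apply/cgrp_nmul.
Qed.

(** Every group of the structure is [cgrp] of its type of elements, so the test groups and maps may
    be taken typed. *)
Lemma pure_injectiveI (X : zmodType) {EX : Enc S X} {IX : igrp X} :
  (forall (V W : zmodType) (EV : Enc S V) (EW : Enc S W) (IV : igrp V) (IW : igrp W)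
     (i : ifun V W) (f : ifun V X), ipure i -> ihom f ->
     exists g : ifun W X, ihom g /\ forall v, g (i v) = f v) ->
  pure_injective (cgrp X).
Proof.
move=> H; split; first exact: cgrp_is_grp.
move=> G G' i f HG HG'; rewrite -(cgrp_gel HG) -(cgrp_gel HG').
move=> Hi; have [/is_hom_graph [j [E _]] _] := Hi; subst i.
move=> /is_hom_graph [g [-> Hg]].
have [h [Hh E]] := H _ _ _ _ _ _ j g (pure_mono_graph Hi) Hg.
exists (graph h); split; first by apply/is_hom_graph; exists h.
by move=> a b c /app_graph [x [-> ->]] /app_graph_enc ->; apply/app_graph_enc; rewrite E.
Qed.
End Pure.

(** * Choice *)

Class zfc (S : structure) : Prop := {
  zfc_zf :: zf S;
  zfc_choice : ax_choice S }.

Lemma choice_ifun {S : structure} {HS : zfc S} T U {ET : Enc S T} {EU : Enc S U}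
  (R : T -> U -> Prop) : small T -> small U -> dP (fun p : T * U => R p.1 p.2) ->
  (forall t, exists u, R t u) -> exists f : ifun T U, forall t, R t (f t).
Proof.
move=> sT sU HR Rt.
(* Pairing every admissible value with its index t makes the sets disjoint, as the choice axiom
   requires. *)
have H (t : T) : is_set (fun w : S => exists p : T * U, w = enc p /\ (p.1 = t /\ R t p.2)).
  by apply: sep_set; [exact: small_prod|dfn].
pose s t := sval (cid (H t)).
have sP t w : w ∈ s t <-> exists p : T * U, w = enc p /\ (p.1 = t /\ R t p.2).
  exact: (svalP (cid (H t)) w).
have ds : dF s.
  apply: (dF_rel (R := fun t x => forall w, w ∈ x <-> exists p : T * U, w = enc p /\ (p.1 = t /\ R t p.2))).
    move=> t x; split=> [-> w|E]; first exact: sP.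
    by apply: set_ext => w; rewrite sP E.
  by dfn.
have [b Hb] := image_set sT ds.
have [||c Hc] := @zfc_choice S HS b.
- by move=> y /Hb [t ->]; have [u Ru] := Rt t; exists (enc (t, u)); apply/sP; exists (t, u).
- move=> y y' z /Hb [t ->] /Hb [t' ->] /sP [p [E [E1 _]]] /sP [p' [E' [E1' _]]].
  by subst z; einj.
have H2 (t : T) : exists u, enc (t, u) ∈ c /\ R t u /\ forall u', enc (t, u') ∈ c /\ R t u' -> u' = u.
  have [|z [[zc /sP [[t' u] [E [/= Et Ru]]]] Hu]] := Hc (s t); first by apply/Hb; exists t.
  subst z t'; exists u; split=> //; split=> // u' [cu' Ru'].
  have : (enc (t, u) : S) = enc (t, u'); last by move=> ?; einj.
  by apply: Hu; split=> //; apply/sP; exists (t, u').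
pose f t := sval (cid (H2 t)).
have fP t : enc (t, f t) ∈ c /\ R t (f t) /\ forall u', enc (t, u') ∈ c /\ R t u' -> u' = f t.
  exact: (svalP (cid (H2 t))).
have df : dF f.
  apply: (dF_rel (R := fun t u => enc (t, u) ∈ c /\ R t u)); last by dfn.
  move=> t u; split=> [->|]; first by have [? [? _]] := fP t.
  by have [_ [_ Hu]] := fP t; apply: Hu.
have [g Hg] := ifun_ex sT df; exists g => t; rewrite Hg.
by have [_ []] := fP t.
Qed.

(** * Zorn's lemma and well-orders *)

Section Tower.
Context {S : structure} {HS : zf S} {T : Type} {ET : Enc S T} (sT : small T).
Implicit Types (A B : iset T) (K : iset (iset T)).

Definition isub_set A B := forall t, A t -> B t.

Definition is_union (U : iset T) K := forall t, U t <-> exists A, K A /\ A t.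

Lemma union_iset K : exists U, is_union U K.
Proof. by apply: iset_ex => //; dfn. Qed.

Variables (A0 : iset T) (f : iset T -> iset T).
Hypotheses (df : dF f) (f_incr : forall A, isub_set A (f A)).

Definition tower_closed K :=
  [/\ K A0, forall A, K A -> K (f A) &
   forall K' U, (exists A, K' A) -> (forall A, K' A -> K A) -> is_union U K' -> K U].

(* Bourbaki-Witt: the least family containing [A0] and closed under [f] and
   unions is linearly ordered by inclusion. *)
Lemma tower_ex : exists K, tower_closed K /\
  (forall A, K A -> isub_set A0 A) /\
  (forall K', tower_closed K' -> forall A, K A -> K' A) /\
  forall A B, K A -> K B -> isub_set A B \/ isub_set (f B) A.
Proof.
have sP : small (iset T) by exact: small_iset.
have [K HK] : exists K, forall A, K A <-> forall K', tower_closed K' -> K' A.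
  apply: iset_ex => //.
  by rewrite /tower_closed /is_union; dfn.
have cK : tower_closed K.
  split; first by apply/HK => K' [].
    by move=> A /HK H; apply/HK => K' cK'; have [_ H' _] := cK'; apply/H'/H.
  move=> K' U nK' sK uU; apply/HK => K'' cK''; have [_ _ H] := cK''.
  by apply: (H K') => // A /sK /HK; apply.
have ind (P : iset T -> Prop) : dP P -> P A0 -> (forall A, K A -> P A -> P (f A)) ->
    (forall K' U, (exists A, K' A) -> (forall A, K' A -> K A /\ P A) -> is_union U K' -> P U) ->
    forall A, K A -> P A.
  move=> dPP P0 Pf PU A KA.
  have [K' HK'] : exists K' : iset (iset T), forall A, K' A <-> K A /\ P A.
    by apply: iset_ex => //; dfn.
  suff /HK' [] : K' A by [].
  have [H1 H2 H3] := cK; move/HK: KA; apply; split; first by apply/HK'.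
    by move=> B /HK' [KB PB]; apply/HK'; split; [apply: H2|apply: Pf].
  move=> K'' U nK'' sK'' uU; apply/HK'; split.
    by apply: (H3 K'') => // B /sK'' /HK' [].
  by apply: (PU K'') => // B /sK'' /HK'.
have KA0 : forall A, K A -> isub_set A0 A.
  apply: (ind _) => //; first by rewrite /isub_set; dfn.
    by move=> A _ H t /H; apply: f_incr.
  by move=> K' U [A KA] H uU t At; apply/uU; exists A; split=> //; case: (H _ KA) => _; apply.
exists K; split=> //; split=> //.
split; first by move=> K' cK' A /HK; apply.
(* No strict predecessor of [C] is carried beyond [C] by [f]. By [dich] every member of the tower
   then lies below [C] or above [f C]; the property itself is proved along the tower afterwards. *)
pose extreme C := forall A, K A -> isub_set A C -> A <> C -> isub_set (f A) C.
have dich C : K C -> extreme C -> forall A, K A -> isub_set A C \/ isub_set (f C) A.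
  move=> KC eC; apply: (ind _); first by rewrite /isub_set; dfn.
  - by left; apply: KA0.
  - move=> A KA [AC|CA]; last by right=> t /CA; apply: f_incr.
    by case: (pselect (A = C)) => [->|AC']; [right|left; apply: eC].
  - move=> K' U nK' HK' uU.
    case: (pselect (exists A, K' A /\ ~ isub_set A C)) => [[A [KA nA]]|H].
      right=> t Ct; apply/uU; exists A; split=> //.
      by have [_ [//|]] := HK' _ KA; apply.
    left=> t /uU [A [KA At]].
    by apply: contrapT => nC; apply: H; exists A; split=> // /(_ t At).
have ext_all : forall C, K C -> extreme C.
  apply: (ind _); first by rewrite /extreme /isub_set; dfn.
  - move=> A KA A0A neq; exfalso; apply: neq.
    by apply: isetP => t; split; [apply: A0A|apply: KA0].
  - move=> C KC eC A KA AfC neq.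
    have [AC|fCA] := dich _ KC eC _ KA.
      case: (pselect (A = C)) => [-> //|AC'] t ft.
      by apply: f_incr; apply: (eC A KA AC AC').
    by exfalso; apply: neq; apply: isetP => t; split; [apply: AfC|apply: fCA].
  - move=> K' U nK' HK' uU A KA AU neq t ft.
    case: (pselect (exists C, K' C /\ ~ isub_set C A)) => [[C [KC nC]]|H].
      have [KC' eC] := HK' _ KC.
      have [AC|fCA] := dich _ KC' eC _ KA; last by case: nC => s /f_incr; apply: fCA.
      apply/uU; exists C; split=> //; apply: (eC A) => //.
      by move=> E; apply: nC; rewrite E.
    exfalso; apply: neq; apply: isetP => s; split; first exact: AU.
    move/uU => [C [KC Cs]]; apply: contrapT => nA; apply: H; exists C; split=> //.
    by move/(_ s Cs).
by move=> A B KA KB; apply: dich => //; apply: ext_all.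
Qed.
End Tower.

(** [f] picks a strictly larger member of [F] when there is one and otherwise fixes its argument.
    The union of its tower over [A0] belongs to the tower, so [f] cannot enlarge it. *)
Lemma zorn {S : structure} {HS : zfc S} T {ET : Enc S T} (F : iset T -> Prop) (A0 : iset T) :
  small T -> dP F -> F A0 ->
  (forall (K : iset (iset T)) (U : iset T), (exists A, K A) -> (forall A, K A -> F A) ->
     (forall A B, K A -> K B -> isub_set A B \/ isub_set B A) -> is_union U K -> F U) ->
  exists M, F M /\ isub_set A0 M /\ forall A, F A -> isub_set M A -> A = M.
Proof.
move=> sT dPF FA0 FU.
have sP : small (iset T) by exact: small_iset.
pose R (A B : @iset S T ET) := (F B /\ isub_set A B /\ A <> B) \/ ((~ exists B, F B /\ isub_set A B /\ A <> B) /\ B = A).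
have [||f Hf] := @choice_ifun S HS (iset T) (iset T) _ _ R sP sP.
- by rewrite /R /isub_set; dfn.
- move=> A; case: (pselect (exists B, F B /\ isub_set A B /\ A <> B)) => [[B H]|H].
    by exists B; left.
  by exists A; right.
have df : dF (fun A => f A) by dfn.
have fi A : isub_set A (f A) by case: (Hf A) => [[_ []//]|[_ ->]].
have [K [[K0 Kf KU] [KA0 [Kmin Kch]]]] := tower_ex sT A0 df fi.
have KF A : K A -> F A.
  have [K' HK'] : exists K' : iset (iset T), forall A, K' A <-> K A /\ F A.
    by apply: iset_ex => //; dfn.
  move=> KA; suff /HK' [] : K' A by [].
  apply: Kmin KA; split; first by apply/HK'.
    by move=> B /HK' [KB FB]; apply/HK'; split; [apply: Kf|case: (Hf B) => [[]//|[_ ->]]].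
  move=> K'' U nK'' sK'' uU; apply/HK'; split.
    by apply: (KU K'') => // B /sK'' /HK' [].
  apply: (FU K'') => // [B /sK'' /HK' []//|B C /sK'' /HK' [KB _] /sK'' /HK' [KC _]].
  by have [|H] := Kch _ _ KB KC; [left|right=> t /fi; apply: H].
have [M uM] := union_iset sT K.
have KM : K M by apply: (KU K) => //; exists A0.
exists M; split; first exact: KF.
split; first exact: KA0.
move=> A FA MA; apply: contrapT => neq.
have [[FM [MfM neq']]|[H _]] := Hf M; last by apply: H; exists A; split=> //; split=> // E; apply: neq.
apply: neq'; apply: isetP => t; split; first exact: MfM.
by move=> ft; apply/uM; exists (f M); split=> //; apply: Kf.
Qed.

(** Zermelo's argument: [f] adds one point at a time, and x precedes y when some stage of the tower
    contains x but not y. The least element of [P] is the point added to the union of the stages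
    disjoint from [P]. *)
Lemma well_order {S : structure} {HS : zfc S} T {ET : Enc S T} : small T ->
  exists lt : iset (T * T), (forall x, ~ lt (x, x)) /\
    (forall x y z, lt (x, y) -> lt (y, z) -> lt (x, z)) /\
    forall P : iset T, (exists x, P x) -> exists x, P x /\ forall y, P y -> y = x \/ lt (x, y).
Proof.
move=> sT; have sP : small (iset T) by exact: small_iset.
pose R (A B : @iset S T ET) := isub_set A B /\ ((forall t, A t) \/ exists t, ~ A t /\ forall s, B s <-> A s \/ s = t).
have [||f Hf] := @choice_ifun S HS (iset T) (iset T) _ _ R sP sP.
- by rewrite /R /isub_set; dfn.
- move=> A; case: (pselect (forall t, A t)) => [At|/existsNP [t At]].
    by exists A; split=> //; left.
  have [B HB] : exists B : iset T, forall s, B s <-> A s \/ s = t by apply: iset_ex => //; dfn.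
  by exists B; split; [move=> s As; apply/HB; left|right; exists t].
have df : dF (fun A => f A) by dfn.
have fi A : isub_set A (f A) by case: (Hf A).
have [A0 HA0] : exists A0 : iset T, forall t, A0 t <-> False by apply: iset_ex => //; dfn.
have [K [[K0 Kf KU] [KA0 [Kmin Kch]]]] := tower_ex sT A0 df fi.
have [lt Hlt] : exists lt : iset (T * T), forall p, lt p <-> exists A, K A /\ A p.1 /\ ~ A p.2.
  by apply: iset_ex; [exact: small_prod|dfn].
exists lt; split; first by move=> x /Hlt [A [_ []]].
split.
  move=> x y z /Hlt [A [KA [/= Ax nAy]]] /Hlt [B [KB [/= By nBz]]]; apply/Hlt.
  exists B; split=> //=; split=> //.
  by have [H|H] := Kch _ _ KA KB; [apply: H|case: nAy; apply/H/fi].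
move=> P [x0 Px0].
have [K' HK'] : exists K' : iset (iset T), forall A, K' A <-> K A /\ forall t, A t -> ~ P t.
  by apply: iset_ex => //; dfn.
have [U uU] := union_iset sT K'.
have K'U : K' U.
  apply/HK'; split; last by move=> t /uU [A [/HK' [_ H] /H]].
  apply: (KU K') => //; last by move=> A /HK' [].
  by exists A0; apply/HK'; split=> // t /HA0.
have [KU' HU] := (proj1 (HK' U) K'U).
have [_ [H|[x [Ux Hx]]]] := Hf U; first by case: (HU x0).
have Px : P x.
  apply: contrapT => nP; apply: Ux; apply/uU; exists (f U); split; last by apply/Hx; right.
  by apply/HK'; split; [apply: Kf|move=> t /Hx [/HU|->]].
exists x; split=> // y Py; case: (pselect (y = x)) => [|neq]; [by left|right].
apply/Hlt; exists (f U); split; first exact: Kf.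
by split=> /=; [apply/Hx; right|move/Hx => [/HU|]].
Qed.

(** * Cardinals *)

Section Cardinals.
Context {S : structure} {HS : zf S}.

Definition El (c : S) := {v : S | v ∈ c}.

Lemma El_inj c : injective (fun x : El c => sval x).
Proof. by move=> [x Hx] [y Hy] /= E; subst; congr exist. Qed.

Lemma El_dom c : dP (fun v : S => exists x : El c, v = sval x).
Proof.
apply: (@dP_ext _ _ _ _ (fun v : S => v ∈ c)); last by dfn.
by move=> v; split=> [[[w Hw] -> //]|Hv]; exists (exist _ v Hv).
Qed.

#[global] Instance Enc_El c : Enc S (El c) := enc_via (@El_inj c) (El_dom c).

Lemma El_range c : (fun v => v ∈ c) = (fun x => exists t : El c, x = enc t).
Proof.
apply: funext => v; apply: propext.
by split=> [Hv|[[w Hw] -> //]]; exists (exist _ v Hv).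
Qed.

Lemma small_El c : small (El c).
Proof. by exists c => v; split=> [Hv|[[w Hw] -> //]]; exists (exist _ v Hv). Qed.

Section Bij.
Context {T U W : Type} {ET : Enc S T} {EU : Enc S U} {EW : Enc S W}.

Definition ibij (h : ifun T U) := injective h /\ forall u, exists t, u = h t.

Lemma equinumerousP : equinumerous (fun x : S => exists t : T, x = enc t)
  (fun y => exists u : U, y = enc u) <-> exists h : ifun T U, ibij h.
Proof.
split=> [[f [/is_map_graph [h ->] [/map_inj_graph hi /map_onto_graph hs]]]|[h [hi hs]]].
  by exists h.
by exists (graph h); split; [apply/is_map_graph; exists h|split; [apply/map_inj_graph|apply/map_onto_graph]].
Qed.

Lemma ibij_inv (h : ifun T U) : small U -> ibij h ->
  exists k : ifun U T, (forall u, h (k u) = u) /\ forall t, k (h t) = t.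
Proof.
move=> sU [hi hs]; pose k0 u := sval (cid (hs u)).
have kP u : u = h (k0 u) by exact: (svalP (cid (hs u))).
have dk : dF k0.
  apply: (dF_rel (R := fun u t => u = h t)); last by dfn.
  by move=> u t; split=> [-> //|E]; apply: hi; rewrite -E.
have [k Hk] := ifun_ex sU dk; exists k; split=> [u|t]; rewrite Hk -?kP //.
by apply: hi; rewrite -kP.
Qed.
End Bij.

Lemma ibij_comp T U W {ET : Enc S T} {EU : Enc S U} {EW : Enc S W}
  (h : ifun T U) (k : ifun U W) : small T -> ibij h -> ibij k ->
  exists l : ifun T W, ibij l /\ forall t, l t = k (h t).
Proof.
move=> sT [hi hs] [ki ks].
have [|l Hl] := @ifun_ex _ _ T W _ _ (fun t => k (h t)) sT; first by dfn.
exists l; split=> //; split=> [x y|w]; first by rewrite !Hl => /ki /hi.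
by have [u ->] := ks w; have [t ->] := hs u; exists t; rewrite Hl.
Qed.

Lemma cantor_bernstein T U {ET : Enc S T} {EU : Enc S U} (f : ifun T U) (g : ifun U T) :
  small T -> small U -> injective f -> injective g -> exists h : ifun T U, ibij h.
Proof.
move=> sT sU fi gi.
(* [Phi A] is the complement of g(U - f(A)). It is monotone; on its greatest fixed point [D] the
   bijection is f, outside [D] it is the inverse of g. *)
pose Phi (A : @iset S T ET) t := ~ exists u, t = g u /\ ~ exists t', A t' /\ u = f t'.
have PhiM (A B : iset T) : (forall t, A t -> B t) -> forall t, Phi A t -> Phi B t.
  move=> AB t PA [u [E nB]]; apply: PA; exists u; split=> // -[t' [At Eu]].
  by apply: nB; exists t'; split=> //; apply: AB.
have [D HD] : exists D : iset T, forall t, D t <-> exists A : iset T, (forall t, A t -> Phi A t) /\ A t.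
  by apply: iset_ex => //; rewrite /Phi; dfn.
have D1 t : D t -> Phi D t.
  move/HD => [A [HA At]]; apply: (PhiM A); last exact: HA.
  by move=> s As; apply/HD; exists A.
have D2 t : Phi D t -> D t.
  move=> Pt; have [D' HD'] : exists D' : iset T, forall s, D' s <-> Phi D s.
    by apply: iset_ex => //; rewrite /Phi; dfn.
  apply/HD; exists D'; split; last exact/HD'.
  by move=> s /HD' Ps; apply: (PhiM D) => // x /D1 /HD'.
have H t : exists u, (D t /\ u = f t) \/ (~ D t /\ t = g u).
  case: (pselect (D t)) => Dt; first by exists (f t); left.
  have : ~ Phi D t by move/D2.
  by move/contrapT => [u [E _]]; exists u; right.
pose h0 t := sval (cid (H t)).
have hP t : (D t /\ h0 t = f t) \/ (~ D t /\ t = g (h0 t)) by exact: (svalP (cid (H t))).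
have dh : dF h0.
  apply: (dF_rel (R := fun t u => (D t /\ u = f t) \/ (~ D t /\ t = g u))); last by dfn.
  move=> t u; split=> [-> //|]; have := hP t.
  by case=> [[Dt ->]|[nD E]] [[Dt' E']|[nD' E']] //; apply: gi; rewrite -E.
have [h Hh] := ifun_ex sT dh; exists h.
have cross t t' : D t -> ~ D t' -> h0 t <> h0 t'.
  move=> Dt nD' E.
  have [[_ Et]|[//]] := hP t; have [[//]|[_ Et']] := hP t'.
  have : ~ Phi D t' by move/D2.
  move/contrapT => [u [Eu nu]]; apply: nu; exists t; split=> //.
  by apply: gi; rewrite -Eu Et' -E Et.
split.
  move=> t t'; rewrite !Hh => E.
  have [[Dt Et]|[nD Et]] := hP t; have [[Dt' Et']|[nD' Et']] := hP t'.
  - by apply: fi; rewrite -Et E.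
  - by case: (cross t t').
  - by case: (cross t' t).
  - by rewrite Et E -Et'.
move=> u; case: (pselect (exists t, D t /\ u = f t)) => [[t [Dt ->]]|nD].
  by exists t; rewrite Hh; have [[_ ->]|[]] := hP t.
have nDg : ~ D (g u) by move=> /D1 H1; apply: H1; exists u.
by exists (g u); rewrite Hh; have [[]|[_ /gi]] := hP (g u).
Qed.

End Cardinals.

(** * Mostowski collapse of a well-ordered set *)

Section Collapse.
Context {S : structure} {HS : zfc S} {T : Type} {ET : Enc S T} (sT : small T).
Variable lt : iset (T * T).
Hypotheses (lt_irr : forall x, ~ lt (x, x))
  (lt_trans : forall x y z, lt (x, y) -> lt (y, z) -> lt (x, z))
  (lt_min : forall P : iset T, (exists x, P x) -> exists x, P x /\ forall y, P y -> y = x \/ lt (x, y)).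

Lemma lt_ind (P : T -> Prop) : dP P -> (forall x, (forall y, lt (y, x) -> P y) -> P x) ->
  forall x, P x.
Proof.
move=> dPP IH x0; apply: contrapT => nP.
have [Q HQ] : exists Q : iset T, forall x, Q x <-> ~ P x by apply: iset_ex => //; dfn.
have [|x [/HQ Px Hx]] := lt_min (P := Q); first by exists x0; apply/HQ.
apply: Px; apply: IH => y yx; apply: contrapT => /HQ /Hx [E|xy].
  by subst; apply: lt_irr yx.
exact: lt_irr (lt_trans yx xy).
Qed.

(** A collapse of the initial segment up to x; the values of [k] beyond x are free. *)
Definition collapsing (x : T) (k : ifun T S) :=
  forall y, y = x \/ lt (y, x) -> forall z, z ∈ k y <-> exists w, lt (w, y) /\ z = k w.

Lemma collapse_uniq x k k' : collapsing x k -> collapsing x k' ->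
  forall y, y = x \/ lt (y, x) -> k y = k' y.
Proof.
move=> Hk Hk'; apply: lt_ind; first by dfn.
move=> y IH yx; apply: set_ext => z; rewrite Hk // Hk' //.
have E w : lt (w, y) -> k w = k' w.
  by move=> wy; apply: IH => //; right; case: yx => [<-//|]; apply: lt_trans.
by split=> -[w [wy ->]]; exists w; rewrite E.
Qed.

(** Transfinite recursion: the value at y collects the values at w of all partial collapses up to w,
    for w below y, and these agree by [collapse_uniq]. Induction then shows that [F] itself is a
    partial collapse up to every point. *)
Lemma collapse_ex : exists F : ifun T S, forall y z, z ∈ F y <-> exists w, lt (w, y) /\ z = F w.
Proof.
pose Q y (u : S) := exists w, lt (w, y) /\ exists k, collapsing w k /\ u = k w.
have HQ y : is_set (Q y).
  have [|w u u' [_ [k [Hk ->]]] [_ [k' [Hk' ->]]]|b Hb] :=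
    @repl_set _ _ T S _ _ (fun w u => lt (w, y) /\ exists k, collapsing w k /\ u = k w) sT.
  - by rewrite /collapsing; dfn.
  - by apply: (collapse_uniq Hk Hk'); left.
  exists b => v; rewrite Hb; split=> [[u [-> [w H]]]|[w H]]; first by exists w.
  by exists v; split=> //; exists w.
pose F0 y := sval (cid (HQ y)).
have F0P y z : z ∈ F0 y <-> Q y z by exact: (svalP (cid (HQ y)) z).
have dF0 : dF F0.
  apply: (dF_rel (R := fun y u => forall z, z ∈ u <-> Q y z)).
    by move=> y u; split=> [->//|E]; apply: set_ext => z; rewrite E F0P.
  by rewrite /Q /collapsing; dfn.
have [F HF] := ifun_ex sT dF0.
have HFc : forall x, collapsing x F.
  apply: lt_ind; first by rewrite /collapsing; dfn.
  move=> x IH y yx z; rewrite HF F0P.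
  have E w : lt (w, y) -> collapsing w F.
    by move=> wy; apply: IH; case: yx => [<-//|]; apply: lt_trans.
  split=> [[w [wy [k [Hk ->]]]]|[w [wy ->]]].
    by exists w; split=> //; apply: (collapse_uniq Hk (E _ wy)); left.
  by exists w; split=> //; exists F; split=> //; apply: E.
by exists F => y; apply: (HFc y); left.
Qed.

Lemma ordinal_ex : exists a : S, is_ordinal a /\ exists h : ifun T (El a), ibij h.
Proof.
have [F HF] := collapse_ex.
have dFF : dF (fun x => F x) by dfn.
have [a Ha] := image_set sT dFF.
exists a; split.
  split=> [x /Ha [t ->] z /HF [w [_ ->]]|x /Ha [t ->] y /HF [w [wt ->]] z /HF [v [vw ->]]].
    by apply/Ha; exists w.
  by apply/HF; exists v; split=> //; apply: lt_trans wt.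
have total x y : x <> y -> lt (x, y) \/ lt (y, x).
  move=> neq; have [P HP] : exists P : iset T, forall z, P z <-> z = x \/ z = y.
    by apply: iset_ex => //; dfn.
  have [|z [/HP zxy Hz]] := lt_min (P := P); first by exists x; apply/HP; left.
  case: zxy => E; subst z.
    have /Hz [E|] : P y by apply/HP; right.
      by case: neq.
    by left.
  have /Hz [E|] : P x by apply/HP; left.
    by case: neq.
  by right.
have Fi x y : F x = F y -> x = y.
  move=> E; apply: contrapT => /total [xy|yx].
    have : F x ∈ F y by apply/HF; exists x.
    by rewrite E => /mem_irrefl.
  have : F y ∈ F x by apply/HF; exists y.
  by rewrite E => /mem_irrefl.
have Fa t : F t ∈ a by apply/Ha; exists t.
pose h0 t : El a := exist _ (F t) (Fa t).
have dh : dF h0.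
  by apply: (dF_lift (f := fun x : El a => sval x)); [exact: El_inj|exact: dF_via|].
have [h Hh] := ifun_ex sT dh; exists h; split=> [x y|[u Hu]].
  by rewrite !Hh => -[] /Fi.
by have [t E] := proj1 (Ha u) Hu; exists t; apply: El_inj; rewrite Hh.
Qed.
End Collapse.

(** * Existence of cardinals and of the continuum *)

Section Continuum.
Context {S : structure} {HS : zfc S}.

Lemma is_ordinal_mem (a x : S) : is_ordinal a -> x ∈ a -> is_ordinal x.
Proof.
move=> [H1 H2] xa; split=> [y yx|y yx z zy]; first exact: H2 yx.
exact: (H2 y (H1 _ xa _ yx)).
Qed.

(** From an ordinal in bijection with T one descends along membership as long as some element is in
    bijection with the whole; the ordinal where this stops is a cardinal. *)
Lemma cardinal_ex T {ET : Enc S T} : small T ->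
  exists c : S, is_cardinal c /\ exists h : ifun (El c) T, ibij h.
Proof.
move=> sT; have [lt [l1 [l2 l3]]] := well_order sT.
have [a [oa [h hb]]] := ordinal_ex sT l1 l2 l3.
have [k [hk kh]] := ibij_inv (small_El a) hb.
have kb : ibij k.
  split=> [x y E|t]; first by rewrite -(hk x) -(hk y) E.
  by exists (h t); rewrite kh.
move: oa k kb {h hb hk kh}.
elim/(well_founded_ind zf_wf): a => a IH oa k kb.
case: (pselect (exists b, b ∈ a /\ exists h : ifun (El b) (El a), ibij h)).
  move=> [b [ba [h hb]]]; have [l [lb _]] := ibij_comp (small_El b) hb kb.
  by apply: (IH b ba) lb; apply: is_ordinal_mem ba.
move=> nb; exists a; split; last by exists k.
split=> // x xa; rewrite (El_range x) (El_range a) => /equinumerousP [f fb].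
by apply: nb; exists x; split=> //; exists f.
Qed.

Lemma continuum_ex : exists c : S, is_continuum c /\ exists h : ifun (El c) (iset nat), ibij h.
Proof.
have [c [cc [h hb]]] := cardinal_ex (small_iset small_nat).
exists c; split; last by exists h.
split=> //; rewrite (El_range c).
have -> : (fun x : S => forall u, u ∈ x -> omega u) = (fun x => exists A : iset nat, x = enc A).
  apply: funext => x; apply: propext; split=> [H|[A ->] u /extP [n [-> _]]]; last first.
    by exists n; apply/enc_numP.
  have Hs : is_set (fun w : S => exists n : nat, w = enc n /\ enc n ∈ x).
    exists x => w; split=> [wx|[n [-> //]]]; have [n /enc_numP E] := H _ wx.
    by exists n; rewrite -E.
  exists (ISet Hs); apply: set_ext => w; rewrite extP /=.
  split=> [wx|[n [-> //]]]; have [n /enc_numP E] := H _ wx.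
  by exists n; rewrite -E.
by apply/equinumerousP; exists h.
Qed.

Lemma empty_cardinal (o : S) : is_empty o -> is_cardinal o.
Proof. by move=> Ho; split; [split=> x /Ho|move=> x /Ho]. Qed.
End Continuum.

Import Order.TTheory Num.Theory.
(** * Divisibility in abelian groups *)

Section Gdvd.
Variable V : zmodType.
Implicit Types (x y : V) (n r : nat) (m : int).

Definition tfree := forall n x, (0 < n)%N -> x *+ n = 0 -> x = 0.
Definition divisible := forall n x, (0 < n)%N -> gdvd n x.

Lemma gdvd0 x : gdvd 0 x <-> x = 0.
Proof. by split=> [[z ->]|->]; [rewrite mulr0n|exists 0; rewrite mulr0n]. Qed.

Lemma gdvdxx n x : gdvd n (x *+ n).
Proof. by exists x. Qed.

Lemma gdvdD n x y : gdvd n x -> gdvd n y -> gdvd n (x + y).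
Proof. by move=> [a ->] [b ->]; exists (a + b); rewrite mulrnDl. Qed.

Lemma gdvdN n x : gdvd n x -> gdvd n (- x).
Proof. by move=> [a ->]; exists (- a); rewrite mulNrn. Qed.

Lemma gdvdB n x y : gdvd n x -> gdvd n y -> gdvd n (x - y).
Proof. by move=> Hx Hy; apply/gdvdD => //; apply/gdvdN. Qed.

Lemma gdvdZ n x m : gdvd n x -> gdvd n (x *~ m).
Proof. by move=> [a ->]; exists (a *~ m); rewrite !pmulrn mulrzAC. Qed.

Lemma gdvdMn n r x : gdvd n x -> gdvd (n * r) (x *+ r).
Proof. by move=> [a ->]; exists a; rewrite mulrnA. Qed.

Lemma gdvd_dvdn n r x : (n %| r)%N -> gdvd r x -> gdvd n x.
Proof. by move=> /dvdnP [k ->] [a ->]; exists (a *+ k); rewrite -mulrnA. Qed.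

Lemma gdvd_dvdz n x m : (n%:Z %| m)%Z -> gdvd n (x *~ m).
Proof. by move=> /dvdzP [k ->]; exists (x *~ k); rewrite pmulrn mulrzA. Qed.

Lemma tfree_mulIn n x y : tfree -> (0 < n)%N -> x *+ n = y *+ n -> x = y.
Proof.
move=> tf n0 E; apply/eqP; rewrite -subr_eq0; apply/eqP/(tf n) => //.
by rewrite mulrnBl E subrr.
Qed.

Lemma tfree_gdvd n r x : tfree -> (0 < r)%N -> gdvd (n * r) (x *+ r) -> gdvd n x.
Proof.
move=> tf r0 [z E]; exists z; apply: (tfree_mulIn tf r0).
by rewrite E mulrnA.
Qed.
End Gdvd.

Lemma int_ideal (I : int -> Prop) : (forall m n, I m -> I n -> I (m - n)) ->
  (exists m, m != 0 /\ I m) ->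
  exists d : nat, (0 < d)%N /\ I d%:Z /\ forall m, I m -> (d%:Z %| m)%Z.
Proof.
move=> IB [m0 [m0n Im0]].
have I0 : I 0 by rewrite -(subrr m0); apply: IB.
have IN m : I m -> I (- m) by move=> Im; rewrite -sub0r; apply: IB.
have ex : exists n : nat, (0 < n)%N && `[< I n%:Z >].
  exists `|m0|%N; rewrite absz_gt0 m0n; apply/asboolP.
  by rewrite abszE; case: (ger0P m0) => _ //; apply: IN.
case: (ex_minnP ex) => d /andP [d0 /asboolP Id] dmin.
exists d; split=> //; split=> // m Im.
have IM k : I (d%:Z * k%:Z).
  elim: k => [|k IHk]; first by rewrite mulr0.
  have -> : d%:Z * k.+1%:Z = d%:Z * k%:Z - (- d%:Z) by rewrite intS mulrDr mulr1 opprK addrC.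
  by apply: IB => //; apply: IN.
have IMz k : I (d%:Z * k).
  by case: k => k; [exact: IM|rewrite NegzE mulrN; apply: IN].
have Ir : I (m %% d%:Z)%Z.
  by rewrite /modz mulrC; apply: IB.
apply/dvdz_mod0P; case: (eqVneq (m %% d%:Z)%Z 0) => [//|nz]; exfalso.
have r0 : 0 <= (m %% d%:Z)%Z by rewrite modz_ge0 // gt_eqF.
have rlt : (m %% d%:Z)%Z < d%:Z by apply: ltz_pmod.
have := dmin `|(m %% d%:Z)%Z|%N; rewrite absz_gt0 nz /=.
have -> : `[< I `|(m %% d%:Z)%Z|%N%:Z >] by apply/asboolP; rewrite gez0_abs.
by move=> /(_ isT); rewrite -lez_nat gez0_abs // leNgt rlt.
Qed.

(** * Extension of partial homomorphisms *)

Section Extension.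
Context {S : structure} {HS : zfc S}.
Context {H Y : zmodType} {EH : Enc S H} {EY : Enc S Y} {IH : igrp H} {IY : igrp Y}.

(* The case [n = 0] says that the relation is functional. *)
Definition good (R : iset (H * Y)) := R 0 /\ (forall p q, R p -> R q -> R (p - q)) /\
  forall h y n, R (h, y) -> gdvd n h -> gdvd n y.

Section Step.
Variables (R : iset (H * Y)) (h : H).
Hypothesis gR : good R.

(** This is clause n of [good] for the relation generated by [R] and (h, y). *)
Definition step_cond n y := forall (m : int) k g, R (k, g) ->
  gdvd n (h *~ m + k) -> gdvd n (y *~ m + g).

(** The multiples of h that meet the domain of [R] modulo n. They form an ideal of the integers, so
    one generator controls all conditions modulo n. *)
Definition step_ideal n (m : int) := exists k g, R (k, g) /\ gdvd n (h *~ m + k).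

Lemma good0 : R (0, 0). Proof. by case: gR. Qed.

Lemma goodB k g k' g' : R (k, g) -> R (k', g') -> R (k - k', g - g').
Proof. by case: gR => _ [H1 _] Hk Hk'; apply: (H1 (k, g) (k', g')). Qed.

Lemma goodN k g : R (k, g) -> R (- k, - g).
Proof. by move=> Hk; have := goodB good0 Hk; rewrite !sub0r. Qed.

Lemma goodD k g k' g' : R (k, g) -> R (k', g') -> R (k + k', g + g').
Proof. by move=> Hk /goodN Hk'; have := goodB Hk Hk'; rewrite !opprK. Qed.

Lemma goodZ k g (m : int) : R (k, g) -> R (k *~ m, g *~ m).
Proof.
move=> Hk; have Hn n : R (k *+ n, g *+ n).
  by elim: n => [|n IHn]; rewrite ?mulr0n ?mulrS; [exact: good0|exact: goodD].
by case: m => n; [apply: Hn|rewrite NegzE !mulrNz; apply/goodN/Hn].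
Qed.

Lemma step_idealB n m m' : step_ideal n m -> step_ideal n m' -> step_ideal n (m - m').
Proof.
move=> [k [g [Rk D]]] [k' [g' [Rk' D']]]; exists (k - k'), (g - g').
split; first exact: goodB.
by have := gdvdB D D'; rewrite mulrzBr opprD !addrA [_ + k - _]addrAC.
Qed.

(* A generator [d] of the ideal provides [h d + k] divisible by [n]; then [d]
   divides [k], hence its image, and the quotient solves all conditions. *)
Lemma step_solve n (d : nat) : (0 < d)%N -> step_ideal n d ->
  (forall m, step_ideal n m -> (d%:Z %| m)%Z) ->
  exists y, step_cond n y /\ exists k g, R (k, g) /\ gdvd n (h *~ d + k) /\ y *~ d + g = 0.
Proof.
move=> d0 [kd [gd [Rd Dd]]] gen.
have dn : (d%:Z %| n%:Z)%Z.
  apply: gen; exists 0, 0; split; first exact: good0.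
  by rewrite addr0; exists h.
have dk : gdvd d kd.
  have := gdvdB (gdvd_dvdn dn Dd) (gdvdxx d h).
  by rewrite pmulrn addrAC subrr add0r.
have [_ [_ Hdiv]] := gR.
have [c Ec] := Hdiv _ _ _ Rd dk.
exists (- c); split; last first.
  by exists kd, gd; split=> //; split=> //; rewrite -pmulrn Ec mulNrn addNr.
move=> m k g Rk Dk.
have [q Eq] : exists q, m = q * d%:Z by apply/dvdzP/gen; exists k, g.
have D1 := gdvdZ q Dd; have D2 := gdvdB Dk D1.
have Rk' := goodB Rk (goodZ q Rd).
have : gdvd n (k - kd *~ q).
  move: D2; congr gdvd; rewrite mulrzDl -mulrzA Eq [d%:Z * q]mulrC.
  by rewrite opprD addrA [_ + k]addrC addrK.
move/(Hdiv _ _ _ Rk'); congr gdvd.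
by rewrite Ec Eq pmulrn mulNrz mulrC mulrzA addrC.
Qed.

Definition one_step := exists y, forall n, step_cond n y.

Lemma step_divisible : divisible Y -> one_step.
Proof.
(* In a divisible group the conditions modulo positive n hold automatically; what remains is n = 0,
   that is, functionality. *)
move=> dY; suff [y Hy] : exists y, step_cond 0 y by exists y => -[//|n] m k g _ _; apply: dY.
case: (pselect (exists m, m != 0 /\ step_ideal 0 m)) => [ex|nex].
  have [d [d0 [Id gen]]] := int_ideal (step_idealB (n := 0)) ex.
  by have [y [Hy _]] := step_solve d0 Id gen; exists y.
exists 0 => m k g Rk Dk; have m0 : m = 0.
  by apply: contrapT => /eqP m0; apply: nex; exists m; split=> //; exists k, g.
move: Dk; rewrite m0 !mulr0z !add0r; have [_ [_ Hdiv]] := gR; exact: Hdiv Rk.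
Qed.
End Step.

End Extension.

(* Algebraic compactness, restricted to congruences modulo successively dividing integers. *)
Definition scompact {S : structure} {HS : zf S} (V : zmodType) {EV : Enc S V} :=
  forall (L : ifun nat nat) (c : ifun nat V), (forall k, 0 < L k)%N ->
    (forall k, L k %| L k.+1)%N -> (forall k, gdvd (L k) (c k.+1 - c k)) ->
    exists y, forall k, gdvd (L k) (y - c k).
Arguments scompact {S HS} V {EV}.

Section Extension2.
Context {S : structure} {HS : zfc S}.
Context {H Y : zmodType} {EH : Enc S H} {EY : Enc S Y} {IH : igrp H} {IY : igrp Y}.

Lemma step_cond_dvd (R : iset (H * Y)) h n r y : good R -> tfree Y -> (0 < r)%N ->
  step_cond R h (n * r) y -> step_cond R h n y.
Proof.
move=> gR tf r0 Hy m k g Rk D; apply: (tfree_gdvd tf r0).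
have := Hy (m * r%:Z) _ _ (goodZ gR r%:Z Rk).
have E (V : zmodType) (a b : V) : a *~ (m * r%:Z) + b *~ r%:Z = (a *~ m + b) *+ r.
  by rewrite mulrzA -mulrzDl pmulrn.
by rewrite !E; apply; apply: gdvdMn.
Qed.

(** If a nonzero multiple of h lies in the domain, the value is forced. Otherwise let d_j generate
    the ideal of j! and L_j = j!/d_j: the solutions modulo j! form one class modulo L_j, the L_j
    form a divisibility chain, and a solution for all j! is a solution for every n. *)
Lemma step_scompact (R : iset (H * Y)) h : good R -> tfree Y -> scompact Y -> one_step R h.
Proof.
move=> gR tf sc; have [_ [_ Hdiv]] := gR.
case: (pselect (exists m, m != 0 /\ step_ideal R h 0 m)) => [ex|nex].
  have [d [d0 [Id gen]]] := int_ideal (step_idealB gR (n := 0)) ex.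
  have [y [_ [k0 [g0 [R0 [/gdvd0 E0 E0']]]]]] := step_solve gR d0 Id gen.
  (* After multiplication by d the element h enters only through h d = -k0, so the condition becomes
     a divisibility between entries of [R]; torsion-freeness cancels d again. *)
  exists y => n m k g Rk D; apply: (tfree_gdvd tf d0).
  have E (V : zmodType) (a b b0 : V) : a *~ d + b0 = 0 ->
      b *~ d - b0 *~ m = (a *~ m + b) *+ d.
    move=> /eqP; rewrite addr_eq0 => /eqP Ea.
    by rewrite pmulrn mulrzDl mulrzAC Ea mulNrz addrC.
  rewrite -(E _ _ _ _ E0'); apply: (Hdiv _ _ _ (goodB gR (goodZ gR d Rk) (goodZ gR m R0))).
  by rewrite (E _ _ _ _ E0); apply: gdvdMn.
pose gens (N : nat) (d : nat) := (0 < d)%N /\ step_ideal R h N d /\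
  forall m, step_ideal R h N m -> (d%:Z %| m)%Z.
pose Q (j : nat) (p : nat * Y) := exists d : nat, gens j`! d /\ (p.1 * d = j`!)%N /\ step_cond R h j`! p.2.
have [||||f Hf] := @choice_ifun S HS nat (nat * Y)%type _ _ Q.
- exact: small_nat.
- by apply: small_prod; [exact: small_nat|exact: igrp_small].
- by rewrite /Q /gens /step_ideal /step_cond; dfn.
- move=> j; have N0 := fact_gt0 j.
  have IN : step_ideal R h j`! j`!%:Z.
    exists 0, 0; split; first exact: good0.
    by rewrite addr0; exists h.
  have IB m n : step_ideal R h j`! m -> step_ideal R h j`! n -> step_ideal R h j`! (m - n).
    exact: step_idealB.
  have [|d Hd] := int_ideal IB.
    by exists j`!%:Z; split=> //; rewrite eqz_nat -lt0n.
  have [d0 [Id gen]] := Hd; have [y [Hy _]] := step_solve gR d0 Id gen.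
  have /dvdnP [L EL] : (d %| j`!)%N by have := gen _ IN.
  by exists (L, y), d; split=> //; split.
have [L HL] : exists L : ifun nat nat, forall j, L j = (f j).1.
  by apply: ifun_ex; [exact: small_nat|dfn].
have [c Hc] : exists c : ifun nat Y, forall j, c j = (f j).2.
  by apply: ifun_ex; [exact: small_nat|dfn].
have Hf' j : exists d, gens j`! d /\ (L j * d = j`!)%N /\ step_cond R h j`! (c j).
  by rewrite HL Hc; apply: Hf.
have near j d y : gens j`! d -> (L j * d = j`!)%N -> step_cond R h j`! (c j) ->
    step_cond R h j`! y -> gdvd (L j) (y - c j).
  move=> [d0 [[k [g [Rk D]]] _]] Ed Cc Cy; apply: (tfree_gdvd tf d0); rewrite Ed.
  have := gdvdB (Cy _ _ _ Rk D) (Cc _ _ _ Rk D).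
  by rewrite opprD addrACA subrr addr0 -mulrzBl pmulrn.
have [y Hy] : exists y, forall k, gdvd (L k) (y - c k).
  apply: sc.
  - move=> j; have [d [_ [E _]]] := Hf' j.
    by have := fact_gt0 j; rewrite -E muln_gt0 => /andP [].
  - move=> j; have [d [gd [E C]]] := Hf' j; have [d' [gd' [E' C']]] := Hf' j.+1.
    have [d0 [[k [g [Rk D]]] _]] := gd; have [d0' [_ gen']] := gd'.
    (* If j! divides h d + k, then (j+1)! divides its (j+1)-fold. Hence d' divides d (j+1), which is
       equivalent to L_j dividing L_(j+1). *)
    have : (d'%:Z %| d%:Z * j.+1%:Z)%Z.
      apply: gen'; exists (k *~ j.+1), (g *~ j.+1); split; first exact: goodZ.
      by rewrite factS mulnC mulrzA -mulrzDl -pmulrn; apply: gdvdMn.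
    rewrite -PoszM => /dvdnP /= [e Ee].
    apply/dvdnP; exists e; apply/eqP; rewrite -(eqn_pmul2r d0') E' factS -E.
    by rewrite mulnCA [(j.+1 * d)%N]mulnC Ee mulnCA mulnA.
  - move=> j; have [d [gd [E C]]] := Hf' j; have [d' [gd' [E' C']]] := Hf' j.+1.
    apply: (near j d) => //; apply: (step_cond_dvd (r := j.+1)) => //.
    by rewrite mulnC -factS.
have Hj j : step_cond R h j`! y.
  have [d [[d0 [_ gen]] [E C]]] := Hf' j => m k g Rk D.
  have /dvdzP [q Eq] : (d%:Z %| m)%Z by apply: gen; exists k, g.
  have [z Ez] := Hy j.
  have -> : y *~ m + g = (y - c j) *~ m + (c j *~ m + g).
    by rewrite addrA -mulrzDl subrK.
  apply: gdvdD; last exact: C Rk D.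
  rewrite Ez Eq -E; exists (z *~ q).
  by rewrite mulrC mulrzA -!pmulrn -mulrnA pmulrn mulrzAC pmulrn.
exists y => -[|n].
  move=> m k g Rk D; have m0 : m = 0.
    by apply: contrapT => /eqP m0; apply: nex; exists m; split=> //; exists k, g.
  by move: D; rewrite m0 !mulr0z !add0r; apply: Hdiv Rk.
have /dvdnP [r Er] : (n.+1 %| n.+1`!)%N by apply: dvdn_fact; rewrite leqnn.
apply: (step_cond_dvd (r := r)) => //; last by rewrite mulnC -Er.
by have := fact_gt0 n.+1; rewrite Er muln_gt0 => /andP [].
Qed.

(** Zorn over the good relations: [step] makes a maximal one total, and its clause n = 0 makes it a
    function. *)
Lemma extend (R0 : iset (H * Y)) : (forall (R : iset (H * Y)) h, good R -> one_step R h) -> good R0 ->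
  exists f : ifun H Y, ihom f /\ forall h y, R0 (h, y) -> f h = y.
Proof.
move=> step g0.
have sH : small H by exact: igrp_small.
have sHY : small (H * Y)%type by apply: small_prod; apply: igrp_small.
have [||M [gM [RM maxM]]] := @zorn S HS (H * Y)%type _ good R0 sHY _ g0.
- by rewrite /good; dfn.
- move=> K U [A0 KA0] KF Kch uU; split; first by apply/uU; exists A0; split=> //; case: (KF _ KA0).
  split.
    move=> p q /uU [A [KA Ap]] /uU [B [KB Bq]]; apply/uU.
    have [sAB|sBA] := Kch _ _ KA KB.
      by exists B; split=> //; have [_ [HB _]] := KF _ KB; apply: HB => //; apply: sAB.
    by exists A; split=> //; have [_ [HA _]] := KF _ KA; apply: HA => //; apply: sBA.
  by move=> h y n /uU [A [KA Ap]]; have [_ [_ HA]] := KF _ KA; apply: HA Ap.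
have Mtot h : exists y, M (h, y).
  have [y Hy] := step M h gM; exists y.
  have [A HA] : exists A : iset (H * Y), forall p, A p <->
      exists m k g, M (k, g) /\ p = (h *~ m + k, y *~ m + g).
    by apply: iset_ex => //; dfn.
  have MA : isub_set M A.
    by move=> [k g] Mk; apply/HA; exists 0, k, g; split=> //; rewrite !mulr0z !add0r.
  suff /maxM/(_ MA) <- : good A.
    by apply/HA; exists 1, 0, 0; split; [exact: good0|rewrite !mulr1z !addr0].
  split; first by apply: MA; case: gM.
  split.
    move=> p q /HA [m [k [g [Mk ->]]]] /HA [m' [k' [g' [Mk' ->]]]]; apply/HA.
    exists (m - m'), (k - k'), (g - g'); split; first exact: goodB.
    by congr pair; rewrite /= mulrzBr opprD addrACA.
  by move=> h' y' n /HA [m [k [g [Mk [-> ->]]]]] D; apply: Hy Mk D.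
have Mfun h y y' : M (h, y) -> M (h, y') -> y = y'.
  move=> My My'; have := goodB gM My My'; rewrite subrr => M0.
  have [_ [_ Hdiv]] := gM; have /gdvd0/eqP := Hdiv _ _ 0%N M0 (proj2 (gdvd0 0) erefl).
  by rewrite subr_eq0 => /eqP.
pose f0 h := sval (cid (Mtot h)).
have f0P h : M (h, f0 h) by exact: (svalP (cid (Mtot h))).
have df : dF f0.
  apply: (dF_rel (R := fun h y => M (h, y))); last by dfn.
  by move=> h y; split=> [->|My]; [exact: f0P|apply: Mfun My (f0P h)].
have [f Hf] := ifun_ex sH df; exists f; split=> [x y|h y /RM My]; rewrite !Hf.
  by apply: Mfun (f0P _) _; apply: goodD.
exact: Mfun (f0P h) My.
Qed.
End Extension2.

(** Purity of [i] is what makes the set of pairs (i v, f v) a good relation, with n = 0 accounting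
    for injectivity. *)
Lemma scompact_pure_injective {S : structure} {HS : zfc S} (X : zmodType) {EX : Enc S X} {IX : igrp X} :
  tfree X -> scompact X -> forall (V W : zmodType) (EV : Enc S V) (EW : Enc S W)
   (IV : igrp V) (IW : igrp W) (i : ifun V W) (f : ifun V X), ipure i -> ihom f ->
     exists g : ifun W X, ihom g /\ forall v, g (i v) = f v.
Proof.
move=> tf sc V W EV EW IV IW i f [hi [ii pi]] hf.
have [R HR] : exists R : iset (W * X), forall p, R p <-> exists v, p = (i v, f v).
  by apply: iset_ex; [apply: small_prod; apply: igrp_small|dfn].
have [||g [hg Hg]] := extend (R0 := R).
- by move=> R' h gR'; apply: step_scompact.
- split; first by apply/HR; exists 0; rewrite !ihom0.
  split.
    move=> p q /HR [v ->] /HR [w ->]; apply/HR; exists (v - w).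
    by congr pair; rewrite /= ihomB.
  by move=> h y n /HR [v [-> ->]] /pi /(ihom_dvd hf).
by exists g; split=> // v; apply: Hg; apply/HR; exists v.
Qed.

(** * Groups of internal functions and quotient groups *)

Section FunGroup.
Context {S : structure} {HS : zf S} {T : Type} {ET : Enc S T}.
Context {V : zmodType} {EV : Enc S V}.

(** One construction serves full products, coherent sequences and finitely supported functions. All
    conditions are bundled so that the group structure of [fun_grp P] depends on [P] alone. *)
Record fsub := FSub {
  fs_small : small T;
  fs_igrp : igrp V;
  fs_pred :> ifun T V -> Prop;
  fs_def : dP fs_pred;
  fs_0 : forall f : ifun T V, (forall t, f t = 0) -> fs_pred f;
  fs_B : forall f g h : ifun T V, fs_pred f -> fs_pred g -> (forall t, h t = f t - g t) -> fs_pred h }.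

Variable P : fsub.
Let sT := fs_small P.
#[local] Instance IV : igrp V := fs_igrp P.

Record fun_grp := FG { fg_val :> ifun T V; fg_prop : P fg_val }.

Lemma fg_inj : injective fg_val.
Proof. by move=> [f Hf] [g Hg] /= E; subst; congr FG. Qed.

Lemma fgP (f g : fun_grp) : (forall t, f t = g t) -> f = g.
Proof. by move=> E; apply/fg_inj/ifunP. Qed.

Lemma fg_dom : dP (fun f => exists x, f = fg_val x).
Proof.
have HP := fs_def P; apply: (@dP_ext _ _ _ _ (fs_pred P)); last by dfn.
by move=> f; split=> [[[g Hg] ->]//|Hf]; exists (FG Hf).
Qed.

#[global] Instance Enc_fun_grp : Enc S fun_grp := enc_via fg_inj fg_dom.

Lemma dF_fg_val : dF fg_val.
Proof. exact: dF_via. Qed.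

HB.instance Definition _ := gen_eqMixin fun_grp.
HB.instance Definition _ := gen_choiceMixin fun_grp.

Lemma fg_sub_ex (x y : fun_grp) : exists z : fun_grp, forall t, z t = x t - y t.
Proof.
have [|z Hz] := @ifun_ex S HS T V ET EV (fun t => x t - y t) sT; first by dfn.
by exists (FG (fs_B (fg_prop x) (fg_prop y) Hz)).
Qed.

Lemma fg_zero_ex : exists z : fun_grp, forall t, z t = 0.
Proof.
have [|z Hz] := @ifun_ex S HS T V ET EV (fun t => 0) sT; first by dfn.
by exists (FG (fs_0 P Hz)).
Qed.

Definition fg_zero := sval (cid fg_zero_ex).
Definition fg_sub x y := sval (cid (fg_sub_ex x y)).
Definition fg_opp x := fg_sub fg_zero x.
Definition fg_add x y := fg_sub x (fg_opp y).

Lemma fg_zeroE t : fg_zero t = 0.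
Proof. exact: (svalP (cid fg_zero_ex) t). Qed.

Lemma fg_subE x y t : fg_sub x y t = x t - y t.
Proof. exact: (svalP (cid (fg_sub_ex x y)) t). Qed.

Lemma fg_oppE x t : fg_opp x t = - x t.
Proof. by rewrite fg_subE fg_zeroE sub0r. Qed.

Lemma fg_addE0 x y t : fg_add x y t = x t + y t.
Proof. by rewrite fg_subE fg_oppE opprK. Qed.

Lemma fg_addA : associative fg_add.
Proof. by move=> x y z; apply: fgP => t; rewrite !fg_addE0 addrA. Qed.
Lemma fg_addC : commutative fg_add.
Proof. by move=> x y; apply: fgP => t; rewrite !fg_addE0 addrC. Qed.
Lemma fg_add0 : left_id fg_zero fg_add.
Proof. by move=> x; apply: fgP => t; rewrite fg_addE0 fg_zeroE add0r. Qed.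
Lemma fg_addN : left_inverse fg_zero fg_opp fg_add.
Proof. by move=> x; apply: fgP => t; rewrite fg_addE0 fg_oppE fg_zeroE addNr. Qed.

HB.instance Definition _ := GRing.isZmodule.Build fun_grp fg_addA fg_addC fg_add0 fg_addN.

Implicit Types x y : fun_grp.

Lemma fgD x y t : (x + y) t = x t + y t. Proof. exact: fg_addE0. Qed.
Lemma fgN x t : (- x) t = - x t. Proof. exact: fg_oppE. Qed.
Lemma fg0 t : (0 : fun_grp) t = 0. Proof. exact: fg_zeroE. Qed.
Lemma fgB x y t : (x - y) t = x t - y t. Proof. by rewrite fgD fgN. Qed.
Lemma fgMn x n t : (x *+ n) t = x t *+ n.
Proof. by elim: n => [|n IHn]; rewrite ?mulr0n ?fg0 // !mulrS fgD IHn. Qed.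
Lemma fgMz x m t : (x *~ m) t = x t *~ m.
Proof. by case: m => n; rewrite ?NegzE ?mulrNz ?fgN -!pmulrn fgMn. Qed.
Lemma fg_sum (I : Type) (r : seq I) (F : I -> fun_grp) t :
  (\sum_(i <- r) F i) t = \sum_(i <- r) F i t.
Proof.
by elim: r => [|i r IHr]; rewrite ?big_nil ?fg0 // !big_cons fgD IHr.
Qed.

#[global] Instance igrp_fun_grp : igrp fun_grp.
Proof.
have Hv := dF_fg_val.
split; last first.
  by apply: (small_inj Hv fg_inj); apply: small_ifun => //; apply: igrp_small.
apply: (@dP_ext _ _ _ _ (fun p : fun_grp * fun_grp * fun_grp => forall t, p.2 t = p.1.1 t + p.1.2 t)); last by dfn.
by move=> [[x y] z] /=; split=> [-> t|E]; [rewrite fgD|apply: fgP => t; rewrite fgD].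
Qed.
End FunGroup.

Section FunGroup2.
Context {S : structure} {HS : zf S} {T : Type} {ET : Enc S T}.
Context {V : zmodType} {EV : Enc S V} {P : fsub (T := T) (V := V)}.
Context {G : Type} {EG : Enc S G}.

Lemma dF_fg (f : G -> fun_grp P) : dF f -> dF (fun g => fg_val (f g)).
Proof. move=> Hf; exact: (dF_app1 (dF_fg_val P) Hf). Qed.

Lemma dF_fgI (f : G -> fun_grp P) : dF (fun p : G * T => f p.1 p.2) -> dF f.
Proof.
move=> Hf; apply: (dF_lift (f := @fg_val _ _ _ _ _ _ P)).
- exact (@fg_inj _ _ _ _ _ _ P).
- exact (dF_fg_val P).
by apply: dF_ifun.
Qed.
End FunGroup2.
Ltac dfn_fg := lazymatch goal with
  | |- dF (fun t => fg_val (@?f t)) => apply (@dF_fg _ _ _ _ _ _ _ _ _ f)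
  end.
Ltac dfn_fun ::= first [dfn_fun0 | dfn_add | dfn_natmul | dfn_intmul | dfn_fg].

Section Quotient.
Variable V : zmodType.

Record zsub := ZSub {
  sg_pred :> V -> Prop;
  sg_0 : sg_pred 0;
  sg_B : forall x y, sg_pred x -> sg_pred y -> sg_pred (x - y) }.

Definition sg_mem (P : zsub) : {pred V} := fun x => `[< P x >].

Lemma sg_closed P : zmod_closed (sg_mem P).
Proof.
by split=> [|x y /asboolP Px /asboolP Py]; apply/asboolP; [exact: sg_0|exact: sg_B].
Qed.

HB.instance Definition _ P := GRing.isZmodClosed.Build V (sg_mem P) (sg_closed P).

Definition qt (P : zsub) : zmodType := Quotient.quot (sg_mem P).

Variable P : zsub.

Definition qpi (x : V) : qt P := (\pi_(Quotient.quot (sg_mem P)) x)%qT.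

Lemma qpi_eq x y : qpi x = qpi y <-> P (x - y).
Proof.
split=> [/eqP|H]; first by rewrite -Quotient.idealrBE => /asboolP.
by apply/eqP; rewrite -Quotient.idealrBE; apply/asboolP.
Qed.

Lemma qpi_surj (q : qt P) : exists x, q = qpi x.
Proof. by exists (repr q); rewrite /qpi reprK. Qed.

Lemma qpiD x y : qpi (x + y) = qpi x + qpi y.
Proof. by rewrite /qpi !piE. Qed.

Lemma qpi0 : qpi 0 = 0.
Proof. by have /eqP := qpiD 0 0; rewrite addr0 -subr_eq0 opprD addrA subrr sub0r oppr_eq0 => /eqP. Qed.

Lemma qpiN x : qpi (- x) = - qpi x.
Proof. by apply/eqP; rewrite -addr_eq0 -qpiD addNr qpi0. Qed.

Lemma qpiB x y : qpi (x - y) = qpi x - qpi y.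
Proof. by rewrite qpiD qpiN. Qed.

Lemma qpiMn x n : qpi (x *+ n) = qpi x *+ n.
Proof. by elim: n => [|n IHn]; rewrite ?mulr0n ?qpi0 // !mulrS qpiD IHn. Qed.

Lemma qpi_eq0 x : qpi x = 0 <-> P x.
Proof. by rewrite -qpi0 qpi_eq subr0. Qed.

Lemma gdvd_qpi n x : gdvd n (qpi x) <-> exists z, P (x - z *+ n).
Proof.
split=> [[q]|[z]]; last by move/qpi_eq; rewrite qpiMn => ->; exists (qpi z).
by have [z ->] := qpi_surj q; rewrite -qpiMn => /qpi_eq H; exists z.
Qed.
End Quotient.

Section EncQuotient.
Context {S : structure} {HS : zf S} {V : zmodType} {EV : Enc S V} {IV : igrp V}.
Variable P : zsub V.
Context {U : Type} {EU : Enc S U} (f : qt P -> U).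
Hypotheses (fi : injective f) (df : dF (fun x : V => f (qpi P x))).

Lemma quot_dom : dP (fun u => exists q, u = f q).
Proof.
pose g x := f (qpi P x); have dg : dF g by [].
apply: (@dP_ext _ _ _ _ (fun u => exists x, u = g x)); last by dfn.
by move=> u; split=> [[q ->]|[x ->]]; [have [x ->] := qpi_surj q; exists x|exists (qpi P x)].
Qed.

(** The injection [f] into an encoded type is left open: B/A has to be coded by cosets and J_p by
    sequences of cosets, to agree with the codes of the statement. *)
Definition Enc_quot : Enc S (qt P) := enc_via fi quot_dom.

Lemma dF_qpi : @dF S HS V (qt P) EV Enc_quot (qpi P).
Proof.
apply: (@dF_lift _ _ _ _ _ _ Enc_quot _ f) => //.
exact: (@dF_via _ _ _ _ _ f fi quot_dom).
Qed.

Lemma igrp_quot : @igrp S HS (qt P) Enc_quot.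
Proof.
have Hp := dF_qpi; set E := Enc_quot in Hp *.
split; last first.
  by apply: (small_surj Hp) => [q|]; [have [x ->] := qpi_surj q; exists x|exact: igrp_small].
apply: (@dP_ext _ _ _ _ (fun p : qt P * qt P * qt P => exists x y, p.1.1 = qpi P x /\ p.1.2 = qpi P y /\ p.2 = qpi P (x + y))).
  move=> [[a b] c] /=; split=> [->|[x [y [-> [-> ->]]]]]; last by rewrite qpiD.
  have [x ->] := qpi_surj a; have [y ->] := qpi_surj b.
  by exists x, y; rewrite qpiD.
by dfn.
Qed.
End EncQuotient.

Section FullGroup.
Context {S : structure} {HS : zf S} {T : Type} {ET : Enc S T} (sT : small T).
Context {V : zmodType} {EV : Enc S V} (IV : igrp V).

Lemma full_def : dP (fun _ : ifun T V => True).
Proof. by dfn. Qed.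

Definition full : fsub := FSub sT IV full_def (fun _ _ => I) (fun _ _ _ _ _ _ => I).

Definition all_fun := fun_grp full.

Lemma all_fun_ex (f : T -> V) : dF f -> exists x : all_fun, forall t, x t = f t.
Proof. by move=> df; have [x Hx] := ifun_ex sT df; exists (FG (P := full) (fg_val := x) I). Qed.
End FullGroup.

(** * Quotients of the Baer-Specker group *)

Section Baer.
Context {S : structure} {HS : zfc S}.

Definition Bgrp := all_fun (@small_nat S _) igrp_int.

Variable P : zsub Bgrp.
Context {EX : Enc S (qt P)} {IX : igrp (qt P)}.
Hypothesis dpi : dF (qpi P).
Hypothesis Pfin : forall x : Bgrp, (exists k, forall n, (k <= n)%N -> x n = 0) -> P x.

(* The limit of the partial sums [x_0 + sum_(j < k) L_j d_j] is taken diagonally: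
   only finitely many coordinates of the difference fail to be divisible. *)
Lemma scompact_Bquot : scompact (qt P).
Proof.
move=> L c L0 Ldvd Lc.
have sB : small Bgrp by exact: igrp_small.
have [||x Hx] := @choice_ifun S _ nat Bgrp _ _ (fun k b => qpi P b = c k) small_nat sB.
- by dfn.
- by move=> k; have [b ->] := qpi_surj (c k); exists b.
(* Membership in [P] is written as an equation between classes because definability is known for
   [qpi]. *)
have [||d Hd] := @choice_ifun S _ nat Bgrp _ _
    (fun k b => qpi P (x k.+1 - x k - b *+ L k) = qpi P 0) small_nat sB.
- by dfn.
- move=> k; have := Lc k; rewrite -!Hx -qpiB => /gdvd_qpi [z Hz]; exists z.
  by apply/qpi_eq; rewrite subr0.
pose y0 n : int := x 0%N n + \sum_(0 <= j < n) d j n *+ L j.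
have [y Hy] : exists y : Bgrp, forall n, y n = y0 n.
  by apply: all_fun_ex; rewrite /y0; dfn.
pose yk k : Bgrp := x 0%N + \sum_(j < k) d j *+ L j.
have ykc k : qpi P (yk k) = c k.
  elim: k => [|k IHk]; first by rewrite /yk big_ord0 addr0 Hx.
  rewrite /yk big_ord_recr addrA qpiD -/(yk k) IHk /=.
  have := Hd k; rewrite !qpiB qpi0 !Hx => /eqP; rewrite subr_eq0 => /eqP <-.
  by rewrite addrC subrK.
have LL k m : (k <= m)%N -> (L k %| L m)%N.
  move=> /subnK <-; elim: (m - k)%N => [|i IHi] //.
  by apply: dvdn_trans IHi _; rewrite addSn.
exists (qpi P y) => k; rewrite -(ykc k) -qpiB; apply/gdvd_qpi.
(* At a place n beyond k, y minus the k-th partial sum is the sum of d_j L_j over k <= j < n, and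
   L_k divides all these L_j. *)
have dv n : (k <= n)%N -> gdvd (L k) ((y - yk k) n).
  move=> kn; rewrite fgB Hy /y0 big_mkord /yk fgD opprD addrACA subrr add0r fg_sum.
  have -> : \sum_(i < k) (d i *+ L i) n = \sum_(i < k) d i n *+ L i :> int.
    by apply: eq_bigr => i _; rewrite fgMn.
  have Hm m : (k <= m)%N ->
    gdvd (L k) (\sum_(j < m) d j n *+ L j - \sum_(i < k) d i n *+ L i).
    move/subnK <-; elim: (m - k)%N => [|i IHi]; first by rewrite add0n subrr; exists 0; rewrite mul0rn.
    rewrite addSn big_ord_recr /= addrAC; apply: gdvdD => //.
    by apply: (gdvd_dvdn (LL k (i + k)%N (leq_addl _ _))); apply: gdvdxx.
  exact: Hm.
pose w : Bgrp := y - yk k.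
have [||z Hz] := @choice_ifun S _ nat int _ _ (fun n z => (k <= n)%N -> w n = z *+ L k)
  small_nat small_int.
- by dfn.
- move=> n; case: (leqP k n) => kn; last by exists 0.
  by have [z Ez] := dv n kn; exists z.
exists (FG (P := full small_nat igrp_int) (fg_val := z) I).
apply: Pfin; exists k => n kn; rewrite fgB fgMn /=.
by rewrite -/w -Hz // subrr.
Qed.
End Baer.

(** * The p-adic integers *)

Lemma gdvd_int (n : nat) (z : int) : gdvd n z <-> (n%:Z %| z)%Z.
Proof.
split=> [[k ->]|/dvdzP [k ->]]; first by apply/dvdzP; exists k; rewrite -mulr_natr natz.
by exists k; rewrite -mulr_natr natz.
Qed.

Section Padic.
Context {S : structure} {HS : zfc S} (p : nat) (pp : prime p).

(** A p-adic integer is given by integers x_k that matter modulo p^k only. Taking integers instead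
    of elements of Z/p^k keeps all terms in one type, at the price of a quotient by [pnull]. *)
Definition pcoh (x : ifun nat int) := forall k, ((p ^ k)%N%:Z %| x k.+1 - x k)%Z.

Lemma pcoh_def : dP pcoh.
Proof. by rewrite /pcoh; dfn. Qed.

Lemma pcoh0 (f : ifun nat int) : (forall t, f t = 0) -> pcoh f.
Proof. by move=> H k; rewrite !H subr0 dvdz0. Qed.

Lemma pcohB (f g h : ifun nat int) : pcoh f -> pcoh g -> (forall t, h t = f t - g t) -> pcoh h.
Proof.
move=> Hf Hg H k; rewrite !H.
have -> : f k.+1 - g k.+1 - (f k - g k) = (f k.+1 - f k) - (g k.+1 - g k) by ring.
by rewrite rpredB.
Qed.

Definition cohs := fun_grp (FSub small_nat igrp_int pcoh_def pcoh0 pcohB).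

Definition pnull (x : cohs) := forall k, ((p ^ k)%N%:Z %| x k)%Z.

Lemma pnull0 : pnull 0. Proof. by move=> k; rewrite fg0 dvdz0. Qed.

Lemma pnullB x y : pnull x -> pnull y -> pnull (x - y).
Proof. by move=> Hx Hy k; rewrite fgB rpredB. Qed.

Definition Jp : zmodType := qt (ZSub pnull0 pnullB).
Definition Jpi : cohs -> Jp := qpi _.

Implicit Types x y z : cohs.

Lemma pcoh_le x k m : (k <= m)%N -> ((p ^ k)%N%:Z %| x m - x k)%Z.
Proof.
move/subnK <-; elim: (m - k)%N => [|i IHi]; first by rewrite add0n subrr dvdz0.
rewrite addSn; have -> : x (i + k).+1 - x k = (x (i + k).+1 - x (i + k)%N) + (x (i + k)%N - x k) by ring.
rewrite rpredD //; apply: dvdz_trans (fg_prop x (i + k)%N).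
by rewrite dvdzE /= dvdn_exp2l // leq_addl.
Qed.

Lemma Jpi_eq x y : Jpi x = Jpi y <-> forall k, ((p ^ k)%N%:Z %| x k - y k)%Z.
Proof. by rewrite /Jpi qpi_eq; split=> H k; have := H k; rewrite fgB. Qed.

Lemma p_dvdz_mul (u : nat) k (z : int) : coprime p u -> ((p ^ k)%N%:Z %| z *+ u)%Z -> ((p ^ k)%N%:Z %| z)%Z.
Proof.
move=> cp; rewrite -mulr_natr natz Gauss_dvdzl //.
by rewrite /coprimez /gcdz /= -/(coprime (p ^ k) u); rewrite eqz_nat; apply/coprimeXl.
Qed.

Lemma p_dvdz_mulX v k (z : int) : ((p ^ (k + v))%N%:Z %| z *+ (p ^ v)%N)%Z = ((p ^ k)%N%:Z %| z)%Z.
Proof.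
rewrite -mulr_natr natz expnD PoszM dvdz_mul2r //.
by rewrite eqz_nat -lt0n expn_gt0 prime_gt0.
Qed.

Lemma logn_split n : (0 < n)%N -> exists u, coprime p u /\ n = (u * p ^ logn p n)%N.
Proof. by move=> n0; have [u cp E] := pfactor_coprime pp n0; exists u. Qed.

Lemma Jp_tfree : tfree Jp.
Proof.
move=> n q n0; have [x ->] := qpi_surj q; rewrite -/(Jpi x) -qpiMn -(qpi0 _).
move=> /Jpi_eq H; apply/Jpi_eq => k; rewrite fg0 subr0.
have [u [cp En]] := logn_split n0; set v := logn p n in En.
have := H (k + v)%N; rewrite fg0 subr0 fgMn En mulrnA p_dvdz_mulX => /p_dvdz_mul -/(_ cp) D.
have -> : x k = x (k + v)%N - (x (k + v)%N - x k) by ring.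
by rewrite rpredB // pcoh_le // leq_addr.
Qed.

(** Write n = u p^v with u prime to p. As u is invertible modulo every p^k, only the power p^v
    matters; the k-th term of a quotient is computed from the term k + v, since division by p^v
    costs v places of precision. *)
Lemma Jp_gdvd n x : (0 < n)%N -> gdvd n (Jpi x) <-> ((p ^ logn p n)%N%:Z %| x (logn p n))%Z.
Proof.
move=> n0; have [u [cp En]] := logn_split n0; set v := logn p n in En *.
split=> [/gdvd_qpi [z Hz]|D].
  have := Hz v; rewrite fgB fgMn => Hv.
  have -> : x v = (x v - z v *+ n) + z v *+ n by ring.
  by rewrite rpredD // En -mulr_natr natz PoszM mulrA dvdz_mull.
have Dk k : exists z : int, ((p ^ (k + v))%N%:Z %| z *+ n - x (k + v)%N)%Z.
  have : ((p ^ v)%N%:Z %| x (k + v)%N)%Z.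
    have -> : x (k + v)%N = (x (k + v)%N - x v) + x v by ring.
    by rewrite rpredD // pcoh_le // leq_addl.
  move/dvdzP => [w Ew].
  have /coprimezP [[a b] /= Eab] : coprimez (p ^ k)%N u.
    by rewrite /coprimez /gcdz /= eqz_nat; apply/coprimeXl.
  (* b inverts u modulo p^k, and w is x_(k+v) divided by p^v. *)
  exists (b * w); rewrite Ew {1}En mulrnA -[X in _ - _ * X]natz mulr_natr -mulrnBl p_dvdz_mulX.
  apply/dvdzP; exists (- (w * a)); rewrite -mulr_natr natz.
  apply/eqP; rewrite -subr_eq0.
  have -> : b * w * u - w - - (w * a) * (p ^ k)%N = w * (a * (p ^ k)%N + b * u - 1) by ring.
  by rewrite Eab subrr mulr0.
have [||z Hz] := @choice_ifun S _ nat int _ _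
  (fun k (z : int) => ((p ^ (k + v))%N%:Z %| z *+ n - x (k + v)%N)%Z) small_nat small_int => //.
  by dfn.
have cz : pcoh z.
  move=> k; apply: (p_dvdz_mul cp); rewrite -(p_dvdz_mulX v) -mulrnA -En.
  have -> : (z k.+1 - z k) *+ n = (z k.+1 *+ n - x (k.+1 + v)%N) - (z k *+ n - x (k + v)%N) +
     (x (k + v).+1 - x (k + v)%N) by rewrite mulrnBl addSn; ring.
  rewrite rpredD ?(fg_prop x) // rpredB //.
  by apply: dvdz_trans (Hz k.+1); rewrite dvdzE /= dvdn_exp2l // addSn.
apply/gdvd_qpi; exists (FG (P := FSub small_nat igrp_int pcoh_def pcoh0 pcohB) (fg_val := z) cz) => k.
rewrite fgB fgMn /=.
have -> : x k - z k *+ n = - (z k *+ n - x (k + v)%N) - (x (k + v)%N - x k) by ring.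
rewrite rpredB ?pcoh_le ?leq_addr // rpredN.
by apply: dvdz_trans (Hz k); rewrite dvdzE /= dvdn_exp2l // leq_addr.
Qed.

Lemma Jp_not_divisible : exists q : Jp, ~ gdvd p q.
Proof.
have c1 : dF (fun _ : nat => 1 : int) by dfn.
have [o Ho] := ifun_ex small_nat c1.
have co : pcoh o by move=> k; rewrite !Ho subrr dvdz0.
exists (Jpi (FG (P := FSub small_nat igrp_int pcoh_def pcoh0 pcohB) (fg_val := o) co)).
have p0 := prime_gt0 pp.
rewrite Jp_gdvd //= Ho -[X in logn p X]expn1 pfactorK // expn1.
rewrite dvdzE /= dvdn1 => /eqP E; by move: pp; rewrite E.
Qed.

(* A sequence of congruences is solved by its limit when the moduli have
   unbounded p-part, and by a term of maximal p-part otherwise. *)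
Lemma Jp_scompact {EJ : Enc S Jp} {IJ : igrp Jp} : dF Jpi -> scompact Jp.
Proof.
move=> dpi L c L0 Ldvd Lc.
have sC : small cohs by exact: igrp_small.
have [||x Hx] := @choice_ifun S _ nat cohs _ _ (fun k b => Jpi b = c k) small_nat sC => //.
- by dfn.
- by move=> k; have [b ->] := qpi_surj (c k); exists b.
have LL k m : (k <= m)%N -> (L k %| L m)%N.
  move=> /subnK <-; elim: (m - k)%N => [|i IHi] //.
  by apply: dvdn_trans IHi _; rewrite addSn.
have cc k m : (k <= m)%N -> gdvd (L k) (c m - c k).
  move=> /subnK <-; elim: (m - k)%N => [|i IHi]; first by rewrite add0n subrr; exists 0; rewrite mul0rn.
  rewrite addSn -(subrK (c (i + k)%N) (c (i + k).+1)) -addrA; apply: gdvdD => //.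
  by apply: gdvd_dvdn (Lc _); apply: LL; rewrite leq_addl.
have xx i k m : (k <= m)%N -> (p ^ i %| L k)%N -> ((p ^ i)%N%:Z %| x m i - x k i)%Z.
  move=> km pi; have := cc k m km; rewrite -!Hx /Jpi -qpiB => /gdvd_qpi [z Hz].
  have -> : x m i - x k i = (x m - x k - z *+ L k) i + z i *+ L k by rewrite !fgB fgMn; ring.
  by rewrite rpredD // -mulr_natr natz dvdz_mull.
have fin k (y : cohs) : ((p ^ logn p (L k))%N%:Z %| y (logn p (L k)) - x k (logn p (L k)))%Z ->
    gdvd (L k) (Jpi y - c k).
  by move=> D; rewrite -Hx /Jpi -qpiB Jp_gdvd // fgB.
have pL k : (p ^ logn p (L k) %| L k)%N by exact: pfactor_dvdnn.
case: (pselect (forall i, exists k, (p ^ i %| L k)%N)) => [unb|/existsNP [i bd]].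
  have [||y Hy] := @choice_ifun S _ nat int _ _
    (fun i (z : int) => exists k, (p ^ i %| L k)%N /\ z = x k i) small_nat small_int.
  - by dfn.
  - by move=> i; have [k Hk] := unb i; exists (x k i), k.
  have yx i k : (p ^ i %| L k)%N -> ((p ^ i)%N%:Z %| y i - x k i)%Z.
    move=> Dk; have [k' [Dk' ->]] := Hy i.
    case: (leqP k k') => [|/ltnW] H; first exact: xx.
    by rewrite -opprB rpredN; apply: xx.
  have cy : pcoh y.
    move=> i; have [k Hk] := unb i.+1.
    have Hk' : (p ^ i %| L k)%N by apply: dvdn_trans Hk; rewrite dvdn_exp2l.
    have -> : y i.+1 - y i = (y i.+1 - x k i.+1) + (x k i.+1 - x k i) - (y i - x k i) by ring.
    rewrite rpredB ?yx // rpredD ?(fg_prop (x k)) //.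
    by apply: dvdz_trans (yx _ _ Hk); rewrite dvdzE /= dvdn_exp2l.
  exists (Jpi (FG (P := FSub small_nat igrp_int pcoh_def pcoh0 pcohB) (fg_val := y) cy)) => k.
  by apply: fin => /=; apply: yx.
have exA : exists v, `[< exists k, logn p (L k) = v >] by exists (logn p (L 0%N)); apply/asboolP; exists 0%N.
have bdA v : `[< exists k, logn p (L k) = v >] -> (v <= i)%N.
  move=> /asboolP [k <-]; rewrite leqNgt; apply/negP => lt; apply: bd; exists k.
  by apply: dvdn_trans (pL k); rewrite dvdn_exp2l // ltnW.
case: (ex_maxnP exA bdA) => v /asboolP [k0 Ek0] vmax.
exists (c k0) => k; rewrite -(Hx k0); apply: fin.
have lv : (logn p (L k) <= logn p (L k0))%N by rewrite Ek0; apply: vmax; apply/asboolP; exists k.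
case: (leqP k k0) => [|/ltnW] H; first exact: xx.
rewrite -opprB rpredN; apply: xx => //.
by apply: dvdn_trans (pL k0); rewrite dvdn_exp2l.
Qed.
End Padic.

(** * Extensions *)

Section Subgroups.
Variables (V : zmodType) (P : zsub V).

Record sgt := SGT { sg_val : V; sg_valP : sg_val \in sg_mem P }.
HB.instance Definition _ := [isSub for sg_val].
HB.instance Definition _ := [Choice of sgt by <:].
HB.instance Definition _ := [SubChoice_isSubZmodule of sgt by <:].

Lemma sg_valD (x y : sgt) : sg_val (x + y) = sg_val x + sg_val y.
Proof. exact: (raddfD (val : sgt -> V)). Qed.

Lemma sg_val_inj : injective sg_val.
Proof. exact: val_inj. Qed.

Context {S : structure} {HS : zf S} {EV : Enc S V} {IV : igrp V}.
Hypothesis dPP : dP (fun x => P x).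

Lemma sg_dom : dP (fun x => exists y, x = sg_val y).
Proof.
apply: (@dP_ext _ _ _ _ (fun x => P x)) => // x; split=> [[[y Hy] ->]|Hx]; first exact/asboolP.
have Hx' : x \in sg_mem P by exact/asboolP.
by exists (SGT Hx').
Qed.

Definition Enc_sgt : Enc S sgt := enc_via sg_val_inj sg_dom.

Lemma dF_sg_val : @dF S HS sgt V Enc_sgt EV sg_val.
Proof. exact: (@dF_via _ _ _ _ _ sg_val sg_val_inj sg_dom). Qed.

Lemma igrp_sgt : @igrp S HS sgt Enc_sgt.
Proof.
have Hv := dF_sg_val; set E := Enc_sgt in Hv *.
split; last exact: (small_inj Hv sg_val_inj igrp_small).
apply: (@dP_ext _ _ _ _ (fun p : sgt * sgt * sgt => sg_val p.2 = sg_val p.1.1 + sg_val p.1.2)).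
  by move=> [[x y] z] /=; split=> [->|E']; [rewrite sg_valD|apply: sg_val_inj; rewrite sg_valD].
by dfn.
Qed.
End Subgroups.

Section Extensions.
Context {S : structure} {HS : zfc S} {X : zmodType} {EX : Enc S X} {IX : igrp X}.

Definition exact_seq (V W : zmodType) {EV : Enc S V} {EW : Enc S W} (j : ifun X W) (r : ifun W V) :=
  ihom j /\ injective j /\ ihom r /\ (forall v, exists w, v = r w) /\
  forall w, (exists x, w = j x) <-> r w = 0.

Lemma extension_graph (V W : zmodType) {EV : Enc S V} {EW : Enc S W} {IW : igrp W} i q :
  extension (cgrp X) (cgrp V) (cgrp W) i q <->
  exists (j : ifun X W) (r : ifun W V), i = graph j /\ q = graph r /\ exact_seq j r.
Proof.
split.
  move=> [_ [/is_hom_graph [j [-> hj]] [/map_inj_graph ij [/is_hom_graph [r [-> hr]]]]]].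
  move=> [/map_onto_graph sr ex]; exists j, r; split=> //; split=> //; split=> //.
  split=> //; split=> //; split=> // w.
  have Cw : car (cgrp W) (enc w) by exists w.
  have [H1 H2] := ex _ Cw; split.
    move=> [x Ex]; have [|z [/cgrp_zero -> /app_graph_enc E]] := H1.
      by exists (enc x); apply/app_graph_enc; rewrite Ex.
    by einj.
  move=> rw; have [|x /app_graph [x' [_ E]]] := H2; last by exists x'; einj.
  by exists (enc (0 : V)); split; [exact/cgrp_zero|apply/app_graph_enc; rewrite rw].
move=> [j [r [-> [-> [hj [ij [hr [sr ex]]]]]]]]; split; first exact: cgrp_is_grp.
split; first by apply/is_hom_graph; exists j.
split; first exact/map_inj_graph.
split; first by apply/is_hom_graph; exists r.
split; first exact/map_onto_graph.
move=> _ [w ->]; split.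
  move=> [_ /app_graph [x [_ E]]]; exists (enc (0 : V)); split; first exact/cgrp_zero.
  have {}E : w = j x by einj.
  by apply/app_graph_enc; rewrite (proj1 (ex w)) //; exists x.
move=> [z [/cgrp_zero -> /app_graph_enc E]].
have {}E : r w = 0 by einj.
by have [x Ex] := proj2 (ex w) E; exists (enc x); apply/app_graph_enc; rewrite Ex.
Qed.

Hypothesis Xinj : forall (V W : zmodType) (EV : Enc S V) (EW : Enc S W)
   (IV : igrp V) (IW : igrp W) (i : ifun V W) (f : ifun V X), ipure i -> ihom f ->
     exists g : ifun W X, ihom g /\ forall v, g (i v) = f v.

Section Equiv.
Variables (V : zmodType) (EV : Enc S V) (IV : igrp V).
Hypothesis tV : tfree V.

(** If j x = n w with n > 0, then r w is killed by n, hence is 0, and w comes from X. So X is pure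
    in the extension and its identity map extends. *)
Lemma retraction_ex (W : zmodType) (EW : Enc S W) (IW : igrp W) (j : ifun X W) (r : ifun W V) :
  exact_seq j r -> exists s : ifun W X, ihom s /\ forall x, s (j x) = x.
Proof.
move=> [hj [ij [hr [sr ex]]]].
have [|e He] := @ifun_ex S _ X X _ _ id igrp_small; first by dfn.
have [||s [hs Es]] := @Xinj X W EX EW IX IW j e.
- split=> //; split=> // n x [w Ew]; case: n Ew => [|n] Ew.
    by apply/gdvd0/ij; rewrite Ew mulr0n ihom0.
  have rw : r w = 0.
    by apply: (tV (n := n.+1)) => //; rewrite -ihomMn // -Ew; apply/ex; exists x.
  have [x' Ex'] := proj2 (ex w) rw.
  by exists x'; apply: ij; rewrite Ew Ex' ihomMn.
- by move=> x y; rewrite !He.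
by exists s; split=> // x; rewrite Es He.
Qed.

(** Given the retractions, an element of W' is determined by its images in V and in X, and all pairs
    of images occur; f matches these two coordinates. *)
Lemma split_equiv (W W' : zmodType) (EW : Enc S W) (IW : igrp W) (EW' : Enc S W') (IW' : igrp W')
  (j : ifun X W) (r : ifun W V) (j' : ifun X W') (r' : ifun W' V) :
  exact_seq j r -> exact_seq j' r' ->
  exists f : ifun W W', ihom f /\ (forall x, f (j x) = j' x) /\ forall w, r' (f w) = r w.
Proof.
move=> Hj Hj'; have [s [hs Es]] := retraction_ex _ Hj; have [s' [hs' Es']] := retraction_ex _ Hj'.
have [hj [ij [hr [sr ex]]]] := Hj; have [hj' [ij' [hr' [sr' ex']]]] := Hj'.
have uniq w1 w2 : r' w1 = r' w2 -> s' w1 = s' w2 -> w1 = w2.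
  move=> Er Esw; have [x Ex] : exists x, w1 - w2 = j' x.
    by apply/ex'; rewrite ihomB // Er subrr.
  have : s' (w1 - w2) = 0 by rewrite ihomB // Esw subrr.
  rewrite Ex Es' => x0; move: Ex; rewrite x0 ihom0 // => /eqP.
  by rewrite subr_eq0 => /eqP.
have [||f Hf] := @choice_ifun S _ W W' _ _ (fun w w' => r' w' = r w /\ s' w' = s w)
   igrp_small igrp_small.
- by dfn.
- move=> w; have [w0 E0] := sr' (r w).
  exists (w0 + j' (s w - s' w0)); split.
    by rewrite hr' -E0 (proj1 (ex' _)) ?addr0 //; eexists.
  by rewrite hs' Es' addrC subrK.
exists f; split.
  move=> x y; have [r1 s1] := Hf x; have [r2 s2] := Hf y; have [r3 s3] := Hf (x + y).
  by apply: uniq; [rewrite hr' r1 r2 r3 hr|rewrite hs' s1 s2 s3 hs].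
split=> [x|w]; last by case: (Hf w).
have [r1 s1] := Hf (j x); apply: uniq; last by rewrite s1 Es Es'.
by rewrite r1 (proj1 (ex _)) ?(proj1 (ex' _)) //; exists x.
Qed.

Lemma tfree_Ext_trivial : Ext_trivial (cgrp V) (cgrp X).
Proof.
move=> E i q E' i' q' He He'; have [gE _] := He; have [gE' _] := He'.
move: He He'; rewrite -(cgrp_gel gE) -(cgrp_gel gE').
move=> /extension_graph [j [r [-> [-> Hj]]]] /extension_graph [j' [r' [-> [-> Hj']]]].
have [f [hf [Hfj Hfr]]] := split_equiv _ _ Hj Hj'.
exists (graph f); split; first by apply/is_hom_graph; exists f.
split.
  move=> _ _ e' /app_graph [x [-> ->]] /app_graph_enc ->.
  by apply/app_graph_enc; rewrite Hfj.
move=> _ _ g /app_graph [w [-> ->]] /app_graph_enc ->.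
by apply/app_graph_enc; rewrite Hfr.
Qed.
End Equiv.
End Extensions.

(** * Torsion detected by Ext *)

Section Torsion.
Context {S : structure} {HS : zfc S} {X : zmodType} {EX : Enc S X} {IX : igrp X}.

Lemma rat_divisible : divisible rat.
Proof.
move=> [//|n] x _; exists (x / n.+1%:R); rewrite -[RHS]mulr_natr divfK //.
by rewrite pnatr_eq0.
Qed.

Lemma rat_tfree : tfree rat.
Proof. by move=> [//|n] x _ /eqP; rewrite mulrn_eq0 /= => /eqP. Qed.

Lemma qt_divisible (V : zmodType) (P : zsub V) : divisible V -> divisible (qt P).
Proof.
move=> dV n q n0; have [x ->] := qpi_surj q; have [z ->] := dV n x n0.
by rewrite qpiMn; exists (qpi P z).
Qed.

Section Hull.
Hypothesis tX : tfree X.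

Definition rhom := {f : ifun X rat | ihom f}.

Lemma rhom_inj : injective (fun f : rhom => sval f).
Proof. by move=> [f Hf] [g Hg] /= E; subst; congr exist. Qed.

Lemma rhom_dom : dP (fun f => exists x : rhom, f = sval x).
Proof.
apply: (@dP_ext _ _ _ _ (fun f => ihom f)); last by rewrite /ihom; dfn.
by move=> f; split=> [[[g Hg] ->]//|Hf]; exists (exist _ f Hf).
Qed.

#[local] Instance Enc_rhom : Enc S rhom := enc_via rhom_inj rhom_dom.

Lemma small_rhom : small rhom.
Proof.
apply: (small_inj (f := fun f : rhom => sval f)); [exact: dF_via|exact: rhom_inj|].
by apply: small_ifun; [apply: igrp_small|apply: small_rat].
Qed.

(** Since X is torsion-free, sending m x to m is well defined on the multiples of x; the map extends
    because the rationals are divisible. *)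
Lemma rhom_separates (x : X) : x <> 0 -> exists f : ifun X rat, ihom f /\ f x = 1.
Proof.
move=> x0.
have [R HR] : exists R : iset (X * rat), forall p, R p <-> exists m : int, p = (x *~ m, 1 *~ m).
  by apply: iset_ex; [apply: small_prod; [exact: igrp_small|exact: small_rat]|dfn].
have [||f [hf Hf]] := extend (R0 := R).
- by move=> R' h gR'; apply: step_divisible => //; exact: rat_divisible.
- split; first by apply/HR; exists 0; rewrite !mulr0z.
  split.
    by move=> p q /HR [m ->] /HR [m' ->]; apply/HR; exists (m - m'); rewrite !mulrzBr.
  move=> h y [|n] /HR [m [-> ->]]; last by move=> _; apply: rat_divisible.
  move/gdvd0 => E; suff -> : m = 0 by rewrite mulr0z; exists 0; rewrite mul0rn.
  apply: contrapT => /eqP m0; apply: x0; apply: (tX (n := `|m|%N)); first by rewrite absz_gt0.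
  case: m E {m0} => m /= E; first by rewrite pmulrn.
  by move/eqP: E; rewrite NegzE mulrNz oppr_eq0 => /eqP <-; rewrite pmulrn.
by exists f; split=> //; apply: Hf; apply/HR; exists 1; rewrite !mulr1z.
Qed.

(** A power of the rationals with one factor for each homomorphism from X to them; evaluation embeds
    X, by [rhom_separates]. *)
Definition hull : zmodType := all_fun small_rhom igrp_rat.

Lemma hull_ex : exists (D : zmodType) (ED : Enc S D) (e : ifun X D),
  igrp D /\ divisible D /\ tfree D /\ ihom e /\ injective e.
Proof.
exists hull, (Enc_fun_grp (full small_rhom igrp_rat)).
have dv : dF (fun f : rhom => sval f) by exact: dF_via.
have ex x : exists d : all_fun small_rhom igrp_rat, forall f, d f = sval f x.
  by apply: all_fun_ex; dfn.
pose e0 x := sval (cid (ex x)).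
have e0P x f : e0 x f = sval f x by exact: (svalP (cid (ex x)) f).
have de : dF e0.
  apply: dF_fgI; apply: (dF_rel (R := fun (p : X * rhom) (y : rat) => y = sval p.2 p.1)); last by dfn.
  by move=> [x f] y; rewrite e0P.
have [e He] := ifun_ex igrp_small de; exists e.
split; first exact: igrp_fun_grp.
split.
  move=> n d n0.
  have [||z Hz] := @choice_ifun S _ rhom rat _ _ (fun f y => (d : all_fun small_rhom igrp_rat) f = y *+ n) small_rhom small_rat.
  - by dfn.
  - by move=> f; apply: rat_divisible.
  exists (FG (P := full small_rhom igrp_rat) (fg_val := z) I : all_fun small_rhom igrp_rat).
  by apply: fgP => f; rewrite fgMn -Hz.
split.
  move=> n d n0 /(congr1 (fun d : all_fun small_rhom igrp_rat => fg_val d)) E.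
  apply: fgP => f; rewrite fg0; apply: (rat_tfree n0).
  by rewrite -fgMn E fg0.
split.
  by move=> x y; rewrite !He; apply: fgP => f; rewrite fgD !e0P (svalP f).
move=> x y; rewrite !He => E; apply/eqP; rewrite -subr_eq0; apply/eqP.
apply: contrapT => /rhom_separates [f [hf f1]].
have := congr1 (fun d : all_fun small_rhom igrp_rat => d (exist _ f hf)) E.
rewrite !e0P /= => Ef; move: f1; rewrite ihomB // Ef subrr => /eqP.
by rewrite eq_sym oner_eq0.
Qed.
End Hull.
End Torsion.

Section EncCoset.
Context {S : structure} {HS : zf S} {V : zmodType} {EV : Enc S V} {IV : igrp V}.
Variable P : zsub V.
Hypothesis dPP : dP (fun x => P x).

Lemma coset_ex (q : qt P) : exists A : iset V, forall x, A x <-> qpi P x = q.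
Proof.
have [y ->] := qpi_surj q.
apply: iset_ex; first exact: igrp_small.
apply: (@dP_ext _ _ _ _ (fun x => P (x - y))) => [x|]; first exact: qpi_eq.
by have H : dP (fun x : V => sg_pred P x) by []; dfn.
Qed.

Definition coset (q : qt P) : iset V := sval (cid (coset_ex q)).

Lemma cosetP q x : coset q x <-> qpi P x = q.
Proof. exact: (svalP (cid (coset_ex q)) x). Qed.

Lemma coset_inj : injective coset.
Proof.
by move=> q r E; have [x Hx] := qpi_surj q; apply/esym; rewrite Hx; apply/esym/cosetP; rewrite -E; apply/cosetP.
Qed.

Lemma dF_coset : dF (fun x => coset (qpi P x)).
Proof.
apply: dF_iset; apply: (@dP_ext _ _ _ _ (fun p => P (p.2 - p.1))).
  by move=> [x y] /=; rewrite cosetP; exact: qpi_eq.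
by have H : dP (fun x : V => sg_pred P x) by []; dfn.
Qed.

Definition Enc_coset : Enc S (qt P) := Enc_quot coset_inj dF_coset.

Lemma dF_qpi_coset : @dF S HS V (qt P) EV Enc_coset (qpi P).
Proof. exact: dF_qpi. Qed.

Lemma igrp_coset : @igrp S HS (qt P) Enc_coset.
Proof. exact: igrp_quot. Qed.
End EncCoset.

Section Torsion2.
Context {S : structure} {HS : zfc S} {X : zmodType} {EX : Enc S X} {IX : igrp X}.
Context {V : zmodType} {EV : Enc S V} {IV : igrp V}.
Hypothesis tX : tfree X.
Variables (D : zmodType) (ED : Enc S D) (ID : igrp D) (e : ifun X D).
Hypotheses (dD : divisible D) (tD : tfree D) (he : ihom e) (ie : injective e).

Definition im_e (d : D) := exists x, d = e x.
Lemma im_e0 : im_e 0. Proof. by exists 0; rewrite ihom0. Qed.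
Lemma im_eB x y : im_e x -> im_e y -> im_e (x - y).
Proof. by move=> [a ->] [b ->]; exists (a - b); rewrite ihomB. Qed.
Definition im_sub := ZSub im_e0 im_eB.

Lemma im_def : dP (fun d => im_sub d).
Proof. by rewrite /im_sub /= /im_e; dfn. Qed.

#[local] Instance Enc_DX : Enc S (qt im_sub) := Enc_coset im_def.
#[local] Instance igrp_DX : igrp (qt im_sub) := igrp_coset im_def.

Section Pullback.
Variable phi : ifun V (qt im_sub).
Hypothesis hphi : ihom phi.

Definition pb (u : D * V) := qpi im_sub u.1 = phi u.2.
Lemma pb0 : pb 0. Proof. by rewrite /pb /= qpi0 ihom0. Qed.
Lemma pbB x y : pb x -> pb y -> pb (x - y).
Proof. by rewrite /pb /= => Hx Hy; rewrite qpiB ihomB // Hx Hy. Qed.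
Definition pb_sub := ZSub pb0 pbB.

Lemma pb_def : dP (fun u => pb_sub u).
Proof.
have H : dF (qpi im_sub) by exact: (dF_qpi_coset im_def).
by rewrite /pb_sub /= /pb; dfn.
Qed.

#[local] Instance Enc_pb : Enc S (sgt pb_sub) := Enc_sgt pb_def.
#[local] Instance igrp_pb : igrp (sgt pb_sub) := igrp_sgt pb_def.

(* The pullback of [D -> D/X] along [phi] is an extension of [V] by [X]; if it
   splits then [phi] lifts to [D]. *)
Lemma pullback_lift : Ext_trivial (cgrp V) (cgrp X) ->
  exists psi : V -> D, (forall x y, psi (x + y) = psi x + psi y) /\
    forall v, qpi im_sub (psi v) = phi v.
Proof.
move=> triv.
have dv : dF (fun w : sgt pb_sub => sg_val w) by exact: (dF_sg_val pb_def).
have mk u : pb u -> exists w : sgt pb_sub, sg_val w = u.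
  move=> Hu; have Hu' : u \in sg_mem pb_sub by apply/asboolP.
  by exists (SGT Hu').
have valP (w : sgt pb_sub) : pb (sg_val w) by case: w => u /= /asboolP.
have [||j Hj] := @choice_ifun S _ X (sgt pb_sub) _ _ (fun x w => sg_val w = (e x, 0)) igrp_small igrp_small.
- by dfn.
- move=> x; apply: mk; rewrite /pb /= ihom0 //; apply/qpi_eq0; by exists x.
have [|r Hr] := @ifun_ex S _ (sgt pb_sub) V _ _ (fun w => (sg_val w).2) igrp_small; first by dfn.
have [|j0 Hj0] := @ifun_ex S _ X (X * V)%type _ _ (fun x => (x, 0)) igrp_small; first by dfn.
have [|r0 Hr0] := @ifun_ex S _ (X * V)%type V _ _ (fun u => u.2) igrp_small; first by dfn.
have ex0 : exact_seq j0 r0.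
  split; first by move=> x y; rewrite !Hj0; congr pair; rewrite /= addr0.
  split; first by move=> x y; rewrite !Hj0 => -[].
  split; first by move=> x y; rewrite !Hr0.
  split; first by move=> v; exists (0, v); rewrite Hr0.
  move=> [x v]; rewrite Hr0 /=; split=> [[y]|->]; first by rewrite Hj0 => -[].
  by exists x; rewrite Hj0.
have ex1 : exact_seq j r.
  split; first by move=> x y; apply: sg_val_inj; rewrite sg_valD !Hj he; congr pair; rewrite /= addr0.
  split; first by move=> x y /(congr1 (@sg_val _ pb_sub)); rewrite !Hj => -[] /ie.
  split; first by move=> x y; rewrite !Hr sg_valD.
  split.
    move=> v; have [d Ed] := qpi_surj (phi v).
    by have [w Ew] := mk (d, v) (esym Ed); exists w; rewrite Hr Ew.
  move=> w; rewrite Hr; split=> [[x ->]|E]; first by rewrite Hj.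
  have := valP w; rewrite /pb E ihom0 // => /qpi_eq0 [x Ex].
  by exists x; apply: sg_val_inj; rewrite Hj -Ex -E; case: (sg_val w).
have [||f [/is_hom_graph [F [-> hF]] [Hfj Hfr]]] := triv (cgrp (X * V)%type) (graph j0) (graph r0) (cgrp (sgt pb_sub)) (graph j) (graph r).
- by apply/extension_graph; exists j0, r0.
- by apply/extension_graph; exists j, r.
have FrE v : (sg_val (F (0, v))).2 = v.
  have : app (graph r) (enc (F (0, v))) (enc v).
    by apply: (Hfr (enc ((0, v) : (X * V)%type))); apply/app_graph_enc; rewrite ?Hr0.
  by move/app_graph_enc; rewrite Hr => E; exact (esym (encI E)).
exists (fun v => (sg_val (F (0, v))).1); split.
  move=> x y; have -> : (0, x + y) = (0, x) + (0, y) :> X * V by congr pair; rewrite /= addr0.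
  by rewrite hF sg_valD.
by move=> v; have := valP (F (0, v)); rewrite /pb FrE.
Qed.
End Pullback.

(** Otherwise g has order p, and sending it to the class of x0/p extends to a homomorphism from V to
    the divisible group D/X. As Ext vanishes this lifts to D, where the image of g is p-torsion,
    hence 0. So x0/p lies in X, and p divides x0. *)
Lemma Ext_trivial_torsion0 (p : nat) (x0 : X) (g : V) : prime p -> ~ gdvd p x0 ->
  Ext_trivial (cgrp V) (cgrp X) -> g *+ p = 0 -> g = 0.
Proof.
move=> pp nx triv gp; apply: contrapT => gn0.
have p0 := prime_gt0 pp.
have dq : dF (qpi im_sub) by exact: (dF_qpi_coset im_def).
have [d0 Ed0] := dD (e x0) p0.
have gm (m : int) : g *~ m = 0 -> (p%:Z %| m)%Z.
  move=> gm; apply: contrapT => /negP nd; apply: gn0.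
  have /coprimezP [[a b] /= E] : coprimez p%:Z m by rewrite coprimezE prime_coprime.
  by rewrite -[g]mulr1z -E mulrzDr [a * _]mulrC [b * _]mulrC !mulrzA gm mul0rz -pmulrn gp mul0rz add0r.
have Qd : divisible (qt im_sub) by exact: qt_divisible.
have [R HR] : exists R : iset (V * qt im_sub), forall u, R u <->
    exists m : int, u = (g *~ m, qpi im_sub d0 *~ m).
  by apply: iset_ex; [apply: small_prod; exact: igrp_small|dfn].
have [||phi [hphi Hphi]] := extend (R0 := R).
- by move=> R' h gR'; apply: step_divisible.
- split; first by apply/HR; exists 0; rewrite !mulr0z.
  split.
    by move=> u w /HR [m ->] /HR [m' ->]; apply/HR; exists (m - m'); rewrite !mulrzBr.
  move=> h y [|n] /HR [m [-> ->]]; last by move=> _; apply: Qd.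
  move/gdvd0/gm/dvdzP => [k ->]; apply/gdvd0.
  rewrite mulrC mulrzA -pmulrn -qpiMn -Ed0.
  by rewrite (_ : qpi im_sub (e x0) = 0) ?mul0rz //; apply/qpi_eq0; exists x0.
have [psi [psiD psiE]] := pullback_lift hphi triv.
have psi0 : psi 0 = 0 by have /eqP := psiD 0 0; rewrite addr0 -subr_eq0 opprD addrA subrr sub0r oppr_eq0 => /eqP.
have psiMn n v : psi (v *+ n) = psi v *+ n.
  by elim: n => [|n IHn]; rewrite ?mulr0n // !mulrS psiD IHn.
have pg : psi g = 0 by apply: (tD p0); rewrite -psiMn gp.
have : phi g = qpi im_sub d0 by apply: Hphi; apply/HR; exists 1; rewrite !mulr1z.
rewrite -psiE pg qpi0 => /esym/qpi_eq0 [x Ex]; apply: nx; exists x; apply: ie.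
by rewrite ihomMn // -Ex.
Qed.
End Torsion2.

Lemma Ext_trivial_torsion {S : structure} {HS : zfc S} {X V : zmodType} {EX : Enc S X} {EV : Enc S V}
  {IX : igrp X} {IV : igrp V} (p : nat) : tfree X -> prime p -> (exists x : X, ~ gdvd p x) ->
  Ext_trivial (cgrp V) (cgrp X) -> forall g : V, g *+ p = 0 -> g = 0.
Proof.
move=> tX pp [x nx] triv g gp.
have [D [ED [e [ID [dD [tD [he ie]]]]]]] := hull_ex tX.
exact: (Ext_trivial_torsion0 (x0 := x) ID dD tD he ie pp nx triv gp).
Qed.

Lemma tfree_of_primes (V : zmodType) :
  (forall p, prime p -> forall g : V, g *+ p = 0 -> g = 0) -> tfree V.
Proof.
move=> H n; elim/ltn_ind: n => n IH x n0 E.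
case: (ltngtP n 1%N) => [|n1|En]; first by case: n n0 {IH E} => [|[]].
  have pp := pdiv_prime n1; have /dvdnP [m Em] := pdiv_dvd n.
  have m0 : (0 < m)%N by move: n0; rewrite Em muln_gt0 => /andP [].
  apply: (IH m) => //; first by rewrite Em ltn_Pmulr // prime_gt1.
  by apply: (H _ pp); rewrite -mulrnA -Em.
by move: E; rewrite En mulr1n.
Qed.

(** * The orthogonal classes *)

Section Perp.
Context {S : structure} {HS : zfc S}.
Definition pinj (X : zmodType) {EX : Enc S X} := forall (V W : zmodType) (EV : Enc S V) (EW : Enc S W)
   (IV : igrp V) (IW : igrp W) (i : ifun V W) (f : ifun V X), ipure i -> ihom f ->
     exists g : ifun W X, ihom g /\ forall v, g (i v) = f v.

Arguments pinj X {EX}.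

Lemma perp_tfree (X : zmodType) {EX : Enc S X} {IX : igrp X} (G : grp S) (HG : is_grp G) :
  pinj X -> tfree (gel HG) -> perp (cgrp X) G.
Proof.
move=> pX tG; split=> //; rewrite -(cgrp_gel HG).
exact: tfree_Ext_trivial.
Qed.

Lemma perp_torsion (X : zmodType) {EX : Enc S X} {IX : igrp X} (G : grp S) (HG : is_grp G) p :
  tfree X -> prime p -> (exists x : X, ~ gdvd p x) -> perp (cgrp X) G ->
  forall g : gel HG, g *+ p = 0 -> g = 0.
Proof.
move=> tX pp nx [_ triv].
have triv' : Ext_trivial (cgrp (gel HG)) (cgrp X) by rewrite cgrp_gel.
exact: Ext_trivial_torsion triv'.
Qed.

(* Both sides say that [G] is torsion-free. *)
Lemma perp_iff (X : zmodType) {EX : Enc S X} {IX : igrp X} (Y : nat -> zmodType)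
    (EY : forall p, Enc S (Y p)) (IY : forall p, igrp (Y p)) (G : grp S) :
  tfree X -> pinj X -> (forall p, prime p -> exists x : X, ~ gdvd p x) ->
  (forall p, prime p -> tfree (Y p) /\ @pinj (Y p) (EY p) /\ exists x : Y p, ~ gdvd p x) ->
  perp (cgrp X) G <-> forall p, prime p -> perp (@cgrp S (Y p) (EY p)) G.
Proof.
move=> tX pX nX HY; split.
  move=> pG; have [HG _] := pG.
  have tG : tfree (gel HG).
    by apply: tfree_of_primes => p pp; apply: (perp_torsion (HG := HG) tX pp) => //; apply: nX.
  by move=> p pp; have [_ [pY _]] := HY p pp; apply: (@perp_tfree _ _ _ _ HG).
move=> pG; have [HG _] := pG 2%N isT.
apply: (@perp_tfree _ _ _ _ HG) => //.
apply: tfree_of_primes => p pp; have [tY [_ nY]] := HY p pp.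
exact: (perp_torsion (HG := HG) tY pp nY (pG p pp)).
Qed.
End Perp.

(** * Functions with finite support *)

Section FinSupp.
Context {S : structure} {HS : zf S} {I : eqType} {EI : Enc S I} (sI : small I) (i0 : I).
Context {V : zmodType} {EV : Enc S V} (IV : igrp V).

Definition finsupp (T : eqType) (f : T -> V) := exists l : seq T, forall i, i \notin l -> f i = 0.

Lemma nth_def (l : seq I) : dF (fun k => nth i0 l k).
Proof.
elim: l => [|a l IHl]; first by apply: (@dP_ext _ _ _ _ (fun p => p.2 = i0)); [case=> -[|k] x|dfn].
pose g k := nth i0 l k; have dg : dF g by [].
apply: (dF_rel (R := fun k i => (k = 0 /\ i = a) \/ exists k', k = k'.+1 /\ i = g k')%N); last by dfn.
move=> [|k] i /=; split; [by left| |by right; exists k|].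
  by case=> [[_ ->]//|[k' []]].
by case=> [[]//|[k' [[<-] ->]]].
Qed.

(** Lists are not encoded, so a finite support is enumerated by its length and an internal sequence.
    Injectivity below N ensures that a sum along the enumeration counts each index once, which makes
    [sigma] definable. *)
Definition enum_supp (f : I -> V) (N : nat) (s : ifun nat I) :=
  (forall j k, (j < N)%N -> (k < N)%N -> s j = s k -> j = k) /\
  forall i, (forall k, (k < N)%N -> s k <> i) -> f i = 0.

Lemma enum_suppP (f : I -> V) (l : seq I) : uniq l -> (forall i, i \notin l -> f i = 0) ->
  exists s : ifun nat I, enum_supp f (size l) s /\ (forall k, s k = nth i0 l k).
Proof.
move=> ul Hl; have [s Hs] := ifun_ex small_nat (nth_def l).
exists s; split=> //; split=> [j k jN kN|i Hi].
  by rewrite !Hs => /eqP; rewrite nth_uniq // => /eqP.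
apply: Hl; apply/negP => il; apply: (Hi (index i l)); first by rewrite index_mem.
by rewrite Hs nth_index.
Qed.

Lemma enum_supp_list (f : I -> V) N (s : ifun nat I) : enum_supp f N s ->
  uniq (mkseq s N) /\ forall i, i \notin mkseq s N -> f i = 0.
Proof.
move=> [si sc]; split.
  rewrite map_inj_in_uniq ?iota_uniq // => j k; rewrite !mem_iota !add0n => jN kN.
  exact: si.
move=> i Hi; apply: sc => k kN E; move/negP: Hi; apply; rewrite -E.
by apply: map_f; rewrite mem_iota.
Qed.

Lemma finsuppE (f : I -> V) : finsupp f <-> exists N (s : ifun nat I), enum_supp f N s.
Proof.
split=> [[l Hl]|[N [s /enum_supp_list [_ H]]]]; last by exists (mkseq s N).
have [|s [Hs _]] := @enum_suppP f (undup l) (undup_uniq l).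
  by move=> i; rewrite mem_undup; apply: Hl.
by exists (size (undup l)), s.
Qed.

Lemma finsupp_def : dP (fun f : ifun I V => finsupp f).
Proof.
apply: (@dP_ext _ _ _ _ (fun f : ifun I V => exists N (s : ifun nat I), enum_supp f N s)).
  by move=> f; apply: finsuppE.
by rewrite /enum_supp; dfn.
Qed.

Lemma finsupp0 (f : ifun I V) : (forall t, f t = 0) -> finsupp f.
Proof. by move=> H; exists [::]. Qed.

Lemma finsuppB (f g h : ifun I V) : finsupp f -> finsupp g -> (forall t, h t = f t - g t) -> finsupp h.
Proof.
move=> [l Hl] [l' Hl'] H; exists (l ++ l') => i; rewrite mem_cat negb_or => /andP [il il'].
by rewrite H Hl // Hl' // subrr.
Qed.

Definition fs_sub : fsub := FSub sI IV finsupp_def finsupp0 finsuppB.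
Lemma fs_ex (f : I -> V) : dF f -> finsupp f -> exists x : fun_grp fs_sub, forall i, x i = f i.
Proof.
move=> df [l Hl]; have [g Hg] := ifun_ex sI df.
have fg : finsupp g by exists l => i il; rewrite Hg Hl.
by exists (FG (P := fs_sub) (fg_val := g) fg).
Qed.
End FinSupp.

(** * Integral linear combinations of a family *)

Section Sigma.
Context {S : structure} {HS : zf S} {I : eqType} {EI : Enc S I} (sI : small I) (i0 : I).
Context {X : zmodType} {EX : Enc S X} {IX : igrp X}.

Definition fsz := fun_grp (fs_sub sI i0 igrp_int).

Lemma fsz_supp (n : fsz) : exists l : seq I, uniq l /\ forall i, i \notin l -> n i = 0.
Proof.
case: n => f [l Hl]; exists (undup l); split; first exact: undup_uniq.
by move=> i; rewrite mem_undup; apply: Hl.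
Qed.

Definition sigma (tau : I -> X) (n : fsz) : X :=
  \sum_(i <- sval (cid (fsz_supp n))) tau i *~ n i.

Lemma sum_supp_eq (F : I -> X) (l l' : seq I) : uniq l -> uniq l' ->
  (forall i, i \notin l -> F i = 0) -> (forall i, i \notin l' -> F i = 0) ->
  \sum_(i <- l) F i = \sum_(i <- l') F i.
Proof.
move=> ul ul' Hl Hl'.
rewrite (bigID (fun i => i \in l')) /= [X in _ + X]big1 ?addr0; last by move=> i /Hl'.
rewrite [RHS](bigID (fun i => i \in l)) /= [X in _ = _ + X]big1 ?addr0; last by move=> i /Hl.
rewrite -big_filter -[RHS]big_filter; apply: perm_big; apply: uniq_perm; rewrite ?filter_uniq //.
by move=> i; rewrite !mem_filter andbC.
Qed.

Lemma sigmaE (tau : I -> X) (n : fsz) (l : seq I) : uniq l -> (forall i, i \notin l -> n i = 0) ->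
  sigma tau n = \sum_(i <- l) tau i *~ n i.
Proof.
move=> ul Hl; rewrite /sigma; case: cid => l' /= [ul' Hl'].
by apply: sum_supp_eq => // i Hi; [rewrite Hl'|rewrite Hl]; rewrite ?mulr0z.
Qed.

Lemma fsz_supp2 (n m : fsz) : exists l : seq I, uniq l /\
  (forall i, i \notin l -> n i = 0) /\ forall i, i \notin l -> m i = 0.
Proof.
have [l [_ Hl]] := fsz_supp n; have [l' [_ Hl']] := fsz_supp m.
exists (undup (l ++ l')); split; first exact: undup_uniq.
by split=> i; rewrite mem_undup mem_cat negb_or => /andP [il il']; [apply: Hl|apply: Hl'].
Qed.

Lemma sigmaD tau n m : sigma tau (n + m) = sigma tau n + sigma tau m.
Proof.
have [l [ul [Hn Hm]]] := fsz_supp2 n m.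
rewrite (sigmaE _ ul Hn) (sigmaE _ ul Hm) (sigmaE _ (n := n + m) ul).
  by rewrite -big_split /=; apply: eq_bigr => i _; rewrite fgD mulrzDr.
by move=> i il; rewrite fgD Hn // Hm // addr0.
Qed.

Lemma sigmaN tau n : sigma tau (- n) = - sigma tau n.
Proof.
have [l [ul Hn]] := fsz_supp n.
rewrite (sigmaE _ ul Hn) (sigmaE _ (n := - n) ul).
  by rewrite -sumrN; apply: eq_bigr => i _; rewrite fgN mulrNz.
by move=> i il; rewrite fgN Hn // oppr0.
Qed.

Lemma sigmaB tau n m : sigma tau (n - m) = sigma tau n - sigma tau m.
Proof. by rewrite sigmaD sigmaN. Qed.

Lemma sigmaMz tau n (b : int) : sigma tau (n *~ b) = sigma tau n *~ b.
Proof.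
have [l [ul Hn]] := fsz_supp n.
rewrite (sigmaE _ ul Hn) (sigmaE _ (n := n *~ b) ul).
  by rewrite mulrz_suml; apply: eq_bigr => i _; rewrite fgMz -mulrzA mulrzz.
by move=> i il; rewrite fgMz Hn // mul0rz.
Qed.

Lemma sigma_gdvd tau (n : fsz) (d : nat) : (forall i, (d%:Z %| n i)%Z) -> gdvd d (sigma tau n).
Proof.
move=> H; have [l [ul Hn]] := fsz_supp n; rewrite (sigmaE _ ul Hn).
elim: l {ul Hn} => [|i l IHl]; first by rewrite big_nil; exists 0; rewrite mul0rn.
by rewrite big_cons; apply: gdvdD => //; apply: gdvd_dvdz.
Qed.

Lemma delta_ex (i : I) : exists n : fsz, forall j, n j = (j == i)%:R.
Proof.
apply: fs_ex; last by exists [:: i] => j; rewrite inE => /negbTE ->.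
apply: (dF_rel (R := fun j (z : int) => (j = i /\ z = 1) \/ (j <> i /\ z = 0))); last by dfn.
move=> j z; case: eqP => E /=; split=> [->|]; [by left|by case=> -[]|by right|by case=> -[]].
Qed.

Lemma sigma_delta tau i (n : fsz) : (forall j, n j = (j == i)%:R) -> sigma tau n = tau i.
Proof.
move=> H; rewrite (sigmaE _ (n := n) (l := [:: i])) //.
  by rewrite big_seq1 H eqxx mulr1z.
by move=> j; rewrite inE H => /negbTE ->.
Qed.

Lemma sigma_def : dF (fun p : ifun I X * fsz => sigma p.1 p.2).
Proof.
apply: (dF_rel (R := fun (p : ifun I X * fsz) y => exists N (s : ifun nat I), enum_supp p.2 N s /\
    y = \sum_(0 <= k < N) p.1 (s k) *~ p.2 (s k))); last by rewrite /enum_supp; dfn.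
move=> [tau n] y /=; split=> [->|[N [s [Hs ->]]]].
  have [l [ul Hl]] := fsz_supp n; have [s [Hs Es]] := enum_suppP i0 ul Hl.
  exists (size l), s; split=> //; rewrite (sigmaE _ ul Hl) (big_nth i0).
  by apply: eq_bigr => k _; rewrite Es.
have [ul Hl] := enum_supp_list Hs; rewrite (sigmaE _ ul Hl) big_map.
by rewrite /index_iota subn0.
Qed.
End Sigma.

(** * Bases modulo m *)

Section Bases.
Context {S : structure} {HS : zfc S} {X : zmodType} {EX : Enc S X} {IX : igrp X}.

Let sX : small X := igrp_small.
Notation fsX := (fsz sX (0 : X)).

Lemma sigma_id_def : dF (fun n : fsX => sigma id n).
Proof.
have [|e He] := @ifun_ex S _ X X _ _ id sX; first by dfn.
have Ee : ifun_val e = id by exact: funext.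
have H := sigma_def sX (0 : X) (X := X).
apply: (@dP_ext _ _ _ _ (fun p : fsX * X => p.2 = sigma e p.1)); first by rewrite Ee.
have H' : dF (fun p : ifun X X * fsX => (fun (t : ifun X X) n => sigma t n) p.1 p.2) by exact: H.
exact: (dF_app2 (h := fun (t : ifun X X) (n : fsX) => sigma t n) H' (dF_const e) (dF_idT)).
Qed.

(* For [m = 0] linear independence over the integers, for [m] prime linear
   independence in [X / mX]. *)
Definition mindep (m : nat) (G : iset X) := forall n : fsX, (forall x, n x <> 0 -> G x) ->
  gdvd m (sigma id n) -> forall x, (m%:Z %| n x)%Z.

Lemma mindep_def m : dP (fun G => mindep m G).
Proof. by have H := sigma_id_def; rewrite /mindep; dfn. Qed.

(** Adjoining to a maximal G a further element x creates a dependence. Its coefficient at x is not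
    divisible by m, for otherwise removing that term would leave a dependence within G. For x in G
    the relation x - x serves, with coefficient 1, nonzero modulo m. *)
Lemma basis_max (m : nat) (W : X -> Prop) (G0 : iset X) : dP W -> (forall x, G0 x -> W x) ->
  mindep m G0 -> m <> 1%N ->
  exists G : iset X, (forall x, G0 x -> G x) /\ (forall x, G x -> W x) /\ mindep m G /\
    forall x, W x -> exists (b : int) (n : fsX), ~ (m%:Z %| b)%Z /\ (forall y, n y <> 0 -> G y) /\
      gdvd m (x *~ b + sigma id n).
Proof.
move=> dW G0W iG0 m1.
have dm := mindep_def m.
have [||G [[iG GW] [G0G maxG]]] := @zorn S _ X _ (fun G => mindep m G /\ forall x, G x -> W x) G0 sX _ (conj iG0 G0W).
- by apply: dP_and => //; dfn.
- move=> K U [A0 KA0] KF Kch uU; split; last by move=> x /uU [A [/KF [_]]]; apply.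
  move=> n Hn; have [l [_ Hl]] := fsz_supp n.
  have [A [KA HA]] : exists A, K A /\ forall x, x \in l -> n x <> 0 -> A x.
    elim: l {Hl} => [|x l [A [KA HA]]]; first by exists A0.
    case: (pselect (n x = 0)) => [x0|/Hn/uU [B [KB Bx]]].
      by exists A; split=> // y; rewrite inE => /orP [/eqP ->|]; [|exact: HA].
    have [AB|BA] := Kch _ _ KA KB.
      by exists B; split=> // y; rewrite inE => /orP [/eqP ->//|yl ny]; apply/AB/HA.
    by exists A; split=> // y; rewrite inE => /orP [/eqP -> _|]; [apply: BA|exact: HA].
  have [iA _] := KF _ KA; apply: iA => x nx; apply: HA => //.
  by apply: contrapT => /negP /Hl.
exists G; split=> //; split=> //; split=> // x Wx.
case: (pselect (G x)) => Gx.
  have [n Hn] := delta_ex sX (0 : X) x.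
  exists 1, (- n); split; first by rewrite dvdzE /= dvdn1 => /eqP.
  split; last by rewrite sigmaN (sigma_delta _ Hn) mulr1z subrr; exists 0; rewrite mul0rn.
  by move=> y; rewrite fgN Hn; case: eqP => [->|].
have [G' HG'] : exists G' : iset X, forall y, G' y <-> G y \/ y = x by apply: iset_ex => //; dfn.
have : ~ mindep m G'.
  move=> iG'; apply: Gx; have <- : G' = G; last by apply/HG'; right.
  by apply: maxG; [split=> // y /HG' [/GW|->]|move=> y Gy; apply/HG'; left].
move/existsNP => [n /not_implyP [Hn /not_implyP [Dn /existsNP [y ny]]]].
have [d Hd] := delta_ex sX (0 : X) x.
pose n' : fsX := n - d *~ n x.
have n'E z : n' z = if z == x then 0 else n z.
  by rewrite fgB fgMz Hd; case: eqP => [->|_]; rewrite ?mul0rz ?subr0 // intz subrr.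
have n'G z : n' z <> 0 -> G z.
  by rewrite n'E; case: eqP => // neq /Hn /HG' [].
exists (n x), n'; split; last first.
  by split=> //; rewrite sigmaB sigmaMz (sigma_delta _ Hd) addrC subrK.
move=> mx; apply: ny.
have Dn' : gdvd m (sigma id n').
  by rewrite sigmaB sigmaMz (sigma_delta _ Hd); apply: gdvdB => //; apply: gdvd_dvdz.
by have := iG n' n'G Dn' y; rewrite n'E; case: eqP => [->|].
Qed.

Section Transport.
Context {I : eqType} {EI : Enc S I} (sI : small I) (i0 : I).
Notation fsI := (fsz sI i0).
Variable tau : ifun I X.
Hypothesis tau_inj : injective tau.

(** [mindep] concerns sets of elements, [mbasis] indexed families; this lemma and [pull_ex] carry
    combinations from one form to the other. *)
Lemma push_ex (n : fsI) : exists n' : fsX, (forall i, n' (tau i) = n i) /\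
  (forall x, n' x <> 0 -> exists i, x = tau i) /\ sigma id n' = sigma tau n.
Proof.
have H x : exists z : int, (exists i, x = tau i /\ z = n i) \/ ((~ exists i, x = tau i) /\ z = 0).
  case: (pselect (exists i, x = tau i)) => [[i Ei]|nE]; last by exists 0; right.
  by exists (n i); left; exists i.
pose f x := sval (cid (H x)).
have fP x : (exists i, x = tau i /\ f x = n i) \/ ((~ exists i, x = tau i) /\ f x = 0).
  exact: (svalP (cid (H x))).
have ft i : f (tau i) = n i.
  by have [[j [/tau_inj -> ->]]//|[[]]] := fP (tau i); exists i.
have f0 x : f x <> 0 -> exists i, x = tau i.
  by move=> fx; have [[i [-> _]]|[_ /fx]] := fP x; first by exists i.
have df : dF f.
  apply: (dF_rel (R := fun x (z : int) => (exists i, x = tau i /\ z = n i) \/ ((~ exists i, x = tau i) /\ z = 0)));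
    last by dfn.
  move=> x z; split=> [->//|]; have := fP x.
  case=> [[i [-> ->]] [[j [/tau_inj -> ->]]//|[[]]]|[nE ->] [[i [Ei _]]|[_ ->]]] //; first by exists i.
  by case: nE; exists i.
have [l [ul Hl]] := fsz_supp n.
have Hl' x : x \notin map tau l -> f x = 0.
  move=> xl; apply: contrapT => fx; have [i Ei] := f0 _ fx; apply: fx.
  rewrite Ei ft; apply: Hl; apply: contra xl => il; rewrite Ei; exact: map_f.
have [|n' Hn'] := @fs_ex _ _ X _ sX (0 : X) int _ igrp_int f df; first by exists (map tau l).
exists n'; split; first by move=> i; rewrite Hn'.
split; first by move=> x; rewrite Hn'; apply: f0.
rewrite (sigmaE _ ul Hl) (sigmaE _ (n := n') (l := map tau l)).
- by rewrite big_map; apply: eq_bigr => i _; rewrite Hn' ft.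
- by rewrite map_inj_uniq.
- by move=> x xl; rewrite Hn' Hl'.
Qed.

Lemma pull_ex (n : fsX) : (forall x, n x <> 0 -> exists i, x = tau i) ->
  exists n' : fsI, (forall i, n' i = n (tau i)) /\ sigma tau n' = sigma id n.
Proof.
move=> Hn; have [l [ul Hl]] := fsz_supp n.
have H x : exists i, (exists j, x = tau j) -> x = tau i.
  by case: (pselect (exists j, x = tau j)) => [[j Ej]|nE]; [exists j|exists i0].
pose g x := sval (cid (H x)).
have gP i : g (tau i) = i by apply/esym/tau_inj/(svalP (cid (H (tau i)))); exists i.
have Hl' i : i \notin undup (map g l) -> n (tau i) = 0.
  rewrite mem_undup => il; apply: Hl; apply: contra il => tl.
  by rewrite -[i]gP; apply: map_f.
have [||n' Hn'] := @fs_ex _ _ I _ sI i0 int _ igrp_int (fun i => n (tau i)).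
- by dfn.
- by exists (undup (map g l)).
exists n'; split=> //.
have [n'' [E1 [E2 E3]]] := push_ex n'.
rewrite -E3; congr sigma; apply: fgP => x.
case: (pselect (exists i, x = tau i)) => [[i ->]|nE]; first by rewrite E1 Hn'.
have -> : n x = 0 by apply: contrapT => /Hn.
by apply: contrapT => /E2.
Qed.

Definition mbasis (m : nat) (W : X -> Prop) :=
  (forall i, W (tau i)) /\ (forall n : fsI, gdvd m (sigma tau n) -> forall i, (m%:Z %| n i)%Z) /\
  forall x, W x -> exists (b : int) (n : fsI), ~ (m%:Z %| b)%Z /\ gdvd m (x *~ b + sigma tau n).

Lemma mbasisI m (W : X -> Prop) (G : iset X) : (forall x, G x <-> exists i, x = tau i) ->
  (forall x, G x -> W x) -> mindep m G ->
  (forall x, W x -> exists (b : int) (n : fsX), ~ (m%:Z %| b)%Z /\ (forall y, n y <> 0 -> G y) /\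
      gdvd m (x *~ b + sigma id n)) -> mbasis m W.
Proof.
move=> HG GW iG sp; split; first by move=> i; apply/GW/HG; exists i.
split=> [n Dn i|x /sp [b [n [nb [Hn D]]]]].
  have [n' [E1 [E2 E3]]] := push_ex n; rewrite -E1; apply: iG; last by rewrite E3.
  by move=> x /E2 H; apply/HG.
have [|n' [_ E]] := @pull_ex n; first by move=> y /Hn /HG.
by exists b, n'; rewrite E.
Qed.
End Transport.

(** A maximal independent set containing the family [beta] is at least as large as J, and at most as
    large because [iota] embeds X into J. Cantor-Bernstein then indexes it by J itself. *)
Lemma mbasis_ex (m : nat) (W : X -> Prop) (J : eqType) (EJ : Enc S J) (sJ : small J) (j0 : J)
  (beta : ifun J X) (iota : ifun X J) : dP W -> m <> 1%N ->
  injective beta -> injective iota -> (forall j, W (beta j)) ->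
  (forall n : fsz sJ j0, gdvd m (sigma beta n) -> forall i, (m%:Z %| n i)%Z) ->
  exists tau : ifun J X, injective tau /\ mbasis sJ j0 tau m W.
Proof.
move=> dW m1 bi ii bW bind.
have [G0 HG0] : exists G0 : iset X, forall x, G0 x <-> exists j, x = beta j.
  by apply: iset_ex => //; dfn.
have iG0 : mindep m G0.
  move=> n Hn D x; have [|n' [E1 E2]] := @pull_ex J _ sJ j0 beta bi n.
    by move=> y /Hn /HG0.
  case: (pselect (n x = 0)) => [->|/Hn /HG0 [j ->]]; first exact: dvdz0.
  by rewrite -E1; apply: bind; rewrite E2.
have [|G [G0G [GW [iG sp]]]] := basis_max dW _ iG0 m1; first by move=> x /HG0 [j ->].
pose Gt := {x : X | G x}.
have Gi : injective (fun x : Gt => sval x) by move=> [x Hx] [y Hy] /= E; subst; congr exist; exact: Prop_irrelevance.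
have Gd : dP (fun v : X => exists x : Gt, v = sval x).
  apply: (@dP_ext _ _ _ _ (fun v => G v)); last by dfn.
  by move=> v; split=> [[[w Hw] -> //]|Hv]; exists (exist _ v Hv).
pose EG := enc_via Gi Gd.
have dv : @dF _ _ Gt X EG EX (fun x : Gt => sval x) by exact: (@dF_via _ _ _ _ _ _ Gi Gd).
have sG : @small S Gt EG by exact: (small_inj dv Gi sX).
have bG j : G (beta j) by apply/G0G/HG0; exists j.
have [|f Hf] := @ifun_ex S _ J Gt _ EG (fun j => exist _ (beta j) (bG j)) sJ.
  apply: (@dF_lift _ _ _ _ _ _ EG _ (fun x : Gt => sval x)); [exact: Gi|exact: dv|].
  rewrite /=; dfn.
have [|g Hg] := @ifun_ex S _ Gt J EG _ (fun x => iota (sval x)) sG; first by dfn.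
have [||h [hi hs]] := @cantor_bernstein S _ J Gt _ EG f g sJ sG.
- by move=> a b; rewrite !Hf => -[] /bi.
- by move=> a b; rewrite !Hg => /ii /Gi.
have [|tau Ht] := @ifun_ex S _ J X _ _ (fun j => sval (h j)) sJ.
  by apply: dF_app1 => //; apply: dF_apT; [exact: dF_const|exact: dF_idT].
have ti : injective tau by move=> a b; rewrite !Ht => /Gi /hi.
exists tau; split=> //; apply: (mbasisI sJ j0 ti (G := G)) => // x; split=> [Gx|[j ->]].
  by have [j Ej] := hs (exist _ x Gx); exists j; rewrite Ht -Ej.
by rewrite Ht; case: (h j).
Qed.
End Bases.

(** * Independent families of size continuum *)

Definition cd (a b : nat) : nat := (2 ^ a * (2 * b + 1))%N.

Lemma cd_inj a b a' b' : cd a b = cd a' b' -> a = a' /\ b = b'.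
Proof.
have L x y : logn 2 (cd x y) = x.
  rewrite /cd lognM ?expn_gt0 // ?addn1 // pfactorK // logn_coprime ?addn0 //.
  by rewrite coprime2n /= oddM.
move=> E; have Ea : a = a' by rewrite -(L a b) E L.
split=> //; move: E; rewrite /cd Ea => /eqP; rewrite eqn_pmul2l ?expn_gt0 // => /eqP.
lia.
Qed.

Section Families.
Context {S : structure} {HS : zf S}.

Lemma dF_cd T {ET : Enc S T} (f g : T -> nat) : dF f -> dF g -> dF (fun t => cd (f t) (g t)).
Proof. by move=> Hf Hg; rewrite /cd; dfn. Qed.

(** The binary code of the part of s below n. *)
Definition val2 (s : iset nat) (n : nat) : nat := (\sum_(i < n) if `[< s i >] then 2 ^ i else 0)%N.

Lemma dF_val2 : dF (fun p : iset nat * nat => val2 p.1 p.2).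
Proof.
apply: (dF_natrec (F := fun (s : iset nat) n x => (x + if `[< s n >] then 2 ^ n else 0)%N)).
- by move=> s n; rewrite /val2 big_ord_recr.
- apply: (@dP_ext _ _ _ _ (fun p => p.2 = 0%N)); last by dfn.
  by move=> p; rewrite /val2 big_ord0.
apply: dF_addn; first by dfn.
apply: (dF_ifT (P := fun p : iset nat * nat * nat => p.1.1 p.1.2)); [|by dfn..].
by move=> p; split=> /asboolP.
Qed.

Lemma val2_lt s n : (val2 s n < 2 ^ n)%N.
Proof.
elim: n => [|n IHn]; first by rewrite /val2 big_ord0.
rewrite /val2 big_ord_recr /= -/(val2 s n) expnS mul2n -addnn.
by case: ifP => _; [rewrite ltn_add2r|rewrite addn0 (leq_trans IHn) // leq_addr].
Qed.

Lemma val2_inj s s' n : val2 s n = val2 s' n -> forall i, (i < n)%N -> s i <-> s' i.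
Proof.
elim: n => [//|n IHn]; rewrite /val2 !big_ord_recr /= -/(val2 s n) -/(val2 s' n) => E i.
have L := val2_lt s n; have L' := val2_lt s' n.
have [Eb Ev] : (s n <-> s' n) /\ val2 s n = val2 s' n.
  move: E; case: asboolP => H; case: asboolP => H' E; split=> //; lia.
by rewrite ltnS leq_eqVlt => /orP [/eqP ->//|]; apply: IHn.
Qed.

Lemma val2_sep (T : eqType) (f : T -> iset nat) (l : seq T) (t : T) : injective f ->
  exists N, forall t', t' \in l -> t' != t -> val2 (f t') N <> val2 (f t) N.
Proof.
move=> fi; suff [N HN] : exists N, forall M, (N <= M)%N -> forall t', t' \in l -> t' != t ->
    val2 (f t') M <> val2 (f t) M by exists N => t'; apply: HN.
elim: l => [|a l [N IHl]]; first by exists 0%N.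
case: (eqVneq a t) => [->|at'].
  exists N => M NM t'; rewrite inE => /orP [/eqP ->|]; first by rewrite eqxx.
  exact: IHl.
have [i Hi] : exists i, ~ (f a i <-> f t i).
  by apply: contrapT => H; move/eqP: at'; apply; apply/fi/isetP => i; apply: contrapT => Hi; apply: H; exists i.
exists (maxn N i.+1) => M; rewrite geq_max => /andP [NM iM] t'; rewrite inE => /orP [/eqP -> _|]; last exact: IHl.
by move/val2_inj => H; apply: Hi; apply: H.
Qed.
End Families.
Ltac dfn_cd := lazymatch goal with
  | |- dF (fun t => cd (@?f t) (@?g t)) => apply (@dF_cd _ _ _ _ f g)
  end.
Ltac dfn_fun ::= first [dfn_fun0 | dfn_add | dfn_natmul | dfn_intmul | dfn_fg | dfn_cd].

HB.instance Definition _ (S : structure) (c : S) := gen_eqMixin (El c).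

Section BaerFamilies.
Context {S : structure} {HS : zfc S}.
Notation Bg := (@Bgrp S HS).

Variable P : zsub Bg.
Context {EX : Enc S (qt P)} {IX : igrp (qt P)}.
Hypothesis dpi : dF (qpi P).
Hypothesis Pfin : forall x : Bg, (exists k, forall n, (k <= n)%N -> x n = 0) -> P x.

(** [P] contains the finitely supported sequences, so the places below k do not affect the class. *)
Lemma Bquot_gdvd M (x : Bg) k : (forall t, (k <= t)%N -> gdvd M (x t)) -> gdvd M (qpi P x).
Proof.
move=> H; have [||z Hz] := @choice_ifun S _ nat int _ _ (fun n z => (k <= n)%N -> x n = z *+ M)
  small_nat small_int.
- by dfn.
- move=> n; case: (leqP k n) => kn; last by exists 0.
  by have [z Ez] := H n kn; exists z.
apply/gdvd_qpi; exists (FG (P := full small_nat igrp_int) (fg_val := z) I).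
by apply: Pfin; exists k => n kn; rewrite fgB fgMn /= -Hz // subrr.
Qed.

Context (c : S) (kap : ifun (El c) (iset nat)).
Hypothesis kapb : ibij kap.

(* At the coordinate coding [(n, u, j, p)] only the members [i] with
   [kap i] restricted to [n] coded by [u] can be nonzero, and there the value is
   chosen to differ from that of the j-th element of [P]. *)
Definition fam (Q : nat -> nat -> nat -> Prop) (w : nat -> int) (i : El c) (t : nat) : int :=
  if `[< exists n j p, t = cd n (cd (val2 (kap i) n) (cd j p)) /\ Q j p t >] then w t else 0.

Section Fam.
Variables (Q : nat -> nat -> nat -> Prop) (w : nat -> int).
Hypotheses (dQ : dP (fun x => Q x.1.1 x.1.2 x.2)) (dw : dF w).

Lemma fam_ex : exists b : ifun (El c) Bg, forall i t, b i t = fam Q w i t.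
Proof.
have dv : dF (fun p => val2 p.1 p.2) by exact: dF_val2.
have df : dF (fun p : El c * nat => fam Q w p.1 p.2).
  apply: (dF_ifT (P := fun p : El c * nat => exists n j q, p.2 = cd n (cd (val2 (kap p.1) n) (cd j q)) /\ Q j q p.2)).
  - by move=> p; split=> /asboolP.
  - by dfn.
  - by dfn.
  - by dfn.
have ex i : exists x : Bg, forall t, x t = fam Q w i t.
  apply: all_fun_ex.
  exact: (dF_app2 (h := fun i t => fam Q w i t) (f := fun _ => i) (g := id) df (dF_const i) (dF_idT)).
pose b0 i := sval (cid (ex i)).
have b0P i t : b0 i t = fam Q w i t by exact: (svalP (cid (ex i)) t).
have db : dF b0.
  apply: dF_fgI; apply: (dF_rel (R := fun (p : El c * nat) (z : int) => z = fam Q w p.1 p.2)); last by exact: df.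
  by move=> p z; rewrite b0P.
by have [b Hb] := ifun_ex (small_El c) db; exists b => i t; rewrite Hb.
Qed.

Variables (i0 : El c) (b : ifun (El c) Bg).
Hypothesis Hb : forall i t, b i t = fam Q w i t.
Notation fsc := (fsz (small_El c) i0).

Lemma fam_eval (n : fsc) (i : El c) (j p : nat) : exists t,
  (sigma b n) t = (if `[< Q j p t >] then w t else 0) * n i.
Proof.
have [l [ul Hl]] := fsz_supp n.
have [N HN] := @val2_sep _ _ (El c) kap l i (proj1 kapb).
exists (cd N (cd (val2 (kap i) N) (cd j p))); set t := cd N _.
pose l' := undup (i :: l).
have Hl' i' : i' \notin l' -> n i' = 0.
  by rewrite mem_undup inE negb_or => /andP [_]; apply: Hl.
rewrite (sigmaE _ (undup_uniq _) Hl') fg_sum -/l'.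
have il : i \in l' by rewrite mem_undup inE eqxx.
have cdE i' : (exists n j0 p0, t = cd n (cd (val2 (kap i') n) (cd j0 p0)) /\ Q j0 p0 t) <->
    val2 (kap i') N = val2 (kap i) N /\ Q j p t.
  split=> [[n' [j' [p' [/cd_inj [E1 /cd_inj [E2 /cd_inj [E3 E4]]] HQ]]]]|[E HQ]].
    by subst n' j' p'.
  by exists N, j, p; rewrite E.
rewrite (bigD1_seq i il (undup_uniq _)) /= big1_seq => [|i' /andP [ni i'l]].
  rewrite addr0 fgMz Hb /fam -mulrzz; congr (_ *~ _).
  by congr (if _ then _ else _); apply: asbool_equiv_eq; rewrite cdE; split=> [[]|].
rewrite fgMz Hb /fam; case: asboolP => [/cdE [E _]|]; last by rewrite mul0rz.
move: i'l; rewrite mem_undup inE (negbTE ni) /= => i'l.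
by case: (HN _ i'l ni).
Qed.
End Fam.

Lemma qpi_sigma (i0 : El c) (b : ifun (El c) Bg) (beta : El c -> qt P) (n : fsz (small_El c) i0) :
  (forall i, beta i = qpi P (b i)) -> sigma beta n = qpi P (sigma b n).
Proof.
move=> H; have [l [ul Hl]] := fsz_supp n; rewrite !(sigmaE _ ul Hl).
elim: l {ul Hl} => [|i l IHl]; first by rewrite !big_nil qpi0.
rewrite !big_cons qpiD IHl H; congr (_ + _).
by case: (n i) => m; rewrite ?NegzE ?mulrNz ?qpiN -?pmulrn qpiMn.
Qed.

Lemma indep_inj (m : nat) (i0 : El c) (beta : ifun (El c) (qt P)) : m <> 1%N ->
  (forall n : fsz (small_El c) i0, gdvd m (sigma beta n) -> forall i, (m%:Z %| n i)%Z) ->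
  injective beta.
Proof.
move=> m1 H i i' E; apply: contrapT => /eqP neq; apply: m1.
have [d Hd] := delta_ex (small_El c) i0 i; have [d' Hd'] := delta_ex (small_El c) i0 i'.
have := H (d - d'); rewrite sigmaB (sigma_delta _ Hd) (sigma_delta _ Hd') E subrr.
move=> /(_ _ i); rewrite fgB Hd Hd' eqxx (negbTE neq) subr0 dvdzE /= dvdn1 => H1.
by apply/eqP/H1; exists 0; rewrite mul0rn.
Qed.

Variable a : ifun nat Bg.
Hypothesis Pa : forall x, P x -> exists j, x = a j.

(** At a place assigned to a_j the value is 1 if p divides a_j there and 0 otherwise. If a
    combination equals a_j + p z, evaluate it as in [fam_eval]: value 0 would make a_j divisible by
    p at that place, so the value is 1 and p divides n_i. *)
Lemma family_mod (p : nat) (i0 : El c) : prime p -> exists beta : ifun (El c) (qt P),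
  forall n : fsz (small_El c) i0, gdvd p (sigma beta n) -> forall i, (p%:Z %| n i)%Z.
Proof.
move=> pp.
have [||b Hb] := fam_ex (Q := fun j q t => (p%:Z %| a j t)%Z) (w := fun=> 1).
- by dfn.
- by dfn.
have [|beta Hbeta] := @ifun_ex S _ (El c) (qt P) _ _ (fun i => qpi P (b i)) (small_El c); first by dfn.
exists beta => n; rewrite (qpi_sigma n Hbeta) => /gdvd_qpi [z /Pa [j Ej]] i.
have [t Et] := fam_eval Hb n i j 0.
have : (sigma b n) t = a j t + z t *+ p by rewrite -Ej fgB fgMn subrK.
rewrite Et; case: asboolP => [D|nD].
  by rewrite mul1r => ->; rewrite rpredD // -mulr_natr natz dvdz_mull.
rewrite mul0r => E0; case: nD.
have -> : a j t = - (z t *+ p) by apply/eqP; rewrite -addr_eq0 -E0.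
by rewrite rpredN -mulr_natr natz dvdz_mull.
Qed.

(** The nonzero values are t!, which M divides for all t >= M, so the classes lie in the divisible
    part. They occur where a_j vanishes: if a combination equals a_j, then at the place of
    [fam_eval] a nonzero a_j would equal 0, and a vanishing one gives t! n_i = 0. *)
Lemma family_div (i0 : El c) : exists beta : ifun (El c) (qt P),
  (forall n : fsz (small_El c) i0, gdvd 0 (sigma beta n) -> forall i, (0%:Z %| n i)%Z) /\
  forall i M, (0 < M)%N -> gdvd M (beta i).
Proof.
have [||b Hb] := fam_ex (Q := fun j q t => a j t = 0) (w := fun t => t`!%:Z).
- by dfn.
- by dfn.
have [|beta Hbeta] := @ifun_ex S _ (El c) (qt P) _ _ (fun i => qpi P (b i)) (small_El c); first by dfn.
exists beta; split=> [n|i M M0].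
  rewrite (qpi_sigma n Hbeta) => /gdvd0/qpi_eq0/Pa [j Ej] i.
  have [t Et] := fam_eval Hb n i j 0; rewrite dvd0z.
  move: Et; rewrite Ej; case: asboolP => [->|nD]; last by rewrite mul0r => /nD.
  move/esym/eqP; rewrite mulf_eq0 => /orP [|//].
  by rewrite eqz_nat eqn0Ngt fact_gt0.
rewrite Hbeta; apply: (Bquot_gdvd (k := M)) => t Mt; rewrite Hb /fam.
case: asboolP => _; last by exists 0; rewrite mul0rn.
have /dvdnP [k ->] : (M %| t`!)%N by apply: dvdn_fact; rewrite M0.
by exists k%:Z; rewrite PoszM -mulr_natr natz.
Qed.

(** A class is sent to the set of codes of the pairs (t, x_t) for a chosen representative x; this is
    a subset of omega, which [kap] identifies with an element of c. *)
Lemma Bquot_embed : exists iota : ifun (qt P) (El c), injective iota.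
Proof.
have sB : small Bg by exact: igrp_small.
have sX : small (qt P) by exact: igrp_small.
have [||r Hr] := @choice_ifun S _ (qt P) Bg _ _ (fun q x => qpi P x = q) sX sB.
- by dfn.
- by move=> q; have [x ->] := qpi_surj q; exists x.
have [k [_ kh]] := ibij_inv (small_iset small_nat) kapb.
have dip : dF int_pair by exact: dF_via.
have H (x : Bg) : exists A : iset nat, forall u, A u <-> exists t, u = cd t (cd (int_pair (x t)).1 (int_pair (x t)).2).
  by apply: iset_ex; [exact: small_nat|dfn].
pose g (x : Bg) := sval (cid (H x)).
have gP x u : g x u <-> exists t, u = cd t (cd (int_pair (x t)).1 (int_pair (x t)).2).
  exact: (svalP (cid (H x)) u).
have dg : dF g.
  apply: dF_iset; apply: (@dP_ext _ _ _ _ (fun p : Bg * nat =>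
    exists t, p.2 = cd t (cd (int_pair (p.1 t)).1 (int_pair (p.1 t)).2))); last by dfn.
  by move=> p; apply: gP.
have gi : injective g.
  move=> x y E; apply: fgP => t.
  have : g x (cd t (cd (int_pair (x t)).1 (int_pair (x t)).2)) by apply/gP; exists t.
  rewrite E => /gP [t' /cd_inj [<- /cd_inj [E1 E2]]].
  by apply: int_pair_inj; move: E1 E2; case: (int_pair _) => u v; case: (int_pair _) => u' v' /= -> ->.
have [|iota Hi] := @ifun_ex S _ (qt P) (El c) _ _ (fun q => k (g (r q))) sX; first by dfn.
exists iota => q q'; rewrite !Hi => E; rewrite -(Hr q) -(Hr q'); congr qpi; apply: gi.
have k_inj : injective k.
  move=> A A' EA; have [_ ks] := kapb.
  have [i Ei] := ks A; have [i' Ei'] := ks A'.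
  by move: EA; rewrite Ei Ei' !kh => ->.
exact: k_inj E.
Qed.
End BaerFamilies.

(** * Products, sums and completions as groups of internal functions *)

Section Families.
Context {S : structure} {HS : zf S}.

Lemma graph_of_enc (I T : Type) {EI : Enc S I} {ET : Enc S T} (f : ifun I S) (h : ifun I T) :
  (forall i, f i = enc (h i)) -> graph f = graph h.
Proof. by move=> E; apply: set_ext => w; rewrite !graphP; split=> -[i ->]; exists i; rewrite /enc /= E. Qed.

Lemma lift_enc (I T : Type) {EI : Enc S I} {ET : Enc S T} (f : ifun I S) : small I ->
  (forall i, exists t : T, f i = enc t) -> exists h : ifun I T, forall i, f i = enc (h i).
Proof.
move=> sI H; pose g i := sval (cid (H i)).
have gP i : f i = enc (g i) by exact: (svalP (cid (H i))).
have dg : dF g.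
  apply: (dF_rel (R := fun i v => f i = enc v)); last by dfn.
  by move=> i v; rewrite gP; split=> [->//|?]; einj.
by have [h Hh] := ifun_ex sI dg; exists h => i; rewrite Hh gP.
Qed.

Lemma unlift_enc (I T : Type) {EI : Enc S I} {ET : Enc S T} (h : ifun I T) : small I ->
  exists f : ifun I S, (forall i, f i = enc (h i)) /\ graph h = graph f.
Proof.
move=> sI; have [|f Hf] := @ifun_ex S _ I S _ _ (fun i => enc (h i)) sI; first by dfn.
by exists f; split=> //; rewrite (graph_of_enc Hf).
Qed.

Section Graphs.
Context {I : Type} {EI : Enc S I} (rep : S -> I -> Prop).
Hypothesis repE : forall u i, rep u i <-> u = enc i.

Lemma is_graphP (v : S) (x : I -> S) :
  is_graph rep v x <-> exists f : ifun I S, v = graph f /\ forall i, f i = x i.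
Proof.
have E (g : I -> S) w : (exists i u, rep u i /\ is_pair w u (g i)) <-> exists i, w = enc (i, g i).
  split=> [[i [u [/repE -> /opairP ->]]]|[i ->]]; first by exists i.
  by exists i, (enc i); split; [exact/repE|apply/opairP].
split=> [H|[f [-> Hf]] w]; last first.
  by rewrite graphP E; split=> -[i ->]; exists i; rewrite Hf.
have Hs : is_set (fun w : S => exists i, w = enc (i, x i)).
  by exists v => w; rewrite -E; apply: H.
exists (IFun Hs); split=> //; apply: set_ext => w; rewrite graphP /= -E; exact: H.
Qed.

Lemma gprod_car (F : I -> grp S) v : car (gprod rep F) v <->
  exists f : ifun I S, v = graph f /\ forall i, car (F i) (f i).
Proof.
split=> [[x [/is_graphP [f [-> Hf]] H]]|[f [-> H]]].
  by exists f; split=> // i; rewrite Hf.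
by exists f; split=> //; apply/is_graphP; exists f.
Qed.

Lemma gprod_add (F : I -> grp S) u v w : Defs.add (gprod rep F) u v w <->
  exists f g h : ifun I S, u = graph f /\ v = graph g /\ w = graph h /\
    forall i, Defs.add (F i) (f i) (g i) (h i).
Proof.
split=> [[x [y [z [/is_graphP [f [-> Hf]] [/is_graphP [g [-> Hg]] [/is_graphP [h [-> Hh]] H]]]]]]|].
  by exists f, g, h; do 3 split=> //; move=> i; rewrite Hf Hg Hh.
move=> [f [g [h [-> [-> [-> H]]]]]]; exists f, g, h.
by do 3 (split; first by apply/is_graphP; eexists).
Qed.

Lemma gsum_car (F : I -> grp S) v : car (gsum rep F) v <->
  exists f : ifun I S, v = graph f /\ (forall i, car (F i) (f i)) /\
    exists l : list I, forall i, ~ List.In i l -> is_zero (F i) (f i).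
Proof.
split=> [[/gprod_car [f [-> Hf]] [x [l [/is_graphP [g [/graph_inj <- Hg]] H]]]]|[f [-> [Hf [l Hl]]]]].
  by exists f; split=> //; split=> //; exists l => i il; rewrite Hg; apply: H.
split; first by apply/gprod_car; exists f.
by exists f, l; split=> //; apply/is_graphP; exists f.
Qed.

Lemma gsum_add (F : I -> grp S) u v w : Defs.add (gsum rep F) u v w <->
  exists f g h : ifun I S, u = graph f /\ v = graph g /\ w = graph h /\
    (forall i, Defs.add (F i) (f i) (g i) (h i)) /\
    (exists l : list I, forall i, ~ List.In i l -> is_zero (F i) (f i)) /\
    (exists l : list I, forall i, ~ List.In i l -> is_zero (F i) (g i)) /\
    exists l : list I, forall i, ~ List.In i l -> is_zero (F i) (h i).
Proof.
pose Q (v : S) := exists (x : I -> S) (l : list I),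
  is_graph rep v x /\ forall i : I, ~ List.In i l -> is_zero (F i) (x i).
have E (f : ifun I S) : Q (graph f) <-> exists l : list I, forall i, ~ List.In i l -> is_zero (F i) (f i).
  split=> [[x [l [/is_graphP [g [/graph_inj <- Hg]] H]]]|[l Hl]].
    by exists l => i il; rewrite Hg; apply: H.
  by exists f, l; split=> //; apply/is_graphP; exists f.
rewrite /gsum /=; split.
  move=> [/gprod_add [f [g [h [-> [-> [-> H]]]]]] [/E Hf [/E Hg /E Hh]]].
  by exists f, g, h.
move=> [f [g [h [-> [-> [-> [H [/E Hf [/E Hg /E Hh]]]]]]]]].
by split=> //; apply/gprod_add; exists f, g, h.
Qed.

(** Summands with invariant 0 remain present as one-element groups. The code of that element has to
    be known, since it occurs in the codes of the elements of the whole group. *)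
Lemma gsum_trivial (F : I -> grp S) (o : S) (f : ifun I S) : (forall i, f i = o) ->
  (forall i v, car (F i) v <-> v = o) -> (forall i u v w, Defs.add (F i) u v w <-> u = o /\ v = o /\ w = o) ->
  (forall v, car (gsum rep F) v <-> v = graph f) /\
  forall u v w, Defs.add (gsum rep F) u v w <-> u = graph f /\ v = graph f /\ w = graph f.
Proof.
move=> Hf Hc Ha.
have fz : exists l : list I, forall i, ~ List.In i l -> is_zero (F i) (f i).
  exists nil => i _; split=> [|a /Hc ->]; first exact/Hc.
  by rewrite Hf; apply/Ha.
split=> [v|u v w].
  split=> [/gsum_car [g [-> [Hg _]]]|->].
    by congr graph; apply: ifunP => i; rewrite Hf; apply/Hc/Hg.
  by apply/gsum_car; exists f; split=> //; split=> // i; apply/Hc.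
split=> [/gsum_add [g [h [k [-> [-> [-> [H _]]]]]]]|[-> [-> ->]]].
  have H' i : g i = f i /\ h i = f i /\ k i = f i.
    by have /Ha [-> [-> ->]] := H i; rewrite Hf.
  by split; [|split]; congr graph; apply: ifunP => i; have [? [? ?]] := H' i.
by apply/gsum_add; exists f, f, f; do 3 (split=> //); split=> // i; apply/Ha; rewrite Hf.
Qed.
End Graphs.

Lemma El_rep (c u : S) (i : El c) : u = sval i <-> u = enc i.
Proof. by []. Qed.

(** The only element is the empty function, whose graph is the empty set [o]. *)
Lemma copies_empty (G : grp S) (o : S) : is_empty o -> 
  (forall v, car (copies G o) v <-> v = o) /\
  forall u v w, Defs.add (copies G o) u v w <-> u = o /\ v = o /\ w = o.
Proof.
move=> Ho.
have [f Hf] : exists f : ifun (El o) S, forall i, f i = o.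
  by apply: ifun_ex; [exact: small_El|dfn].
have fo : graph f = o.
  apply: empty_uniq => // z /graphP [[i Hi] _]; exact: (Ho _ Hi).
rewrite -{2 4 5 6}fo; apply: (@gsum_trivial _ _ (fun u i => u = sval i) (@El_rep o) (fun=> G) o f Hf).
  by move=> [i Hi]; case: (Ho _ Hi).
by move=> [i Hi]; case: (Ho _ Hi).
Qed.

Section Copies.
Context {V : zmodType} {EV : Enc S V} {IV : igrp V} (c : S) (i0 : El c).
Notation fsV := (fun_grp (fs_sub (small_El c) i0 IV)).

Lemma In_mem (T : eqType) (x : T) (l : seq T) : List.In x l <-> x \in l.
Proof.
elim: l => [|a l IHl] //=; rewrite inE IHl; split.
  by case=> [->|->]; rewrite ?eqxx ?orbT.
by case/orP => [/eqP ->|]; [left|right].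
Qed.

Lemma fs_zero (f : El c -> V) (g : El c -> S) : (forall i, g i = enc (f i)) ->
  (exists l : list (El c), forall i, ~ List.In i l -> is_zero (cgrp V) (g i)) <-> finsupp f.
Proof.
move=> E; split=> -[l Hl]; exists l => i il.
  have /cgrp_zero : is_zero (cgrp V) (g i) by apply: Hl => /In_mem; rewrite (negbTE il).
  by rewrite E => ?; einj.
by apply/cgrp_zero; rewrite E Hl //; apply/negP => /In_mem.
Qed.

Lemma fs_of (f : ifun (El c) S) : (forall i, car (cgrp V) (f i)) ->
  (exists l : list (El c), forall i, ~ List.In i l -> is_zero (cgrp V) (f i)) ->
  exists h : fsV, (forall i, f i = enc (h i)) /\ graph f = enc h.
Proof.
move=> Hf fz; have [g E] := lift_enc (small_El c) Hf.
have fg : finsupp g by apply/(fs_zero E).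
exists (FG (P := fs_sub (small_El c) i0 IV) (fg_val := g) fg); split=> //.
exact: graph_of_enc.
Qed.

Lemma copies_cgrp : copies (cgrp V) c = cgrp fsV.
Proof.
have out (h : fsV) : exists f : ifun (El c) S, (forall i, f i = enc (h i)) /\ enc h = graph f.
  exact: (unlift_enc (fg_val h) (small_El c)).
apply: grp_ext => [v|u v w].
  rewrite /copies (gsum_car (@El_rep c)); split=> [[f [-> [Hf fz]]]|[h ->]].
    by have [h [_ ->]] := fs_of Hf fz; exists h.
  have [f [Hf ->]] := out h; exists f; split=> //; split; first by move=> i; exists (h i).
  by apply/(fs_zero Hf)/(fg_prop h).
rewrite /copies (gsum_add (@El_rep c)); split.
  move=> [f [g [h [-> [-> [-> [H [zf [zg zh]]]]]]]]].
  have [||f' [Ef ->]] := @fs_of f; [by move=> i; have [x [y [-> _]]] := H i; exists x|by []|].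
  have [||g' [Eg ->]] := @fs_of g; [by move=> i; have [x [y [_ [-> _]]]] := H i; exists y|by []|].
  have [||h' [Eh ->]] := @fs_of h; [by move=> i; have [x [y [_ [_ ->]]]] := H i; exists (x + y)|by []|].
  apply/cgrp_add/fgP => i; rewrite fgD; apply/cgrp_add.
  by have := H i; rewrite Ef Eg Eh.
move=> [f' [g' [-> [-> ->]]]].
have [f [Ef ->]] := out f'; have [g [Eg ->]] := out g'; have [h [Eh ->]] := out (f' + g').
exists f, g, h; do 3 (split=> //); split.
  by move=> i; rewrite Ef Eg Eh; apply/cgrp_add; rewrite fgD.
split; first exact/(fs_zero Ef)/(fg_prop f').
by split; [exact/(fs_zero Eg)/(fg_prop g')|exact/(fs_zero Eh)/(fg_prop (f' + g'))].
Qed.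
End Copies.

(** ** Completions *)

Section Completion.
Context {V : zmodType} {EV : Enc S V} {IV : igrp V}.

Lemma cst_ex (m : nat) (g : V) : exists A : iset V, forall y, A y <-> gdvd m (y - g).
Proof. by apply: iset_ex; [exact: igrp_small|dfn]. Qed.

Definition cst m g : iset V := sval (cid (cst_ex m g)).

Lemma cstP m g y : cst m g y <-> gdvd m (y - g).
Proof. exact: (svalP (cid (cst_ex m g)) y). Qed.

Lemma cst_eq m g h : cst m g h -> cst m g = cst m h.
Proof.
move/cstP => D; apply: isetP => y; rewrite !cstP.
have E : y - g = (y - h) + (h - g) by rewrite addrA subrK.
split=> D'; last by rewrite E; apply: gdvdD.
have -> : y - h = (y - g) - (h - g) by rewrite E addrK.
exact: gdvdB D' D.
Qed.

Lemma is_coset_cst m (s : S) (g : V) :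
  is_coset (cgrp V) (multiples (cgrp V) m) s (enc g) <-> s = enc (cst m g).
Proof.
have E u : (exists h, multiples (cgrp V) m h /\ Defs.add (cgrp V) (enc g) h u) <-> u ∈ (enc (cst m g) : S).
  split=> [[h [[y [[z ->] Hz]] [a [b [Ea [Eb ->]]]]]]|/extP [y [-> /cstP [z Ez]]]].
    apply/extP; exists (a + b); split=> //; apply/cstP.
    have {}Ea : a = g by einj.
    move: Hz; rewrite Eb => /cgrp_nmul ->; exists z; by rewrite Ea addrC addKr.
  exists (enc (z *+ m)); split.
    by exists (enc z); split; [exists z|apply/cgrp_nmul].
  by apply/cgrp_add; rewrite -Ez addrC subrK.
split=> [H|-> u]; last by rewrite E.
by apply: set_ext => u; rewrite -E; apply: H.
Qed.

Lemma num_rep (u : S) (n : nat) : is_num u n <-> u = enc n.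
Proof. exact: enc_numP. Qed.

Lemma pc_coh (f : ifun nat S) :
  (exists x : nat -> S, is_graph (@is_num S) (graph f) x /\ forall k, Defs.subset (x k.+1) (x k)) <->
  forall k, Defs.subset (f k.+1) (f k).
Proof.
split=> [[x [/(is_graphP num_rep) [g [/graph_inj <- Hg]] H]] k|H]; first by rewrite !Hg.
by exists f; split=> //; apply/(is_graphP num_rep); exists f.
Qed.

Lemma pc_car p v : car (padic_completion p (cgrp V)) v <->
  exists f : ifun nat S, v = graph f /\ (forall k, exists g : V, f k = enc (cst (p ^ k) g)) /\
    forall k, Defs.subset (f k.+1) (f k).
Proof.
split=> [[/(gprod_car num_rep) [f [-> Hf]] /pc_coh H]|[f [-> [Hf H]]]].
  exists f; split=> //; split=> // k; have [_ [[g ->] /is_coset_cst ->]] := Hf k; by exists g.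
split; last by apply/pc_coh.
apply/(gprod_car num_rep); exists f; split=> // k; have [g ->] := Hf k.
by exists (enc g); split; [exists g|apply/is_coset_cst].
Qed.

Lemma pc_add p u v w : Defs.add (padic_completion p (cgrp V)) u v w <->
  exists f g h : ifun nat S, u = graph f /\ v = graph g /\ w = graph h /\
    (forall k, exists a b : V, f k = enc (cst (p ^ k) a) /\ g k = enc (cst (p ^ k) b) /\
       h k = enc (cst (p ^ k) (a + b))) /\
    (forall k, Defs.subset (f k.+1) (f k)) /\ (forall k, Defs.subset (g k.+1) (g k)) /\
    forall k, Defs.subset (h k.+1) (h k).
Proof.
split.
  move=> [/(gprod_add num_rep) [f [g [h [-> [-> [-> H]]]]]] [/pc_coh Hf [/pc_coh Hg /pc_coh Hh]]].
  exists f, g, h; do 3 (split=> //); split=> // k.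
  have [_ [_ [_ [[a [b [-> [-> ->]]]] [/is_coset_cst -> [/is_coset_cst -> /is_coset_cst ->]]]]]] := H k.
  by exists a, b.
move=> [f [g [h [-> [-> [-> [H [Hf [Hg Hh]]]]]]]]]; split; last by do 2 (split; first by apply/pc_coh); apply/pc_coh.
apply/(gprod_add num_rep); exists f, g, h; do 3 (split=> //); move=> k.
have [a [b [-> [-> ->]]]] := H k.
exists (enc a), (enc b), (enc (a + b)); split; first by apply/cgrp_add.
by do 2 (split; first by apply/is_coset_cst); apply/is_coset_cst.
Qed.
End Completion.
End Families.

(** * Simultaneous congruences *)

(** The integers m such that M divides m x form an ideal. By hypothesis its generator divides M /
    p^(v_p(M)) for every prime p, so it has no prime factor and equals 1. *)
Lemma gdvd_primes (X : zmodType) (M : nat) (x : X) : (0 < M)%N ->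
  (forall p k, prime p -> (p ^ k %| M)%N -> gdvd (p ^ k) x) -> gdvd M x.
Proof.
move=> M0 H; pose I (m : int) := gdvd M (x *~ m).
have [] := @int_ideal I.
- by move=> m n Hm Hn; rewrite /I mulrzBr; apply: gdvdB.
- by exists M%:Z; split; [by case: (M) M0|rewrite /I -pmulrn; apply: gdvdxx].
move=> d [d0 [Id Hd]].
have L p : prime p -> (d %| M %/ p ^ logn p M)%N.
  move=> pp; have pM : (p ^ logn p M %| M)%N by rewrite pfactor_dvdnn.
  suff HI : I (M %/ p ^ logn p M)%N%:Z.
    exact: Hd _ HI.
  rewrite /I -pmulrn -{1}(divnK pM) mulnC; apply: gdvdMn; exact: H pp pM.
case: (leqP d 1) => d1.
  have E : d = 1%N by lia.
  by move: Id; rewrite /I E mulr1z.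
have pq := pdiv_prime d1; have := L _ pq; set q := pdiv d in pq * => dM.
have qM : (q %| M %/ q ^ logn q M)%N by apply: dvdn_trans dM; apply: pdiv_dvd.
have : (q ^ (logn q M).+1 %| M)%N.
  have E : M = ((M %/ q ^ logn q M) * q ^ logn q M)%N by rewrite divnK // pfactor_dvdnn.
  by rewrite {2}E expnS dvdn_pmul2r // expn_gt0 prime_gt0.
by rewrite pfactor_dvdn // ltnn.
Qed.

Section Chinese.
Context {S : structure} {HS : zfc S} {X : zmodType} {EX : Enc S X} {IX : igrp X}.
Variable y : ifun (nat * nat) X.
Hypothesis ycoh : forall p k, prime p -> gdvd (p ^ k) (y (p, k.+1) - y (p, k)).

Lemma ycoh_le p k m : prime p -> (k <= m)%N -> gdvd (p ^ k) (y (p, m) - y (p, k)).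
Proof.
move=> pp /subnKC <-; elim: (m - k)%N => [|j IHj]; first by rewrite addn0 subrr; exists 0; rewrite mul0rn.
have -> : y (p, k + j.+1)%N - y (p, k) = (y (p, (k + j).+1)%N - y (p, k + j)%N) + (y (p, k + j)%N - y (p, k)).
  by rewrite addrA subrK addnS.
apply: gdvdD => //; apply: (gdvd_dvdn _ (ycoh _ pp)); exact: dvdn_exp2l (leq_addr _ _).
Qed.

Lemma chinese_ex M : (0 < M)%N -> exists c, forall p k, prime p -> (p ^ k %| M)%N -> gdvd (p ^ k) (c - y (p, k)).
Proof.
move=> M0; pose v p := logn p M.
(* Idempotents modulo M: e_p is 1 modulo the p-part of M and 0 modulo the cofactor. *)
pose e p := chinese (p ^ v p) (M %/ p ^ v p) 1 0.
have co p : prime p -> coprime (p ^ v p) (M %/ p ^ v p).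
  move=> pp; have [m pm Em] := pfactor_coprime pp M0.
  have -> : (M %/ p ^ v p)%N = m by rewrite {1}Em mulnK ?expn_gt0 ?prime_gt0.
  exact: coprimeXl.
have e1 p : prime p -> e p = 1 %[mod p ^ v p] by move=> pp; apply: chinese_modl; apply: co.
have e0 p q : prime p -> prime q -> p != q -> (p ^ v p %| e q)%N.
  move=> pp pq npq; have : e q = 0 %[mod M %/ q ^ v q] by apply: chinese_modr; apply: co.
  rewrite mod0n => /eqP; rewrite -/(dvdn _ _); apply: dvdn_trans.
  have E : M = ((M %/ q ^ v q) * q ^ v q)%N by rewrite divnK // pfactor_dvdnn.
  have : (p ^ v p %| M)%N by rewrite pfactor_dvdnn.
  by rewrite {1}E Gauss_dvdl // coprimeXl // coprimeXr // prime_coprime // dvdn_prime2.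
exists (\sum_(q <- primes M) y (q, v q) *+ e q) => p k pp pk.
have kv : (k <= v p)%N by rewrite -pfactor_dvdn.
have pkv : (p ^ k %| p ^ v p)%N by apply: dvdn_exp2l.
case: k => [|k] in pk kv pkv *; first by rewrite expn0; exists (\sum_(q <- primes M) y (q, v q) *+ e q - y (p, 0%N)).
have pin : p \in primes M by rewrite mem_primes pp M0 (dvdn_trans _ pk) // expnS dvdn_mulr.
rewrite (bigD1_seq p pin (primes_uniq _)) /= addrAC; apply: gdvdD; last first.
  rewrite big_seq_cond; elim/big_ind: _ => [|a b|q]; first by exists 0; rewrite mul0rn.
    exact: gdvdD.
  rewrite mem_primes => /andP [/and3P [pq _ _] qp].
  by rewrite pmulrn; apply: gdvd_dvdz; rewrite dvdzE /=; apply: dvdn_trans pkv _; apply: e0 => //; rewrite eq_sym.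
have -> : y (p, v p) *+ e p - y (p, k.+1) = y (p, v p) *~ ((e p)%:Z - 1) + (y (p, v p) - y (p, k.+1)).
  by rewrite mulrzBr mulr1z -pmulrn addrA subrK.
apply: gdvdD; last exact: ycoh_le.
apply: (gdvd_dvdn pkv); apply: gdvd_dvdz.
by rewrite -eqz_mod_dvd !modz_nat (e1 p pp).
Qed.

(** The moduli (k!)^k form a divisibility chain in which each p^k divides some member. Solutions of
    the finitely many congruences below each member are coherent, and compactness provides a common
    one. *)
Lemma chinese_scompact : scompact X -> exists x, forall p k, prime p -> gdvd (p ^ k) (x - y (p, k)).
Proof.
move=> cX; pose L k := (k`! ^ k)%N.
have L0 k : (0 < L k)%N by rewrite expn_gt0 fact_gt0.
have LS k : (L k %| L k.+1)%N.
  apply: dvdn_trans (dvdn_exp2l _ (leqnSn k)); apply: dvdn_exp2r.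
  by rewrite factS dvdn_mull.
have pL p k N : prime p -> (p <= N)%N -> (k <= N)%N -> (p ^ k %| L N)%N.
  move=> pp pN kN; apply: dvdn_trans (dvdn_exp2l _ kN); apply: dvdn_exp2r.
  by apply: dvdn_fact; rewrite prime_gt0.
have sX : small X by exact: igrp_small.
have [||c Hc] := @choice_ifun S _ nat X _ _
    (fun N c => forall p k, prime p -> (p ^ k %| L N)%N -> gdvd (p ^ k) (c - y (p, k))) small_nat sX.
- by rewrite /L; dfn.
- by move=> N; apply: chinese_ex.
have [lf Hlf] : exists lf : ifun nat nat, forall k, lf k = L k.
  by apply: ifun_ex; [exact: small_nat|rewrite /L; dfn].
have [|||x Hx] := cX lf c.
- by move=> k; rewrite Hlf.
- by move=> k; rewrite !Hlf.
- move=> N; rewrite Hlf; apply: gdvd_primes => // p k pp pk.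
  have -> : c N.+1 - c N = (c N.+1 - y (p, k)) - (c N - y (p, k)) by rewrite opprB addrA subrK.
  by apply: gdvdB; apply: Hc => //; apply: dvdn_trans (LS _).
exists x => p k pp; pose N := maxn p k.
have pk : (p ^ k %| L N)%N by apply: pL; rewrite // ?leq_maxl ?leq_maxr.
have -> : x - y (p, k) = (x - c N) + (c N - y (p, k)) by rewrite addrA subrK.
by apply: gdvdD; [apply: (gdvd_dvdn pk); rewrite -(Hlf N)|apply: Hc].
Qed.
End Chinese.

(** * The divisible part *)

Section DivisiblePart.
Context {S : structure} {HS : zfc S} {X : zmodType} {EX : Enc S X} {IX : igrp X}.
Hypothesis tX : tfree X.

Definition dpart (x : X) := forall M, (0 < M)%N -> gdvd M x.

Lemma dpart0 : dpart 0.
Proof. by move=> M _; exists 0; rewrite mul0rn. Qed.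

Lemma dpartB x y : dpart x -> dpart y -> dpart (x - y).
Proof. by move=> Hx Hy M M0; apply: gdvdB; [apply: Hx|apply: Hy]. Qed.

Definition dpart_sub := ZSub dpart0 dpartB.

Lemma dpart_def : dP (fun x => dpart_sub x).
Proof. by rewrite /= /dpart; dfn. Qed.

Lemma dpart_div n x : (0 < n)%N -> dpart x -> exists y, dpart y /\ x = y *+ n.
Proof.
move=> n0 Hx; have [y Ey] := Hx n n0; exists y; split=> // M M0.
by apply: (tfree_gdvd tX n0); rewrite -Ey; apply: Hx; rewrite muln_gt0 M0.
Qed.

#[local] Instance Enc_dpart : Enc S (sgt dpart_sub) := Enc_sgt dpart_def.
#[local] Instance igrp_dpart : igrp (sgt dpart_sub) := igrp_sgt dpart_def.

Lemma dpart_val (d : sgt dpart_sub) : dpart (sg_val d).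
Proof. exact/asboolP/(sg_valP d). Qed.

(** In a torsion-free group the divisible part is itself a divisible group, so its identity map
    extends to X. *)
Lemma dpart_retract : exists r : ifun X X, ihom r /\ (forall x, dpart (r x)) /\ forall x, dpart x -> r x = x.
Proof.
have dv : dF (fun d : sgt dpart_sub => sg_val d) by exact: dF_sg_val.
have sX : small X by exact: igrp_small.
have sD : small (sgt dpart_sub) by exact: igrp_small.
have D y : dpart y -> exists d : sgt dpart_sub, sg_val d = y.
  move=> Hy; have Hy' : y \in sg_mem dpart_sub by apply/asboolP; exact: Hy.
  by exists (SGT Hy').
have dD : divisible (sgt dpart_sub).
  move=> n x n0; have [y [Hy Ey]] := dpart_div n0 (dpart_val x).
  have [d Ed] := D y Hy; exists d; apply: sg_val_inj.
  by rewrite Ey -Ed; elim: (n) => [|m IHm] //; rewrite !mulrS sg_valD IHm.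
have [R0 HR0] := @iset_ex S _ _ _ (fun p : X * sgt dpart_sub => p.1 = sg_val p.2) (small_prod sX sD) ltac:(dfn).
have [||f [hf Hf]] := @extend S _ X (sgt dpart_sub) _ _ _ _ R0.
- move=> R h g; exact: step_divisible.
- split; first by apply/HR0.
  split=> [p q /HR0 Ep /HR0 Eq|h y n /HR0 /= Eh].
    by apply/HR0; rewrite /= Ep Eq.
  case: n => [|n _]; last exact: dD.
  move=> /gdvd0 h0; apply/gdvd0; apply: sg_val_inj; by rewrite -Eh.
have [|r Hr] := @ifun_ex S _ X X _ _ (fun x => sg_val (f x)) sX; first by dfn.
exists r; split; first by move=> x y; rewrite !Hr hf.
split=> [x|x Hx]; rewrite Hr; first exact: dpart_val.
have [d Ed] := D x Hx; rewrite (Hf x d) //; by apply/HR0.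
Qed.
End DivisiblePart.

(** * Coordinates *)

Section FsDiv.
Context {S : structure} {HS : zf S} {I : eqType} {EI : Enc S I} (sI : small I) (i0 : I).
Context {V : zmodType} {EV : Enc S V} (IV : igrp V).
Notation fsV := (fun_grp (fs_sub sI i0 IV)).

Lemma fs_choose (R : I -> V -> Prop) : dP (fun p => R p.1 p.2) ->
  (forall i, exists v, R i v) -> (forall i v v', R i v -> R i v' -> v = v') ->
  (exists l : seq I, forall i, i \notin l -> R i 0) -> exists x : fsV, forall i, R i (x i).
Proof.
move=> dR eR uR [l Hl]; pose f i := sval (cid (eR i)).
have fP i : R i (f i) by exact: (svalP (cid (eR i))).
have df : dF f.
  by apply: (dF_rel (R := R)) dR => i v; split=> [->//|Hv]; apply: uR Hv (fP i).
have [|x Hx] := fs_ex sI i0 IV df; last by exists x => i; rewrite Hx.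
by exists l => i /Hl H0; apply: uR (fP i) H0.
Qed.

Lemma fs_gdvd (u : fsV) d : tfree V -> (0 < d)%N -> (forall i, gdvd d (u i)) -> gdvd d u.
Proof.
move=> tV d0 H; have [||||x Hx] := @fs_choose (fun i v => u i = v *+ d).
- by dfn.
- by [].
- by move=> i v v' -> /(tfree_mulIn tV d0).
- by have [l Hl] := fg_prop u; exists l => i /Hl ->; rewrite mul0rn.
by exists x; apply: fgP => i; rewrite fgMn Hx.
Qed.
End FsDiv.

Lemma tfree_int : tfree int.
Proof.
move=> n z n0 /eqP; rewrite -mulr_natr mulf_eq0 natz => /orP [/eqP //|].
by rewrite eqz_nat => /eqP E; rewrite E in n0.
Qed.

Section ModP.
Context {S : structure} {HS : zfc S} {X : zmodType} {EX : Enc S X} {IX : igrp X}.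
Context {J : eqType} {EJ : Enc S J} (sJ : small J) (j0 : J).
Hypothesis tX : tfree X.
Notation fsJ := (fsz sJ j0).
Variables (tau : ifun J X) (p : nat).
Hypotheses (pp : prime p)
  (bi : forall n : fsJ, gdvd p (sigma tau n) -> forall i, (p%:Z %| n i)%Z)
  (bs : forall x, exists (b : int) (n : fsJ), ~ (p%:Z %| b)%Z /\ gdvd p (x *~ b + sigma tau n)).

Lemma sigmaMn (n : fsJ) m : sigma tau (n *+ m) = sigma tau n *+ m.
Proof. by rewrite [n *+ m]pmulrn sigmaMz -pmulrn. Qed.

(** Independence modulo p makes all coefficients divisible by p; dividing the combination by p,
    which torsion-freeness allows, lowers k by one. *)
Lemma basis_indep k (n : fsJ) : gdvd (p ^ k) (sigma tau n) -> forall i, gdvd (p ^ k) (n i).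
Proof.
elim: k n => [|k IHk] n; first by move=> _ i; exists (n i).
move=> H; have [n' En] : gdvd p n.
  apply: fs_gdvd; [exact: tfree_int|exact: prime_gt0|move=> i].
  by apply/gdvd_int/bi/(gdvd_dvdn _ H); rewrite expnS dvdn_mulr.
move: H; rewrite En sigmaMn expnS mulnC => /(tfree_gdvd tX (prime_gt0 pp))/IHk H i.
by rewrite fgMn; apply: gdvdMn.
Qed.

(** Successive approximation: when the error is z p^k, the relation expressing z b modulo p, with b
    inverted modulo p by Bezout, supplies the correction that reaches p^(k+1). *)
Lemma basis_span k x : exists n : fsJ, gdvd (p ^ k) (x - sigma tau n).
Proof.
elim: k => [|k [n [z Ez]]]; first by exists 0; exists (x - sigma tau (0 : fsJ)).
have [b [m [pb Hb]]] := bs z.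
have [u [v Euv]] := Bezoutz b p.
have g1 : gcdz b p = 1.
  apply/eqP; rewrite -/(coprimez b p) coprimez_sym coprimezE /= prime_coprime //.
  by apply/negP => H; apply: pb; rewrite dvdzE.
exists (n - m *~ u *+ p ^ k).
have -> : x - sigma tau (n - m *~ u *+ p ^ k) = (z + sigma tau (m *~ u)) *+ p ^ k.
  by rewrite sigmaB sigmaMn opprB addrCA addrC Ez mulrnDl.
rewrite expnS; apply: gdvdMn.
have -> : z + sigma tau (m *~ u) = (z *~ b + sigma tau m) *~ u + (z *~ v) *+ p.
  rewrite sigmaMz mulrzDl addrAC; congr (_ + _).
  by rewrite pmulrn -!mulrzA -mulrzDr (mulrC b) Euv g1 mulr1z.
by apply: gdvdD; [apply: gdvdZ|apply: gdvdxx].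
Qed.
End ModP.

Section Rational.
Context {S : structure} {HS : zfc S} {X : zmodType} {EX : Enc S X} {IX : igrp X}.
Context {J : eqType} {EJ : Enc S J} (sJ : small J) (j0 : J).
Hypothesis tX : tfree X.
Notation fsJ := (fsz sJ j0).
Notation fsQ := (fun_grp (fs_sub sJ j0 (@igrp_rat S _))).
Variable tau : ifun J X.
Hypothesis tb : mbasis sJ j0 tau 0 (@dpart X).

(** w consists of the rational coordinates n_i / N of x in the basis [tau]. A relation between codes
    is directly definable; that it does not depend on N is [ratc_uniq]. *)
Definition ratc (x : X) (w : fsQ) := exists (N : nat) (n : fsJ), (0 < N)%N /\
  (forall i, w i *+ N = (n i)%:~R) /\ x *+ N = sigma tau n.

Lemma sigma_inj0 (n m : fsJ) : sigma tau n = sigma tau m -> n = m.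
Proof.
move=> E; apply: fgP => i; have [_ [H _]] := tb.
have := H (n - m); rewrite sigmaB E subrr => /(_ _ i).
by rewrite dvd0z fgB subr_eq0 => H'; apply/eqP/H'; exists 0; rewrite mul0rn.
Qed.

Lemma ratc_cross x N (n : fsJ) N' n' : x *+ N = sigma tau n -> x *+ N' = sigma tau n' ->
  n *+ N' = n' *+ N.
Proof.
move=> E E'; apply: sigma_inj0; rewrite !sigmaMn -E -E' -!mulrnA mulnC //.
Qed.

Lemma ratc_uniq x w w' : ratc x w -> ratc x w' -> w = w'.
Proof.
move=> [N [n [N0 [Hw E]]]] [N' [n' [N0' [Hw' E']]]].
apply: fgP => i; have NN : (0 < N * N')%N by rewrite muln_gt0 N0.
apply: (tfree_mulIn rat_tfree NN).
rewrite mulrnA Hw mulnC mulrnA Hw' -!rmorphMn /= -!fgMn.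
by rewrite (ratc_cross E E').
Qed.

Lemma ratcD x y w v : ratc x w -> ratc y v -> ratc (x + y) (w + v).
Proof.
move=> [N [n [N0 [Hw E]]]] [N' [n' [N0' [Hw' E']]]].
exists (N * N')%N, (n *+ N' + n' *+ N); split; first by rewrite muln_gt0 N0.
split=> [i|].
  by rewrite fgD mulrnDl mulrnA Hw mulnC mulrnA Hw' fgD !fgMn rmorphD /= !rmorphMn.
by rewrite sigmaD !sigmaMn -E -E' mulrnDl -!mulrnA (mulnC N').
Qed.

Lemma ratc_inj x y w : ratc x w -> ratc y w -> x = y.
Proof.
move=> [N [n [N0 [Hw E]]]] [N' [n' [N0' [Hw' E']]]].
have NN : (0 < N * N')%N by rewrite muln_gt0 N0.
apply: (tfree_mulIn tX NN); rewrite mulrnA E mulnC mulrnA E' -!sigmaMn; congr sigma.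
apply: fgP => i; rewrite !fgMn; apply: (@intr_inj rat).
by rewrite !rmorphMn /= -Hw -Hw' -!mulrnA mulnC.
Qed.

Lemma fsq_ex (N : nat) (n : fsJ) : (0 < N)%N -> exists w : fsQ, forall i, w i *+ N = (n i)%:~R.
Proof.
move=> N0; apply: (@fs_choose S _ J _ sJ j0 rat _ _ (fun i v => v *+ N = (n i)%:~R)).
- by dfn.
- by move=> i; have [z Ez] := rat_divisible (n i)%:~R N0; exists z.
- by move=> i v v' <- /(tfree_mulIn rat_tfree N0).
by have [l Hl] := fg_prop n; exists l => i /Hl ->; rewrite mul0rn.
Qed.

Lemma ratc_ex x : dpart x -> exists w, ratc x w.
Proof.
move=> Hx; have [_ [_ H]] := tb; have [b [n [b0 /gdvd0 E]]] := H x Hx.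
have {}b0 : b != 0 by apply/negP => /eqP b0'; apply: b0; rewrite b0'.
have [N [m [N0 Em]]] : exists (N : nat) (m : fsJ), (0 < N)%N /\ x *+ N = sigma tau m.
  move: b0 E; case: b => [N|N] b0 /eqP; rewrite addr_eq0 => /eqP E.
    by exists N, (- n); rewrite sigmaN -E lt0n.
  by exists N.+1, n; split=> //; move: E; rewrite NegzE mulrNz -pmulrn => /oppr_inj.
by have [w Hw] := fsq_ex m N0; exists w, N, m.
Qed.

Lemma ratc_surj w : exists x, dpart x /\ ratc x w.
Proof.
(* N is a common denominator of the finitely many nonzero coordinates; dividing by it does not leave
   the divisible part. *)
have [l Hl] := fg_prop w; pose N := (\prod_(i <- l) `|denq (w i)|)%N.
have N0 : (0 < N)%N by apply: prodn_gt0 => i; rewrite absz_gt0 denq_neq0.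
have HN i : exists z : int, w i *+ N = z%:~R.
  case: (boolP (i \in l)) => [il|/Hl ->]; last by exists 0; rewrite mul0rn.
  have /dvdnP [k Ek] : (`|denq (w i)| %| N)%N by rewrite /N (big_rem _ il) dvdn_mulr.
  exists (numq (w i) * k%:Z); rewrite Ek mulnC mulrnA -[w i *+ _]mulr_natr.
  have -> : `|denq (w i)|%:R = (denq (w i))%:~R :> rat.
    by rewrite -[in RHS](absz_denq (w i)).
  by rewrite -numqE -mulr_natr rmorphM.
have [||||n Hn] := @fs_choose S _ J _ sJ j0 int _ igrp_int (fun i z => w i *+ N = z%:~R).
- by dfn.
- exact: HN.
- by move=> i v v' -> /intr_inj.
- by exists l => i /Hl ->; rewrite mul0rn.
have Ds : dpart (sigma tau n).
  have [Ht _] := tb; have [l' [ul Hl']] := fsz_supp n; rewrite (sigmaE _ ul Hl').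
  elim/big_ind: _ => [M _|a b Ha Hb M M0|i _ M M0]; first by exists 0; rewrite mul0rn.
    by apply: gdvdD; [apply: Ha|apply: Hb].
  by apply: gdvdZ; apply: Ht.
have [x [Hx Ex]] := dpart_div tX N0 Ds.
by exists x; split=> //; exists N, n; rewrite Ex.
Qed.
End Rational.

Section Lifting.
Context {S : structure} {HS : zf S}.

Lemma iset_pairl (T : Type) {ET : Enc S T} (o : S) (P : T -> Prop) : small T -> dP P ->
  exists A : iset (S * T), forall u, A u <-> u.1 = o /\ P u.2.
Proof.
move=> sT dPP.
have H : is_set (fun w : S => exists u : S * T, w = enc u /\ (u.1 = o /\ P u.2)).
  have [||a Ha] := @repl_set S _ T (S * T) _ _ (fun t u => u = (o, t) /\ P t) sT.
  - by dfn.
  - by move=> t u u' [-> _] [-> _].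
  exists a => w; rewrite Ha; split=> -[u [-> Hu]]; exists u; split=> //.
    by have [t [-> Ht]] := Hu.
  by case: u Hu => u1 t /= [-> Ht]; exists t.
by exists (ISet H).
Qed.

Section Pairl.
Context {V : zmodType} {EV : Enc S V} (o : S).

Lemma pairl_inj : injective (fun x : V => (o, x)).
Proof. by move=> x y [->]. Qed.

Lemma pairl_dom : dP (fun u : S * V => exists x, u = (o, x)).
Proof. by dfn. Qed.

(** The code of x as an element of the sum of a one-element group and V. With it that sum is equal,
    and not only isomorphic, to a typed group, so it can be rewritten under the completion. *)
Definition Enc_pairl : Enc S V := enc_via pairl_inj pairl_dom.

Lemma enc_pairlE (x : V) : @enc S V Enc_pairl x = opair o (enc x).
Proof. by []. Qed.

Lemma dF_pairl : @dF S HS V V EV Enc_pairl id.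
Proof.
have H : @dF S HS V (S * V)%type Enc_pairl _ (fun x => (o, x)) by exact: dF_via.
by apply: (dF_lift pairl_inj H); dfn.
Qed.

Lemma dF_pairl_inv : @dF S HS V V Enc_pairl EV id.
Proof.
have H : @dF S HS V (S * V)%type Enc_pairl _ (fun x => (o, x)) by exact: dF_via.
exact: (@dF_sndT _ _ V S V Enc_pairl _ _ _ H).
Qed.

Lemma igrp_pairl : igrp V -> @igrp S HS V Enc_pairl.
Proof.
move=> IV; have d1 := dF_pairl; have d2 := dF_pairl_inv.
split; last by apply: (small_surj d1) => [u|]; [exists u|exact: igrp_small].
apply: (@dF_app1 _ _ (V * V)%type V V _ EV Enc_pairl id (fun p => p.1 + p.2) d1).
apply: (@dF_add _ _ V EV IV (V * V)%type _ fst snd).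
  by apply: (@dF_app1 _ _ (V * V)%type V V _ Enc_pairl EV id fst d2); exact: dF_fst.
by apply: (@dF_app1 _ _ (V * V)%type V V _ Enc_pairl EV id snd d2); exact: dF_snd.
Qed.

Lemma osum_pairl (G : grp S) : (forall v, car G v <-> v = o) ->
  (forall u v w, Defs.add G u v w <-> u = o /\ v = o /\ w = o) ->
  osum G (cgrp V) = @cgrp S V Enc_pairl.
Proof.
move=> Hc Ha; apply: grp_ext => [v|u v w].
  split=> [[a [b [/Hc -> [[x ->] /opairP ->]]]]|[x ->]]; first by exists x.
  by exists o, (enc x); split; [exact/Hc|split; [exists x|exact/opairP]].
split.
  move=> [a [b [a' [b' [c [d [/opairP -> [/opairP -> [/opairP -> [/Ha [-> [-> ->]] [x [y [-> [-> ->]]]]]]]]]]]]]].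
  by exists x, y.
move=> [x [y [-> [-> ->]]]]; exists o, (enc x), o, (enc y), o, (enc (x + y)).
do 3 (split; first exact/opairP); split; first exact/Ha.
by exists x, y.
Qed.
End Pairl.
Lemma Zgrp_cgrp : Zgrp S = cgrp int.
Proof.
by apply: grp_ext => [v|u v w]; split;
  [move=> [z /enc_intP ->]; exists z|move=> [z ->]; exists z; apply/enc_intP|
   move=> [x [y [/enc_intP -> [/enc_intP -> /enc_intP ->]]]]; exists x, y|
   move=> [x [y [-> [-> ->]]]]; exists x, y; split; [|split]; apply/enc_intP].
Qed.

End Lifting.

(** ** Typed completions *)

Section Completion2.
Context {S : structure} {HS : zfc S} {V : zmodType} {EV : Enc S V} {IV : igrp V}.
Variable p : nat.

Lemma dF_cst : dF (fun u : nat * V => cst u.1 u.2).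
Proof.
apply: dF_iset; apply: (@dP_ext _ _ _ _ (fun u : nat * V * V => gdvd u.1.1 (u.2 - u.1.2))); last by dfn.
by move=> u; rewrite cstP.
Qed.

Definition coset_seq (F : ifun nat (iset V)) :=
  (forall k, exists g, F k = cst (p ^ k) g) /\ forall k x, F k.+1 x -> F k x.

Lemma ext_sub (A B : iset V) : Defs.subset (enc A : S) (enc B) <-> forall x, A x -> B x.
Proof.
split=> [H x Ax|H w /extP [x [-> Ax]]]; last by apply/extP; exists x; split=> //; apply: H.
by apply/ext_mem/H/ext_mem.
Qed.

Lemma coset_seqP (F : ifun nat (iset V)) : coset_seq F ->
  exists x : ifun nat V, (forall k, F k = cst (p ^ k) (x k)) /\ forall k, gdvd (p ^ k) (x k.+1 - x k).
Proof.
move=> [H1 H2]; have dc := dF_cst; have sV : small V by exact: igrp_small.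
have [||x Hx] := @choice_ifun S _ nat V _ _ (fun k g => F k = cst (p ^ k) g) small_nat sV.
- by dfn.
- exact: H1.
exists x; split=> // k; apply/cstP; rewrite -Hx; apply: H2; rewrite Hx.
by apply/cstP; rewrite subrr; exists 0; rewrite mul0rn.
Qed.

Lemma pc_carE v : car (padic_completion p (cgrp V)) v <->
  exists F : ifun nat (iset V), v = graph F /\ coset_seq F.
Proof.
rewrite pc_car; split=> [[f [-> [Hf H]]]|[F [-> [HF H]]]].
  have [|F EF] := @lift_enc S _ nat (iset V) _ _ f small_nat.
    by move=> k; have [g ->] := Hf k; exists (cst (p ^ k) g).
  exists F; split; first exact: graph_of_enc.
  split=> k; first by have [g Eg] := Hf k; exists g; apply: encI; rewrite -Eg EF.
  by apply/ext_sub; rewrite -!EF.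
have [f [Ef ->]] := unlift_enc F small_nat; exists f; split=> //.
split=> k; first by have [g Eg] := HF k; exists g; rewrite Ef Eg.
by rewrite !Ef; apply/ext_sub/H.
Qed.

Lemma pc_addE u v w : Defs.add (padic_completion p (cgrp V)) u v w <->
  exists F G H : ifun nat (iset V), u = graph F /\ v = graph G /\ w = graph H /\
    coset_seq F /\ coset_seq G /\ coset_seq H /\
    forall k a b, F k a -> G k b -> H k (a + b).
Proof.
have cD k a b a' b' : cst (p ^ k) a a' -> cst (p ^ k) b b' -> cst (p ^ k) (a + b) (a' + b').
  by move=> /cstP Ha /cstP Hb; apply/cstP; rewrite opprD addrACA; apply: gdvdD.
have cc k a : cst (p ^ k) a a by apply/cstP; rewrite subrr; exists 0; rewrite mul0rn.
rewrite pc_add; split.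
  move=> [f [g [h [-> [-> [-> [E [cf [cg ch]]]]]]]]].
  have [|F EF] := @lift_enc S _ nat (iset V) _ _ f small_nat.
    by move=> k; have [a [b [-> _]]] := E k; exists (cst (p ^ k) a).
  have [|G EG] := @lift_enc S _ nat (iset V) _ _ g small_nat.
    by move=> k; have [a [b [_ [-> _]]]] := E k; exists (cst (p ^ k) b).
  have [|H EH] := @lift_enc S _ nat (iset V) _ _ h small_nat.
    by move=> k; have [a [b [_ [_ ->]]]] := E k; exists (cst (p ^ k) (a + b)).
  have E' k : exists a b, F k = cst (p ^ k) a /\ G k = cst (p ^ k) b /\ H k = cst (p ^ k) (a + b).
    have [a [b [Ea [Eb Ec]]]] := E k; exists a, b.
    by split; [|split]; apply: encI; rewrite -?Ea -?Eb -?Ec -?EF -?EG -?EH.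
  exists F, G, H; do 3 (split; first exact: graph_of_enc).
  split; [|split; [|split]].
  - by split=> k; [have [a [b [-> _]]] := E' k; exists a|apply/ext_sub; rewrite -!EF].
  - by split=> k; [have [a [b [_ [-> _]]]] := E' k; exists b|apply/ext_sub; rewrite -!EG].
  - by split=> k; [have [a [b [_ [_ ->]]]] := E' k; exists (a + b)|apply/ext_sub; rewrite -!EH].
  by move=> k a b; have [a0 [b0 [-> [-> ->]]]] := E' k; apply: cD.
move=> [F [G [H [-> [-> [-> [cF [cG [cH E]]]]]]]]].
have [f [Ef ->]] := unlift_enc F small_nat.
have [g [Eg ->]] := unlift_enc G small_nat.
have [h [Eh ->]] := unlift_enc H small_nat.
exists f, g, h; do 3 (split=> //).
split=> [k|]; last by split; [|split]=> k; rewrite ?Ef ?Eg ?Eh; apply/ext_sub; [case: cF|case: cG|case: cH] => _; apply.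
have [a Ea] := cF.1 k; have [b Eb] := cG.1 k; have [c Ec] := cH.1 k.
exists a, b; rewrite Ef Eg Eh Ea Eb; do 2 (split=> //); rewrite Ec; congr enc.
by apply: cst_eq; rewrite -Ec; apply: E; rewrite ?Ea ?Eb.
Qed.
End Completion2.

(** ** The p-adic integers as a completion *)

Section PadicEnc.
Context {S : structure} {HS : zfc S} (p : nat).
Notation Jp := (@Jp S HS p).
Notation cohs := (@cohs S HS p).
Notation Jpi := (@Jpi S HS p).

Lemma Jf_ex (q : Jp) : exists F : ifun nat (iset int), forall x, q = Jpi x -> forall k, F k = cst (p ^ k) (x k).
Proof.
have dc : dF (fun u : nat * int => cst u.1 u.2) by exact: dF_cst.
have [x Ex] := qpi_surj q.
have [|F HF] := @ifun_ex S _ nat (iset int) _ _ (fun k => cst (p ^ k) (x k)) small_nat; first by dfn.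
exists F => y Ey k; rewrite HF; apply: cst_eq; apply/cstP/gdvd_int.
have H : Jpi y = Jpi x by rewrite -Ey Ex.
by move/Jpi_eq: H.
Qed.

(** The sequence of cosets modulo p^k by which the statement codes a p-adic integer. *)
Definition Jf q : ifun nat (iset int) := sval (cid (Jf_ex q)).

Lemma JfE x k : Jf (Jpi x) k = cst (p ^ k) (x k).
Proof. exact: (svalP (cid (Jf_ex (Jpi x)))). Qed.

Lemma JfP x k w : Jf (Jpi x) k w <-> ((p ^ k)%N%:Z %| w - x k)%Z.
Proof. by rewrite JfE cstP gdvd_int. Qed.

Lemma Jf_inj : injective Jf.
Proof.
move=> q q'; have [x ->] := qpi_surj q; have [y ->] := qpi_surj q' => E.
apply/Jpi_eq => k; apply/JfP; rewrite -/(Jpi y) -E; apply/JfP.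
by rewrite subrr dvdz0.
Qed.

Lemma dF_Jf : dF (fun x : cohs => Jf (Jpi x)).
Proof.
apply: dF_ifun; apply: (@dF_iset _ _ (cohs * nat)%type _ _ _ (fun u => Jf (Jpi u.1) u.2)).
apply: (@dP_ext _ _ _ _ (fun u : cohs * nat * int => ((p ^ u.1.2)%N%:Z %| u.2 - u.1.1 u.1.2)%Z)); last by dfn.
by move=> u; rewrite JfP.
Qed.

#[global] Instance Enc_Jp : Enc S Jp := Enc_quot Jf_inj dF_Jf.
#[global] Instance igrp_Jp : igrp Jp := igrp_quot Jf_inj dF_Jf.

Lemma dF_Jpi : dF Jpi.
Proof. exact: dF_qpi. Qed.

Lemma dF_Jfv : dF Jf.
Proof. exact: dF_via. Qed.

Lemma enc_JpE (q : Jp) : enc q = graph (Jf q).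
Proof. by []. Qed.

Lemma Jf_coset_seq q : coset_seq p (Jf q).
Proof.
have [x ->] := qpi_surj q; rewrite -/(Jpi x).
split=> k; first by exists (x k); rewrite JfE.
move=> w; rewrite !JfP => H.
have -> : w - x k = (w - x k.+1) + (x k.+1 - x k) by rewrite addrA subrK.
rewrite rpredD //; last exact: (fg_prop x k).
by apply: dvdz_trans H; rewrite dvdzE /= dvdn_exp2l.
Qed.

Lemma Jf_surj F : coset_seq p F -> exists q, F = Jf q.
Proof.
move=> /coset_seqP [x [Hx cx]].
have px : pcoh p x by move=> k; apply/gdvd_int/cx.
exists (Jpi (@FG _ _ _ _ _ _ (FSub small_nat igrp_int (@pcoh_def S HS p) (@pcoh0 S HS p) (@pcohB S HS p)) x px)).
by apply: ifunP => k; rewrite JfE Hx.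
Qed.

Lemma padic_cgrp : padic S p = cgrp Jp.
Proof.
rewrite /padic Zgrp_cgrp; apply: grp_ext => [v|u v w].
  rewrite pc_carE; split=> [[F [-> /Jf_surj [q ->]]]|[q ->]]; first by exists q.
  by exists (Jf q); split=> //; exact: Jf_coset_seq.
rewrite pc_addE; split.
  move=> [F [G [H [-> [-> [-> [/Jf_surj [q ->] [/Jf_surj [q' ->] [/Jf_surj [q'' ->] E]]]]]]]]].
  exists q, q'; do 2 split=> //; rewrite enc_JpE; congr graph; congr Jf.
  move: E; have [x ->] := qpi_surj q; have [y ->] := qpi_surj q'; have [z ->] := qpi_surj q''.
  rewrite -/(Jpi x) -/(Jpi y) -/(Jpi z) => E; rewrite -qpiD; apply/Jpi_eq => k.
  rewrite -opprB rpredN fgD; apply/JfP/E; by apply/JfP; rewrite subrr dvdz0.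
move=> [q [q' [-> [-> ->]]]]; exists (Jf q), (Jf q'), (Jf (q + q')).
do 3 (split=> //); do 3 (split; first exact: Jf_coset_seq).
have [x ->] := qpi_surj q; have [y ->] := qpi_surj q'.
move=> k a b; rewrite -qpiD -/(Jpi x) -/(Jpi y) -/(Jpi (x + y)) !JfP fgD => Ha Hb.
by rewrite opprD addrACA rpredD.
Qed.
End PadicEnc.

(** * Kaplansky's decomposition *)

Lemma gdvdB_trans (V : zmodType) n (x y z : V) : gdvd n (x - y) -> gdvd n (y - z) -> gdvd n (x - z).
Proof. by move=> H H'; have := gdvdD H H'; rewrite addrA subrK. Qed.

Lemma isomorphic_of {S : structure} {HS : zf S} (X : zmodType) {EX : Enc S X} {IX : igrp X}
    (G : grp S) (h : X -> S) : dF h -> (forall x y, Defs.add G (h x) (h y) (h (x + y))) ->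
  (forall x, car G (h x)) -> injective h -> (forall v, car G v -> exists x, v = h x) ->
  isomorphic (cgrp X) G.
Proof.
move=> dh ha hc hi hs.
have [|f Hf] := @ifun_ex S _ X S _ _ h _ dh; first exact: igrp_small.
exists (graph f); split; [split; [split|]|split].
- move=> w /graphP [x ->]; exists (enc x), (h x); split; first by exists x.
  by split=> //; apply/opairP; rewrite Hf.
- move=> a [x ->]; exists (h x); split; first by apply/app_graph_enc; rewrite Hf.
  by move=> b /app_graph_enc ->; rewrite Hf.
- move=> a b s a' b' s' [x [y [-> [-> ->]]]] /app_graph_enc -> /app_graph_enc -> /app_graph_enc ->.
  by rewrite !Hf; apply: ha.
- by apply/map_inj_graph => x y; rewrite !Hf; apply: hi.
by move=> b /hs [x ->]; exists (enc x); apply/app_graph_enc; rewrite Hf.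
Qed.

Section PadicInt.
Context {S : structure} {HS : zfc S} (p : nat) (pp : prime p).
Notation Jp := (@Jp S HS p).

Lemma const_coh (z : int) : exists x : @cohs S HS p, forall k, x k = z.
Proof.
have [f Hf] := @ifun_ex S _ nat int _ _ (fun=> z) small_nat ltac:(dfn).
have cf : pcoh p f by move=> k; rewrite !Hf subrr dvdz0.
by exists (@FG _ _ _ _ _ _ (FSub small_nat igrp_int (@pcoh_def S HS p) (@pcoh0 S HS p) (@pcohB S HS p)) f cf).
Qed.

Definition jz z : Jp := Jpi (sval (cid (const_coh z))).

Lemma jz_rep z : exists x : @cohs S HS p, jz z = Jpi x /\ forall k, x k = z.
Proof. by exists (sval (cid (const_coh z))); split=> // k; rewrite (svalP (cid (const_coh z)) k). Qed.

Lemma jzB a b : jz (a - b) = jz a - jz b.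
Proof.
have [x [-> Hx]] := jz_rep (a - b); have [y [-> Hy]] := jz_rep a; have [z [-> Hz]] := jz_rep b.
rewrite -[RHS]qpiB; apply/Jpi_eq => k; rewrite fgB Hx Hy Hz subrr; exact: dvdz0.
Qed.

Lemma jz0 : jz 0 = 0.
Proof. by rewrite -(subrr (0 : int)) jzB subrr. Qed.

Lemma jzD a b : jz (a + b) = jz a + jz b.
Proof. by have := jzB (a + b) b; rewrite addrK => ->; rewrite subrK. Qed.

Lemma Jf_jz z k w : Jf (jz z) k w <-> ((p ^ k)%N%:Z %| w - z)%Z.
Proof. by have [x [-> Hx]] := jz_rep z; rewrite JfP Hx. Qed.

Lemma Jf_gdvd q k z : Jf q k z <-> gdvd (p ^ k) (q - jz z).
Proof.
have [x ->] := qpi_surj q; have [y [-> Hy]] := jz_rep z.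
rewrite -/(Jpi x) JfP -qpiB -/(Jpi (x - y)) Jp_gdvd ?expn_gt0 ?prime_gt0 // pfactorK //.
by rewrite fgB Hy -opprB rpredN.
Qed.

Lemma jz_gdvd k z : gdvd (p ^ k) (jz z) <-> gdvd (p ^ k) z.
Proof.
rewrite -[jz z]subr0 -jz0 -Jf_gdvd Jf_jz sub0r rpredN; exact: iff_sym (gdvd_int _ _).
Qed.
End PadicInt.

Section Kaplansky.
Context {S : structure} {HS : zfc S} {X : zmodType} {EX : Enc S X} {IX : igrp X}.
Hypotheses (tX : tfree X) (cX : scompact X).
Variables (c : S) (i0 : El c).
Notation J := (El c).
Notation sJ := (small_El c).
Notation fsJ := (fsz sJ i0).
Notation W p := (fun_grp (fs_sub sJ i0 (@igrp_Jp S HS p))).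
Notation T1 := (ifun J (ifun nat (iset int))).
Variable tau : ifun nat (ifun J X).
Hypothesis bi : forall p, prime p -> forall n : fsJ,
  gdvd p (sigma (tau p) n) -> forall i, (p%:Z %| n i)%Z.
Hypothesis bs : forall p, prime p -> forall x, exists (b : int) (n : fsJ),
  ~ (p%:Z %| b)%Z /\ gdvd p (x *~ b + sigma (tau p) n).
Variable o : S.

Definition EW p : Enc S (W p) := Enc_pairl o.

Lemma igrp_W p : @igrp S _ (W p) (EW p).
Proof. exact: igrp_pairl. Qed.

Lemma jn_ex p (n : fsJ) : exists u : W p, forall i, u i = jz p (n i).
Proof.
have [||q Hq] := @choice_ifun S _ int (Jp p) _ _ (fun z q => forall k w, Jf q k w <-> ((p ^ k)%N%:Z %| w - z)%Z)
  small_int (igrp_small (igrp := igrp_Jp p)).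
- have dj : dF (@Jf S HS p) by exact: dF_Jfv.
  by dfn.
- by move=> z; exists (jz p z); exact: Jf_jz.
have Eq z : q z = jz p z.
  by apply: Jf_inj; apply: ifunP => k; apply: isetP => w; rewrite Hq Jf_jz.
have [||u Hu] := fs_ex sJ i0 (igrp_Jp p) (f := fun i => q (n i)).
- by dfn.
- by have [l Hl] := fg_prop n; exists l => i /Hl ->; rewrite Eq jz0.
by exists u => i; rewrite Hu Eq.
Qed.

Definition jn p (n : fsJ) : W p := sval (cid (jn_ex p n)).

Lemma jnE p n i : jn p n i = jz p (n i).
Proof. exact: (svalP (cid (jn_ex p n)) i). Qed.

Lemma jnD p n m : jn p (n + m) = jn p n + jn p m.
Proof. by apply: fgP => i; rewrite fgD !jnE fgD jzD. Qed.

Lemma gdvd_W p k (u : W p) : prime p -> gdvd (p ^ k) u <-> forall i, gdvd (p ^ k) (u i).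
Proof.
move=> pp; split=> [[v ->] i|H]; first by rewrite fgMn; exists (v i).
by apply: fs_gdvd => //; [exact: Jp_tfree|rewrite expn_gt0 prime_gt0].
Qed.

Lemma jn_gdvd p k n m : prime p -> gdvd (p ^ k) (jn p n - jn p m) -> gdvd (p ^ k) (sigma (tau p) n - sigma (tau p) m).
Proof.
move=> pp /gdvd_W H; rewrite -sigmaB; apply: sigma_gdvd => i.
by apply/gdvd_int/jz_gdvd => //; have := H pp i; rewrite !fgB !jnE jzB.
Qed.

(** Integers are dense in J_p. A zero coordinate is approximated by 0, which keeps the support
    finite. *)
Lemma W_int p k (g : W p) : prime p -> exists n, gdvd (p ^ k) (g - jn p n).
Proof.
move=> pp.
have dj : dF (@Jf S HS p) by exact: dF_Jfv.
have [||n0 Hn0] := @choice_ifun S _ J int _ _ (fun i z => (g i = 0 -> z = 0) /\ Jf (g i) k z) sJ small_int.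
- by dfn.
- move=> i; case: (pselect (g i = 0)) => [E|N].
    by exists 0; split=> //; apply/Jf_gdvd => //; rewrite E jz0 subrr; exists 0; rewrite mul0rn.
  by have [z Ez] := (Jf_coset_seq (g i)).1 k; exists z; split=> //; rewrite Ez; apply/cstP; rewrite subrr; exists 0; rewrite mul0rn.
have fn : finsupp n0.
  by have [l Hl] := fg_prop g; exists l => i /Hl E; apply: (Hn0 i).1.
exists (FG (P := fs_sub sJ i0 igrp_int) fn); apply/gdvd_W => // i.
by rewrite fgB jnE; apply/Jf_gdvd => //; have [_] := Hn0 i.
Qed.

(** ** The coordinates of an element modulo p^k *)

Definition sgm (p : nat) (n : fsJ) : X := sigma (tau p) n.

Lemma sgm_def : dF (fun u : nat * fsJ => sgm u.1 u.2).
Proof.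
have ds : dF (fun p : ifun J X * fsJ => sigma p.1 p.2) by exact: sigma_def.
exact: (dF_app1 (f := fun u : nat * fsJ => (tau u.1, u.2)) ds ltac:(dfn)).
Qed.

(** [W p] is a type depending on p; [T1] is not, and its elements represent families of p-adic
    integers by their cosets, so that this condition is definable jointly in p, k and x. The first
    two clauses say that G represents an element of [W p], by coherence and finite support; the last
    says that it agrees modulo p^k with integer coordinates of x. *)
Definition condG (p k : nat) (x : X) (G : T1) :=
  (forall i, (forall l, exists g, G i l = cst (p ^ l) g) /\ forall l z, G i l.+1 z -> G i l z) /\
  (exists (N : nat) (s : ifun nat J), forall i, (forall j, (j < N)%N -> s j <> i) ->
     forall l z, G i l z <-> ((p ^ l)%N%:Z %| z)%Z) /\
  exists n : fsJ, (forall i, G i k (n i)) /\ gdvd (p ^ k) (x - sgm p n).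

Lemma condG_def : dP (fun u : nat * nat * X * T1 => condG u.1.1.1 u.1.1.2 u.1.2 u.2).
Proof.
have ds : dF (fun u : nat * fsJ => sgm u.1 u.2) by exact: sgm_def.
have dc : dF (fun u : nat * int => cst u.1 u.2) by exact: dF_cst.
by rewrite /condG; dfn.
Qed.

Lemma enc_W p (u : W p) (G : T1) : (forall i, G i = Jf (u i)) -> @enc S (W p) (EW p) u = enc (o, G).
Proof.
move=> E; rewrite enc_pairlE; congr opair; apply: set_ext => w.
have -> : (enc u : S) = graph (fg_val u) by [].
have -> : (enc G : S) = graph G by [].
by rewrite !graphP; split=> -[i ->]; exists i; rewrite /enc /= E.
Qed.

Lemma condG_W p k x G : prime p -> condG p k x G ->
  exists u : W p, (forall i, G i = Jf (u i)) /\
    exists n, gdvd (p ^ k) (u - jn p n) /\ gdvd (p ^ k) (x - sigma (tau p) n).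
Proof.
move=> pp [H1 [[N [s Hs]] [n [Hn Hx]]]].
have dj : dF (@Jf S HS p) by exact: dF_Jfv.
have [||u0 Hu0] := @choice_ifun S _ J (Jp p) _ _ (fun i q => G i = Jf q) sJ (igrp_small (igrp := igrp_Jp p)).
- by dfn.
- by move=> i; apply: Jf_surj; split; [case: (H1 i)|case: (H1 i)].
have fu : finsupp u0.
  exists (mkseq s N) => i il; apply: Jf_inj; rewrite -Hu0 -jz0.
  apply: ifunP => k'; apply: isetP => w; rewrite Jf_jz subr0; apply: Hs => j jN E.
  by case/negP: il; rewrite -E; apply: map_f; rewrite mem_iota.
exists (FG (P := fs_sub sJ i0 (igrp_Jp p)) fu); split=> //; exists n; split=> //.
by apply/gdvd_W => // i; rewrite fgB jnE; apply/Jf_gdvd => //=; rewrite -Hu0.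
Qed.

Lemma W_condG p k x (u : W p) n : prime p -> gdvd (p ^ k) (u - jn p n) ->
  gdvd (p ^ k) (x - sigma (tau p) n) -> exists G : T1, (forall i, G i = Jf (u i)) /\ condG p k x G.
Proof.
move=> pp /gdvd_W Hu Hx.
have dj : dF (@Jf S HS p) by exact: dF_Jfv.
have [|G HG] := @ifun_ex S _ J (ifun nat (iset int)) _ _ (fun i => Jf (u i)) sJ; first by dfn.
exists G; split=> //; split; [|split].
- by move=> i; rewrite HG; have [] := Jf_coset_seq (u i).
- have /(finsuppE i0) [N [s [_ Hs]]] := fg_prop u; exists N, s => i Hi l z.
  by rewrite HG Hs // -jz0 Jf_jz subr0.
exists n; split=> // i; rewrite HG; apply/Jf_gdvd => //.
by have := Hu pp i; rewrite fgB jnE.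
Qed.

Lemma C_ex p k x : exists A : iset (S * T1), forall u, A u <-> u.1 = o /\ condG p k x u.2.
Proof.
apply: iset_pairl.
  by apply: small_ifun; [exact: small_El|apply: small_ifun; [exact: small_nat|exact: small_iset small_int]].
exact: (dP_app1 (f := fun G : T1 => (p, k, x, G)) condG_def ltac:(dfn)).
Qed.

Definition C p k x : iset (S * T1) := sval (cid (C_ex p k x)).

Lemma CP p k x u : C p k x u <-> u.1 = o /\ condG p k x u.2.
Proof. exact: (svalP (cid (C_ex p k x)) u). Qed.

Lemma C_def : dF (fun u : nat * nat * X => C u.1.1 u.1.2 u.2).
Proof.
have dc : dP (fun u : nat * nat * X * T1 => condG u.1.1.1 u.1.1.2 u.1.2 u.2) by exact: condG_def.
apply: dF_iset; apply: (@dP_ext _ _ _ _ (fun u : nat * nat * X * (S * T1) => u.2.1 = o /\ condG u.1.1.1 u.1.1.2 u.1.2 u.2.2)).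
  by move=> u; rewrite CP.
apply: dP_and; first by dfn.
exact: (dP_app1 (f := fun u : nat * nat * X * (S * T1) => (u.1, u.2.2)) dc ltac:(dfn)).
Qed.

(** Two integer coordinate vectors of x modulo p^k are congruent modulo p^k by [basis_indep], so the
    elements satisfying [condG] form exactly one coset. *)
Lemma C_cst p k x n : prime p -> gdvd (p ^ k) (x - sigma (tau p) n) ->
  enc (C p k x) = @enc S _ (@Enc_iset S _ (W p) (EW p)) (@cst S _ (W p) (EW p) (igrp_W p) (p ^ k) (jn p n)).
Proof.
move=> pp Hn; apply: set_ext => w; split.
  move=> /extP [[o' G] [-> /CP /= [-> /(condG_W pp) [u [Eu [m [Hu Hm]]]]]]].
  apply/extP; exists u; split; first by rewrite (enc_W Eu).
  suff H : gdvd (p ^ k) (u - jn p n) by exact: (proj2 (@cstP S _ (W p) (EW p) (igrp_W p) _ _ _) H).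
  have D : gdvd (p ^ k) (jn p m - jn p n).
    apply/gdvd_W => // i; rewrite fgB !jnE -jzB; apply/jz_gdvd => //.
    rewrite -fgB; apply: (basis_indep tX pp (bi pp)); rewrite sigmaB.
    have -> : sigma (tau p) m - sigma (tau p) n = (x - sigma (tau p) n) - (x - sigma (tau p) m).
      by rewrite opprB [RHS]addrC addrA subrK.
    exact: gdvdB.
  exact: gdvdB_trans Hu D.
move=> /extP [u [-> /cstP Hu]]; have [G [EG HG]] := W_condG pp Hu Hn.
by rewrite (enc_W EG); apply/extP; exists (o, G); split=> //; apply/CP.
Qed.

(** ** The completed factors *)

Lemma Fs_ex p x : exists F : ifun nat (iset (S * T1)), forall k, F k = C p k x.
Proof.
have dC : dF (fun u : nat * nat * X => C u.1.1 u.1.2 u.2) by exact: C_def.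
by apply: ifun_ex; [exact: small_nat|dfn].
Qed.

Definition Fs p x : ifun nat (iset (S * T1)) := sval (cid (Fs_ex p x)).

Lemma FsE p x k : Fs p x k = C p k x.
Proof. exact: (svalP (cid (Fs_ex p x)) k). Qed.

Lemma Fs_def : dF (fun u : nat * X => Fs u.1 u.2).
Proof.
have dC : dF (fun u : nat * nat * X => C u.1.1 u.1.2 u.2) by exact: C_def.
apply: dF_ifun; apply: (dF_rel (R := fun (u : nat * X * nat) A => A = C u.1.1 u.2 u.1.2)); last by dfn.
by move=> u A; rewrite FsE.
Qed.

Lemma span p k x : prime p -> exists n : fsJ, gdvd (p ^ k) (x - sigma (tau p) n).
Proof. by move=> pp; apply: basis_span => //; exact: bs. Qed.

(** For a fixed prime, the sequence built in the type independent of p has the same code as a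
    coherent sequence of cosets in the typed group [W p]. *)
Lemma Fs_lift p x : prime p -> exists F : @ifun S _ nat (@iset S (W p) (EW p)) _ _,
  (graph (Fs p x) = graph F /\ @coset_seq S _ (W p) (EW p) (igrp_W p) p F) /\
  forall k n, gdvd (p ^ k) (x - sigma (tau p) n) -> F k = @cst S _ (W p) (EW p) (igrp_W p) (p ^ k) (jn p n).
Proof.
move=> pp; have [f [Ef ->]] := unlift_enc (Fs p x) small_nat.
have sp k : exists n : fsJ, gdvd (p ^ k) (x - sigma (tau p) n) by exact: span.
have [|F EF] := @lift_enc S _ nat (@iset S (W p) (EW p)) _ _ f small_nat.
  move=> k; have [n Hn] := sp k; exists (@cst S _ (W p) (EW p) (igrp_W p) (p ^ k) (jn p n)).
  by rewrite Ef FsE (C_cst pp Hn).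
have HF k n : gdvd (p ^ k) (x - sigma (tau p) n) -> F k = @cst S _ (W p) (EW p) (igrp_W p) (p ^ k) (jn p n).
  by move=> Hn; apply: encI; rewrite -EF Ef FsE (C_cst pp Hn).
exists F; split=> //; split; first exact: graph_of_enc.
split=> k; first by have [n Hn] := sp k; exists (jn p n); apply: HF.
move=> u; have [n Hn] := sp k.+1.
have pk : (p ^ k %| p ^ k.+1)%N by exact: dvdn_exp2l.
rewrite (HF k.+1 n Hn) (HF k n (gdvd_dvdn pk Hn)) => /cstP H.
exact: (proj2 (@cstP S _ (W p) (EW p) (igrp_W p) _ _ _) (gdvd_dvdn pk H)).
Qed.

Notation Ap p := (padic_completion p (@cgrp S (W p) (EW p))).

Lemma Ap_car p x : prime p -> car (Ap p) (graph (Fs p x)).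
Proof.
move=> pp; have [F [[E cF] _]] := Fs_lift x pp.
by apply/(@pc_carE S HS (W p) (EW p) (igrp_W p)); exists F.
Qed.

Lemma Ap_add p x y : prime p -> Defs.add (Ap p) (graph (Fs p x)) (graph (Fs p y)) (graph (Fs p (x + y))).
Proof.
move=> pp; have [F [[E cF] HF]] := Fs_lift x pp; have [G [[E' cG] HG]] := Fs_lift y pp.
have [H [[E'' cH] HH]] := Fs_lift (x + y) pp.
apply/(@pc_addE S HS (W p) (EW p) (igrp_W p)); exists F, G, H.
do 6 (split; first by []); move=> k u v.
have [n Hn] := span k x pp; have [m Hm] := span k y pp.
have Hnm : gdvd (p ^ k) (x + y - sigma (tau p) (n + m)).
  by rewrite sigmaD opprD addrACA; apply: gdvdD.
rewrite (HF k n Hn) (HG k m Hm) (HH k _ Hnm) jnD => /cstP Hu /cstP Hv.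
apply: (proj2 (@cstP S _ (W p) (EW p) (igrp_W p) _ _ _)).
by have := gdvdD Hu Hv; rewrite addrACA -opprD.
Qed.

Lemma Fs_inj p x y k : prime p -> Fs p x = Fs p y -> gdvd (p ^ k) (x - y).
Proof.
move=> pp E; have [n Hn] := span k x pp; have [m Hm] := span k y pp.
have : @cst S _ (W p) (EW p) (igrp_W p) (p ^ k) (jn p n) = @cst S _ (W p) (EW p) (igrp_W p) (p ^ k) (jn p m).
  have Ec : C p k x = C p k y by rewrite -!FsE E.
  exact: encI (etrans (esym (C_cst pp Hn)) (etrans (congr1 enc Ec) (C_cst pp Hm))).
move=> E'; have H : gdvd (p ^ k) (jn p n - jn p m).
  apply: (proj1 (@cstP S _ (W p) (EW p) (igrp_W p) _ _ _)); rewrite -E'.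
  by apply: (proj2 (@cstP S _ (W p) (EW p) (igrp_W p) _ _ _)); rewrite subrr; exists 0; rewrite mul0rn.
apply: gdvdB_trans (gdvdB_trans Hn (jn_gdvd pp H)) _.
by rewrite -opprB; apply: gdvdN.
Qed.

Lemma Fs_eq p x (F : @ifun S _ nat (@iset S (W p) (EW p)) _ _) : prime p ->
  (forall k, exists n, F k = @cst S _ (W p) (EW p) (igrp_W p) (p ^ k) (jn p n) /\
     gdvd (p ^ k) (x - sigma (tau p) n)) -> graph F = graph (Fs p x).
Proof.
move=> pp H; have [G [[-> _] HG]] := Fs_lift x pp; congr graph; apply: ifunP => k.
by have [n [-> Hn]] := H k; rewrite (HG k n Hn).
Qed.

Lemma pidx_dom : dP (fun n : nat => exists q : prime_index, n = sval q).
Proof.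
apply: (@dP_ext _ _ _ _ (fun n => prime n)); last by dfn.
by move=> n; split=> [[[q pq] ->]|pn] //; exists (exist _ n pn).
Qed.

Lemma pidx_inj : injective (fun q : prime_index => sval q).
Proof. by move=> [q pq] [q' pq'] /= E; subst q'; rewrite (bool_irrelevance pq pq'). Qed.

#[local] Instance Enc_pidx : Enc S prime_index := enc_via pidx_inj pidx_dom.

Lemma pidx_def : dF (fun q : prime_index => sval q).
Proof. exact: dF_via. Qed.

Lemma small_pidx : small prime_index.
Proof. exact: small_inj pidx_def pidx_inj small_nat. Qed.

Lemma pidx_rep (u : S) (q : prime_index) : is_num u (sval q) <-> u = enc q.
Proof. exact: enc_numP. Qed.

Lemma Phi_ex x : exists F : ifun prime_index (ifun nat (iset (S * T1))), forall q, F q = Fs (sval q) x.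
Proof.
have dq := pidx_def; have dFs : dF (fun u : nat * X => Fs u.1 u.2) by exact: Fs_def.
by apply: ifun_ex; [exact: small_pidx|dfn].
Qed.

Definition Phi x := sval (cid (Phi_ex x)).

Lemma PhiE x q : Phi x q = Fs (sval q) x.
Proof. exact: (svalP (cid (Phi_ex x)) q). Qed.

Lemma Phi_def : dF Phi.
Proof.
have dq := pidx_def; have dFs : dF (fun u : nat * X => Fs u.1 u.2) by exact: Fs_def.
apply: dF_ifun; apply: (dF_rel (R := fun (u : X * prime_index) A => A = Fs (sval u.2) u.1)); last by dfn.
by move=> u A; rewrite PhiE.
Qed.

Notation AG := (gprod (fun (u : S) (q : prime_index) => is_num u (sval q)) (fun q => Ap (sval q))).

Lemma AG_car x : car AG (graph (Phi x)).
Proof.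
apply/(gprod_car pidx_rep); have [f [Ef ->]] := unlift_enc (Phi x) small_pidx.
by exists f; split=> // q; rewrite Ef PhiE; apply: Ap_car (svalP q).
Qed.

Lemma AG_add x y : Defs.add AG (graph (Phi x)) (graph (Phi y)) (graph (Phi (x + y))).
Proof.
apply/(gprod_add pidx_rep); have [f [Ef ->]] := unlift_enc (Phi x) small_pidx.
have [g [Eg ->]] := unlift_enc (Phi y) small_pidx.
have [h [Eh ->]] := unlift_enc (Phi (x + y)) small_pidx.
by exists f, g, h; do 3 (split; first by []); move=> q; rewrite Ef Eg Eh !PhiE; apply: Ap_add (svalP q).
Qed.

Lemma Phi_inj x y : Phi x = Phi y -> dpart (x - y).
Proof.
move=> E M M0; apply: gdvd_primes => // p k pp _; apply: Fs_inj => //.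
by have := PhiE x (exist _ p pp); rewrite E PhiE.
Qed.

(** Stated on codes because the type of the p-component varies with p: y is a combination of basis
    elements whose coordinate vector lies in the k-th coset of that component. When p is not prime
    the condition on cosets is vacuous. *)
Definition coordR (f : ifun prime_index S) (pk : nat * nat) (y : X) := exists n : fsJ, y = sgm pk.1 n /\
  forall q : prime_index, sval q = pk.1 -> exists (G : T1) (b : S),
    (forall i l z, G i l z <-> ((pk.1 ^ l)%N%:Z %| z - n i)%Z) /\ (enc (pk.2, b) : S) ∈ f q /\ (enc (o, G) : S) ∈ b.

(** Integer approximations chosen from the cosets give elements y(p, k) coherent in k for each
    prime, and [chinese_scompact] finds x approximated by all of them. The summand d records that
    the divisible component can still be adjusted. *)
Lemma Phi_surj v : car AG v -> exists x, forall d, dpart d -> v = graph (Phi (x + d)).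
Proof.
move=> /(gprod_car pidx_rep) [f [-> Hf]].
have sX : small X by exact: igrp_small.
have FP p (pp : prime p) : exists F : @ifun S _ nat (@iset S (W p) (EW p)) _ _,
    f (exist _ p pp) = graph F /\ @coset_seq S _ (W p) (EW p) (igrp_W p) p F.
  exact: (proj1 (@pc_carE S HS (W p) (EW p) (igrp_W p) _ _) (Hf (exist _ p pp))).
have Fcst p (pp : prime p) F k n : @coset_seq S _ (W p) (EW p) (igrp_W p) p F ->
    F k (jn p n) -> F k = @cst S _ (W p) (EW p) (igrp_W p) (p ^ k) (jn p n).
  by move=> [H _]; have [g ->] := H k; apply: cst_eq.
pose R := coordR f.
have RP p (pp : prime p) F k y : f (exist _ p pp) = graph F -> 
    @coset_seq S _ (W p) (EW p) (igrp_W p) p F -> R (p, k) y -> exists n, y = sigma (tau p) n /\ F k (jn p n).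
  move=> EF cF [n [-> H]]; exists n; split=> //; have [G [b [HG [Hb HGb]]]] := H (exist _ p pp) erefl.
  have EG i : G i = Jf (jn p n i).
    by apply: ifunP => l; apply: isetP => z; rewrite HG jnE Jf_jz.
  move: Hb; rewrite EF => /graphP [t Et].
  move: HGb; rewrite -(enc_W EG).
  have [Ek Eb] := opair_inj Et; have {}Ek : k = t by exact: (encI Ek).
  have -> : b = enc (F t) by exact: Eb.
  by rewrite -Ek => /extP [u [Eu HFu]]; rewrite (encI Eu).
have [||y Hy] := @choice_ifun S _ (nat * nat)%type X _ _ R (small_prod small_nat small_nat) sX.
- have dq := pidx_def; have ds : dF (fun u : nat * fsJ => sgm u.1 u.2) by exact: sgm_def.
  by rewrite /R /coordR; dfn.
- move=> [p k]; case: (boolP (prime p)) => [pp|np]; last first.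
    by exists (sgm p 0), 0; split=> // q /= E; case/negP: np; rewrite -E; exact: (svalP q).
  have [F [EF cF]] := FP p pp; have [g Eg] := cF.1 k.
  have [n Hn] := W_int k g pp; exists (sgm p n), n; split=> // q Eq.
  have {Eq} -> : q = exist _ p pp by apply: pidx_inj.
  have [] := @W_condG p k (sigma (tau p) n) (jn p n) n pp; try by rewrite subrr; exists 0; rewrite mul0rn.
  move=> G [EG _]; exists G, (enc (F k)); split.
    by move=> i l z; rewrite EG jnE Jf_jz.
  rewrite EF; split; first by apply/graphP; exists k.
  rewrite -(enc_W EG); apply/extP; exists (jn p n); split=> //; rewrite Eg.
  by apply: (proj2 (@cstP S _ (W p) (EW p) (igrp_W p) _ _ _)); rewrite -opprB; apply: gdvdN.
have coh p k : prime p -> gdvd (p ^ k) (y (p, k.+1) - y (p, k)).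
  move=> pp; have [F [EF cF]] := FP p pp.
  have [n [-> Hn]] := RP p pp F k _ EF cF (Hy (p, k)).
  have [m [-> Hm]] := RP p pp F k.+1 _ EF cF (Hy (p, k.+1)).
  have := cF.2 _ _ Hm; rewrite (Fcst p pp F k n cF Hn) => /(proj1 (@cstP S _ (W p) (EW p) (igrp_W p) _ _ _)).
  exact: jn_gdvd.
have [x Hx] := chinese_scompact coh cX.
exists x => d Hd; apply: graph_of_enc => -[p pp]; rewrite PhiE /=.
have [F [EF cF]] := FP p pp; rewrite EF; apply: Fs_eq => // k.
have [n [Ey Hn]] := RP p pp F k _ EF cF (Hy (p, k)); exists n; split; first exact: Fcst.
by rewrite -Ey addrAC; apply: gdvdD; [exact: Hx|apply: Hd; rewrite expn_gt0 prime_gt0].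
Qed.

Variable tau0 : ifun J X.
Hypothesis tb : mbasis sJ i0 tau0 0 (@dpart X).
Variables (o2 : S) (G2 : grp S).
Hypotheses (G2c : forall v, car G2 v <-> v = o2)
  (G2a : forall u v w, Defs.add G2 u v w <-> u = o2 /\ v = o2 /\ w = o2).
Notation fsQ := (fun_grp (fs_sub sJ i0 (@igrp_rat S _))).

Definition coord (w : ifun X fsQ) (x : X) : S := enc ((Phi x, o2), w x).

(** [Phi] determines x up to its divisible part, and the rational coordinates of the retraction r x
    determine the rest. *)
Lemma decomposition : isomorphic (cgrp X) (osum (osum AG G2) (cgrp fsQ)).
Proof.
have [r [hr [Dr rD]]] := dpart_retract tX.
have sX : small X by exact: igrp_small.
have sQ : small fsQ by exact: igrp_small.
have [||w Hw] := @choice_ifun S _ X fsQ _ _ (fun x w => ratc tau0 (r x) w) sX sQ.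
- by rewrite /ratc; have ds : dF (fun n : fsJ => sigma tau0 n);
    [exact: (dF_app1 (f := fun n : fsJ => (tau0, n)) (@sigma_def S _ J _ sJ i0 X _ _) ltac:(dfn))|dfn].
- by move=> x; apply: ratc_ex.
pose h := coord w.
have dPhi := Phi_def.
have hE x : h x = opair (opair (graph (Phi x)) o2) (enc (w x)) by [].
apply: (isomorphic_of (h := h)).
- by rewrite /h /coord; dfn.
- move=> x y; rewrite !hE; exists (opair (graph (Phi x)) o2), (enc (w x)), (opair (graph (Phi y)) o2), (enc (w y)).
  exists (opair (graph (Phi (x + y))) o2), (enc (w (x + y))); do 3 (split; first exact/opairP); split.
    exists (graph (Phi x)), o2, (graph (Phi y)), o2, (graph (Phi (x + y))), o2.
    by do 3 (split; first exact/opairP); split; [exact: AG_add|exact/G2a].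
  apply/cgrp_add; apply: (ratc_uniq tb (Hw _)); rewrite hr; apply: ratcD; exact: Hw.
- move=> x; rewrite hE; exists (opair (graph (Phi x)) o2), (enc (w x)); split; last first.
    by split; [exists (w x)|exact/opairP].
  by exists (graph (Phi x)), o2; split; [exact: AG_car|split; [exact/G2c|exact/opairP]].
- move=> x y; rewrite !hE => /opair_inj [/opair_inj [/graph_inj E _] Ew].
  have {}Ew : w x = w y by exact: (encI Ew).
  have Er : r x = r y by apply: (ratc_inj tX (Hw x)); rewrite Ew; apply: Hw.
  by apply/eqP; rewrite -subr_eq0 -(rD _ (Phi_inj E)) (ihomB _ _ hr) Er subrr.
move=> v [a [b [[a1 [a2 [/Phi_surj [x Hx] [/G2c -> /opairP ->]]]] [[wb ->] /opairP ->]]]].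
have [d [Dd Hd]] := ratc_surj tX tb wb.
(* Replacing r x by d changes x by a divisible element only, hence leaves [Phi x] as it is. *)
exists (x + (d - r x)); rewrite hE -Hx; last exact: dpartB.
congr (opair _ (enc _)); apply: (ratc_uniq tb Hd).
have E : r (x + (d - r x)) = d by rewrite hr (ihomB _ _ hr) (rD _ (Dr x)) (rD d Dd) addrC subrK.
by have := Hw (x + (d - r x)); rewrite E.
Qed.
End Kaplansky.

Section KaplanskyGroup.
Context {S : structure} {HS : zfc S} {X : zmodType} {EX : Enc S X} {IX : igrp X}.
Hypotheses (tX : tfree X) (cX : scompact X).
Variables (c : S) (i0 : El c).
Notation fsJ := (fsz (small_El c) i0).

Lemma Qgrp_cgrp : Qgrp S = cgrp rat.
Proof.
by apply: grp_ext => [v|u v w]; split;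
  [move=> [z /enc_ratP ->]; exists z|move=> [z ->]; exists z; apply/enc_ratP|
   move=> [x [y [/enc_ratP -> [/enc_ratP -> /enc_ratP ->]]]]; exists x, y|
   move=> [x [y [-> [-> ->]]]]; exists x, y; split; [|split]; apply/enc_ratP].
Qed.

Lemma pos_dom : dP (fun n : nat => exists q : pos_index, n = sval q).
Proof.
apply: (@dP_ext _ _ _ _ (fun n => 0 < n)%N); last by dfn.
by move=> n; split=> [[[q pq] ->]|pn] //; exists (exist _ n pn).
Qed.

Lemma pos_inj : injective (fun q : pos_index => sval q).
Proof. by move=> [q pq] [q' pq'] /= E; subst q'; rewrite (bool_irrelevance pq pq'). Qed.

#[local] Instance Enc_pos : Enc S pos_index := enc_via pos_inj pos_dom.
#[local] Existing Instance Enc_pidx.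

Lemma kaplansky_isomorphic (tau : ifun nat (ifun (El c) X)) (tau0 : ifun (El c) X) (o : S) :
  is_empty o ->
  (forall p, prime p -> forall n : fsJ, gdvd p (sigma (tau p) n) -> forall i, (p%:Z %| n i)%Z) ->
  (forall p, prime p -> forall x, exists (b : int) (n : fsJ),
    ~ (p%:Z %| b)%Z /\ gdvd p (x *~ b + sigma (tau p) n)) ->
  mbasis (small_El c) i0 tau0 0 (@dpart X) ->
  isomorphic (cgrp X) (kaplansky_group (fun _ _ => o) (fun=> c) (fun=> o) c).
Proof.
move=> Ho bi bs tb.
have dpos : dF (fun q : pos_index => sval q) by exact: dF_via.
have [|f Hf] := @ifun_ex S _ pos_index S _ _ (fun=> o) (small_inj dpos pos_inj small_nat); first by dfn.
have [|f2 Hf2] := @ifun_ex S _ prime_index S _ _ (fun=> o) small_pidx; first by dfn.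
have rpos (u : S) (q : pos_index) : is_num u (sval q) <-> u = enc q by exact: enc_numP.
have [G2c G2a] := gsum_trivial (@pidx_rep S _) (F := fun q => copies (pruefer S (sval q)) o) Hf2
  (fun q => (copies_empty (pruefer S (sval q)) Ho).1) (fun q => (copies_empty (pruefer S (sval q)) Ho).2).
(* The one-element summands enter through their codes [graph f] and [graph f2]; the group of
   [decomposition] is then equal to the Kaplansky group. *)
refine (eq_ind _ (isomorphic (cgrp X)) (decomposition tX cX bi bs (graph f) tb G2c G2a) _ _).
symmetry.
rewrite /kaplansky_group Qgrp_cgrp; congr osum; last exact: copies_cgrp.
congr osum; congr gprod; apply: funext => q; congr padic_completion.
rewrite padic_cgrp (copies_cgrp (V := Jp (sval q)) i0).
have [Gc Ga] := gsum_trivial rpos (F := fun n => copies (Zmod S (sval q ^ sval n)) o) Hf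
  (fun n => (copies_empty (Zmod S (sval q ^ sval n)) Ho).1) (fun n => (copies_empty (Zmod S (sval q ^ sval n)) Ho).2).
exact: osum_pairl Gc Ga.
Qed.
End KaplanskyGroup.

(** * The Baer-Specker group and its quotients in typed form *)

Section QuotCgrp.
Context {S : structure} {HS : zf S} {V : zmodType} {EV : Enc S V} {IV : igrp V}.
Variable P : zsub V.
Hypothesis dPP : dP (fun x => P x).

Lemma quot_cgrp (Q : S -> Prop) : (forall v, Q v <-> exists x : V, v = enc x /\ P x) ->
  quot (cgrp V) Q = @cgrp S (qt P) (Enc_coset dPP).
Proof.
move=> HQ.
have cE v (x : V) : is_coset (cgrp V) Q v (enc x) <-> v = @enc S _ (Enc_coset dPP) (qpi P x).
  have E u : (exists h, Q h /\ Defs.add (cgrp V) (enc x) h u) <-> u ∈ (enc (coset dPP (qpi P x)) : S).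
    split=> [[h [/HQ [y [-> Py]] [a [b [Ea [Eb ->]]]]]]|/extP [y [-> /cosetP Ey]]].
      apply/extP; exists (a + b); split=> //; apply/cosetP/qpi_eq.
      have {}Ea : a = x by einj.
      have {}Eb : b = y by einj.
      by rewrite Ea Eb addrC addKr.
    exists (enc (y - x)); split; last by apply/cgrp_add; rewrite addrC subrK.
    by apply/HQ; exists (y - x); split=> //; apply/qpi_eq.
  split=> [H|-> u]; last by rewrite E.
  by apply: set_ext => u; rewrite -E; apply: H.
apply: grp_ext => [v|u v w].
  split=> [[g [[x ->] /cE ->]]|[q ->]]; first by exists (qpi P x).
  have [x ->] := qpi_surj q; exists (enc x); split; [by exists x|exact/cE].
split=> [[a [b [d [[x [y [-> [-> ->]]]] [/cE -> [/cE -> /cE ->]]]]]]|[q [q' [-> [-> ->]]]]].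
  by exists (qpi P x), (qpi P y); rewrite qpiD.
have [x ->] := qpi_surj q; have [y ->] := qpi_surj q'.
exists (enc x), (enc y), (enc (x + y)); split; first exact/cgrp_add.
by rewrite -qpiD; split; [|split]; apply/cE.
Qed.
End QuotCgrp.

Lemma bs_car {S : structure} {HS : zf S} v :
  car (baer_specker S) v <-> exists f : ifun nat int, v = graph f.
Proof.
rewrite /baer_specker Zgrp_cgrp (gprod_car num_rep); split=> [[f [-> Hf]]|[f ->]].
  by have [h Hh] := lift_enc small_nat Hf; exists h; apply: graph_of_enc.
by have [g [Hg ->]] := unlift_enc f small_nat; exists g; split=> // n; exists (f n).
Qed.

Lemma baer_specker_cgrp {S : structure} {HS : zfc S} : baer_specker S = cgrp (@Bgrp S HS).
Proof.
have out (x : @Bgrp S HS) : exists f : ifun nat S, (forall n, f n = enc (x n)) /\ (enc x : S) = graph f.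
  exact: (unlift_enc (fg_val x) small_nat).
apply: grp_ext => [v|u v w].
  by rewrite bs_car; split=> [[f ->]|[x ->]]; [exists (FG (P := full small_nat igrp_int) (fg_val := f) I)|exists (fg_val x)].
rewrite /baer_specker Zgrp_cgrp (gprod_add num_rep); split.
  move=> [f [g [h [-> [-> [-> H]]]]]].
  have [|f' Ef] := @lift_enc S _ nat int _ _ f small_nat.
    by move=> n; have [x [y [-> _]]] := H n; exists x.
  have [|g' Eg] := @lift_enc S _ nat int _ _ g small_nat.
    by move=> n; have [x [y [_ [-> _]]]] := H n; exists y.
  exists (FG (P := full small_nat igrp_int) (fg_val := f') I), (FG (P := full small_nat igrp_int) (fg_val := g') I).
  split; first exact: graph_of_enc.
  split; first exact: graph_of_enc.
  apply: graph_of_enc => n; rewrite fgD /=.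
  have [x [y [Ex [Ey ->]]]] := H n; congr enc.
  by congr (_ + _); apply: encI; [rewrite -Ex Ef|rewrite -Ey Eg].
move=> [x [y [-> [-> ->]]]].
have [f [Ef ->]] := out x; have [g [Eg ->]] := out y; have [h [Eh ->]] := out (x + y).
exists f, g, h; do 3 (split=> //); move=> n; rewrite Ef Eg Eh; apply/cgrp_add; exact: fgD.
Qed.

(** * Absoluteness *)

Section Absoluteness.
Context {S1 S2 : structure} {H1 : zf S1} {H2 : zf S2}.
Variable j : S1 -> S2.
Hypotheses (j_mem : forall x y, x ∈ y <-> j x ∈ j y)
  (j_trans : forall z y, z ∈ j y -> exists x, z = j x).

Lemma j_upair s a b : is_upair s a b -> is_upair (j s) (j a) (j b).
Proof.
move=> Hs w; split=> [Hw|[] ->]; [|by apply/j_mem/Hs; left|by apply/j_mem/Hs; right].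
have [t Et] := j_trans Hw; move: Hw; rewrite Et -j_mem => /Hs [] ->; by [left|right].
Qed.

Lemma j_opair a b : j (opair a b) = opair (j a) (j b).
Proof.
apply/opairP; have /opairP [s [t [Hs [Ht Hp]]]] : opair a b = opair a b by [].
by exists (j s), (j t); split; [|split]; apply: j_upair.
Qed.

Lemma j_nat (n : nat) : j (enc n) = enc n.
Proof.
apply/enc_numP; elim: n => [|n IHn].
  have /enc_numP H : (enc 0%N : S1) = enc 0%N by [].
  by move=> z Hz; have [t Et] := j_trans Hz; move: Hz; rewrite Et -j_mem => /H.
have /enc_numP [u [/enc_numP -> Hu]] : (enc n.+1 : S1) = enc n.+1 by [].
exists (j (enc n)); split=> // w; split=> [Hw|].
  have [t Et] := j_trans Hw; move: Hw; rewrite Et -!j_mem => /Hu [?|->]; by [left|right].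
case=> [Hw|->]; last by apply/j_mem/Hu; right.
by have [t Et] := j_trans Hw; move: Hw; rewrite Et -!j_mem => ?; apply/Hu; left.
Qed.

Lemma j_int (z : int) : j (enc z) = enc z.
Proof.
have E (S : structure) (HS : zf S) : (enc z : S) = opair (enc (int_pair z).1) (enc (int_pair z).2) by [].
by rewrite !E j_opair !j_nat.
Qed.

Lemma j_graph (f : ifun (S := S1) nat int) : exists g : ifun (S := S2) nat int,
  j (graph f) = graph g /\ forall n, g n = f n.
Proof.
have E (S : structure) (HS : zf S) (n : nat) (z : int) : (enc (n, z) : S) = opair (enc n) (enc z) by [].
have Hw w : w ∈ j (graph f) <-> exists n, w = enc (n, f n).
  split=> [Hw|[n ->]]; last first.
    by rewrite E -j_nat -j_int -j_opair -E -j_mem; apply/graphP; exists n.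
  have [t Et] := j_trans Hw; move: Hw; rewrite Et -j_mem => /graphP [n ->]; exists n.
  by rewrite !E j_opair j_nat j_int.
have Hs : is_set (fun w : S2 => exists n, w = enc (n, f n)) by exists (j (graph f)).
by exists (IFun Hs); split=> //; apply: set_ext => w; rewrite Hw graphP.
Qed.
End Absoluteness.

(** The induction runs outside the model: values are adjoined one at a time to the zero sequence.
    Hence every finitely supported sequence lies in every model, in particular those of N lie in
    M. *)
Lemma finite_ifun {S : structure} {HS : zf S} (x : nat -> int) k :
  (forall n, (k <= n)%N -> x n = 0) -> exists f : ifun nat int, forall n, f n = x n.
Proof.
elim: k x => [|k IHk] x Hx.
  by have [|f Hf] := @ifun_ex S _ nat int _ _ (fun=> 0) small_nat; [dfn|exists f => n; rewrite Hf Hx].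
have [|f Hf] := IHk (fun n => if n == k then 0 else x n).
  by move=> n kn; case: eqP => // nk; apply: Hx; rewrite ltn_neqAle kn eq_sym andbT; apply/eqP.
have [|g Hg] := @ifun_ex S _ nat int _ _ (fun n => if n == k then x k else f n) small_nat.
  apply: (dF_ifT (P := fun n => n = k)); [by move=> n; split=> /eqP|by dfn|by dfn|].
  exact: (dF_apT (dF_const f) (@dF_idT _ _ nat _)).
by exists g => n; rewrite Hg Hf; case: eqP => [->|].
Qed.

(** * The quotient for the models M and N *)

Section Main.
Variables (V : structure) (M N : V -> Prop).
Hypotheses (Vwf : well_founded (@isin V)) (Mtrans : transitive_class M)
  (MN : forall x : V, M x -> N x)
  (MZF : ZF (restrict M)) (NZFC : ZFC (restrict N)).

Lemma restrict_wf (C : V -> Prop) : well_founded (@isin (restrict C)).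
Proof.
suff H v : forall x : restrict C, sval x = v -> Acc (@isin (restrict C)) x by move=> x; apply: H.
elim/(well_founded_ind Vwf): v => v IHv x Ex; constructor=> y yx.
by apply: (IHv (sval y)); rewrite -?Ex.
Qed.

#[local] Instance zf_M : zf (restrict M) := {| zf_axioms := MZF; zf_wf := restrict_wf (C := M) |}.
#[local] Instance zfc_N : zfc (restrict N) :=
  {| zfc_zf := {| zf_axioms := proj1 NZFC; zf_wf := restrict_wf (C := N) |}; zfc_choice := proj2 NZFC |}.

Definition incl (x : restrict M) : restrict N := exist _ (sval x) (MN (svalP x)).

Lemma incl_mem x y : x ∈ y <-> incl x ∈ incl y.
Proof. by []. Qed.

Lemma incl_trans (z : restrict N) (y : restrict M) : z ∈ incl y -> exists x, z = incl x.
Proof.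
case: z => z Nz Hz; exists (exist _ z (Mtrans (svalP y) Hz)).
by congr exist; apply: Prop_irrelevance.
Qed.

Lemma incl_sval (x : restrict M) (v : restrict N) : sval x = sval v <-> v = incl x.
Proof.
split=> [|-> //]; case: v => v Nv /= E; subst v; congr exist; exact: Prop_irrelevance.
Qed.

Notation Bg := (@Bgrp (restrict N) zfc_N).

Definition inM (x : Bg) := exists f : ifun (S := restrict M) nat int, forall n, f n = x n.

Lemma inM0 : inM 0.
Proof. by apply: (@finite_ifun _ _ _ 0) => n _; exact: fg0. Qed.

Lemma inMB x y : inM x -> inM y -> inM (x - y).
Proof.
move=> [f Hf] [g Hg].
have [|h Hh] := @ifun_ex _ _ nat int _ _ (fun n => f n - g n) (@small_nat (restrict M) _); first by dfn.
by exists h => n; rewrite Hh Hf Hg fgB.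
Qed.

Definition Asub := ZSub inM0 inMB.

Lemma inM_fin (x : Bg) : (exists k, forall n, (k <= n)%N -> x n = 0) -> Asub x.
Proof. by move=> [k Hk]; apply: finite_ifun Hk. Qed.

Lemma bs_subP v : @bs_sub V M N v <-> exists x : Bg, v = enc x /\ Asub x.
Proof.
split=> [[w [/incl_sval -> /bs_car [f ->]]]|[x [-> [f Hf]]]].
  have [g [-> Hg]] := j_graph incl_mem incl_trans f.
  by exists (FG (P := full small_nat igrp_int) (fg_val := g) I); split=> //; exists f.
have [g [Eg Hg]] := j_graph incl_mem incl_trans f.
exists (graph f); split; last by apply/bs_car; exists f.
apply/incl_sval; rewrite Eg; congr graph; apply: ifunP => n; by rewrite Hg Hf.
Qed.

(** Being a sequence of M is not expressed by a formula of N. But A is a set of M and hence, M being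
    transitive, an element of N with the same members, which serves as a parameter. *)
Lemma Asub_def : dP (fun x : Bg => Asub x).
Proof.
have [a Ha] := small_ifun (@small_nat (restrict M) _) (@small_int (restrict M) _).
apply: (dcl_eq (D := fun v => v ∈ incl a)); last exact: dn_const_mem.
move=> v; rewrite -bs_subP; split=> [[w [/incl_sval -> /bs_car [f ->]]]|Hv].
  by apply/incl_mem/Ha; exists f.
have [x Ex] := incl_trans Hv; move: Hv; rewrite Ex -incl_mem => /Ha [f ->].
by exists (graph f); split=> //; apply/bs_car; exists f.
Qed.

(** The division can be carried out in M: the values of x are defined there from the sequence n
    x. *)
Lemma Asub_pure n (x : Bg) : (0 < n)%N -> Asub (x *+ n) -> Asub x.
Proof.
move=> n0 [f Hf].
have dx : dF (fun t : nat => x t : int) (HS := zf_M).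
  apply: (dF_rel (R := fun t z => z *+ n = f t)); last by dfn.
  move=> t z; rewrite Hf fgMn; split=> [->//|]; exact: tfree_mulIn tfree_int n0.
by have [g Hg] := ifun_ex (@small_nat (restrict M) _) dx; exists g.
Qed.

Notation X := (qt Asub).
#[local] Instance Enc_BA : Enc (restrict N) X := Enc_coset Asub_def.
#[local] Instance igrp_BA : igrp X := igrp_coset Asub_def.

Lemma BA_tfree : tfree X.
Proof.
move=> n q n0; have [x ->] := qpi_surj q; rewrite -qpiMn => /qpi_eq0 /(Asub_pure n0) H.
exact/qpi_eq0.
Qed.

Lemma BA_scompact : scompact X.
Proof. exact: scompact_Bquot (dF_qpi_coset Asub_def) inM_fin. Qed.

Lemma bs_quotient_cgrp : @bs_quotient V M N = cgrp X.
Proof. by rewrite /bs_quotient baer_specker_cgrp; apply: quot_cgrp; exact: bs_subP. Qed.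

Lemma BA_pinj : pinj (X := X).
Proof. exact: scompact_pure_injective BA_tfree BA_scompact. Qed.

Lemma bs_quotient_pure_injective : pure_injective (@bs_quotient V M N).
Proof. by rewrite bs_quotient_cgrp; apply: pure_injectiveI; exact: BA_pinj. Qed.

Hypothesis cA : countable_in (@bs_sub V M N).

Lemma Asub_enum : exists a : ifun nat Bg, forall x, Asub x -> exists j, x = a j.
Proof.
have [f [[fw fm] fi]] := cA; have dA := Asub_def.
have sB : small Bg by exact: igrp_small.
have appE (x : Bg) (k : nat) : app f (enc x) (enc k) <-> enc (x, k) ∈ f.
  by split=> [[w [Hw /opairP E]]|H]; [rewrite E in Hw|exists (enc (x, k)); split=> //; apply/opairP].
(* Numbers that the given injection does not assign to an element of A receive the default 0. *)
have [||a Ha] := @choice_ifun _ _ nat Bg _ _ (fun k x => (Asub x /\ enc (x, k) ∈ f) \/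
  (~ (exists y : Bg, Asub y /\ enc (y, k) ∈ f)) /\ x = 0) small_nat sB.
- by dfn.
- move=> k; case: (pselect (exists y : Bg, Asub y /\ enc (y, k) ∈ f)) => [[y Hy]|H].
    by exists y; left.
  by exists 0; right.
exists a => x Ax; have Bx : @bs_sub V M N (enc x) by apply/bs_subP; exists x.
have [b [[w [Hw Ew]] _]] := fm _ Bx.
have [a' [b' [_ [[k /enc_numP Ek] Ew']]]] := fw w Hw.
have [_ Eb] := pair_inj Ew Ew'.
have Hxk : enc (x, k) ∈ f.
  by move/opairP: Ew => Ew; rewrite Eb Ek in Ew; rewrite Ew in Hw.
exists k; have [[_ Hak]|[H _]] := Ha k; last by case: H; exists x.
apply: encI; apply: fi (_ : app f _ (enc k)) _; exact/appE.
Qed.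

Context (c : restrict N) (kap : ifun (El c) (iset nat)).
Hypothesis kapb : ibij kap.

Lemma BA_not_gdvd p : prime p -> exists x : X, ~ gdvd p x.
Proof.
move=> pp; have dpi : dF (qpi Asub) by exact: dF_qpi_coset.
have [a Pa] := Asub_enum.
(* Any subset of omega provides an index [i0], since [kap] is onto. *)
have [A _] : exists A : iset (S := restrict N) nat, forall t, A t <-> False by apply: iset_ex; [exact: small_nat|dfn].
have [i0 _] := kapb.2 A.
have [beta Hb] := family_mod dpi kapb Pa i0 pp.
have [d Hd] := delta_ex (small_El c) i0 i0.
exists (beta i0); rewrite -(sigma_delta beta Hd) => /Hb /(_ i0).
rewrite Hd eqxx dvdzE /= dvdn1 => /eqP E; by rewrite E in pp.
Qed.

(** [sigma] with its family given as an internal function, so that [dfn] sees a definable function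
    of two encoded arguments. *)
Definition isigma (i0 : El c) (t : ifun (El c) X) (n : fsz (small_El c) i0) : X := sigma t n.

Lemma bs_quotient_isomorphic (o : restrict N) : is_empty o ->
  isomorphic (@bs_quotient V M N) (kaplansky_group (fun _ _ => o) (fun=> c) (fun=> o) c).
Proof.
move=> Ho; have dpi : dF (qpi Asub) by exact: dF_qpi_coset.
have [a Pa] := Asub_enum.
have [A _] : exists A : iset (S := restrict N) nat, forall t, A t <-> False by apply: iset_ex; [exact: small_nat|dfn].
have [i0 _] := kapb.2 A.
have [iota iotai] := Bquot_embed dpi kapb.
have sX : small X by exact: igrp_small.
have ds : dF (fun u : ifun (El c) X * fsz (small_El c) i0 => isigma u.1 u.2) by exact: sigma_def.
have [||tau Htau] := @choice_ifun _ _ nat (ifun (El c) X) _ _ (fun p t => prime p ->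
    (forall n : fsz (small_El c) i0, gdvd p (isigma t n) -> forall i, (p%:Z %| n i)%Z) /\
    forall x, exists (b : int) (n : fsz (small_El c) i0), ~ (p%:Z %| b)%Z /\ gdvd p (x *~ b + isigma t n))
    small_nat (small_ifun (small_El c) sX).
- by dfn.
- move=> p; case: (boolP (prime p)) => [pp|np]; last first.
    have [|t _] := @ifun_ex _ _ (El c) X _ _ (fun=> 0) (small_El c); first by dfn.
    by exists t.
  have [beta Hb] := family_mod dpi kapb Pa i0 pp.
  have p1 : p <> 1%N by move=> E; rewrite E in pp.
  have [||t [_ [_ [Ht Hs]]]] := @mbasis_ex _ _ X _ _ p (fun=> True) _ _ (small_El c) i0 beta iota _ p1
    (indep_inj p1 Hb) iotai _ Hb.
  - by dfn.
  - by [].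
  by exists t => _; split=> // x; apply: Hs.
(* The same for m = 0 within the divisible part: a maximal family independent over the integers,
   which becomes a basis over the rationals. *)
have [beta [Hb Db]] := family_div dpi inM_fin kapb Pa i0.
have z1 : 0%N <> 1%N by [].
have [||tau0 [_ tb]] := @mbasis_ex _ _ X _ _ 0 (@dpart X) _ _ (small_El c) i0 beta iota _ z1
    (indep_inj z1 Hb) iotai _ Hb.
- exact: dpart_def.
- by move=> i M' M0; apply: Db.
rewrite bs_quotient_cgrp; apply: (kaplansky_isomorphic (tau := tau) BA_tfree BA_scompact Ho _ _ tb).
  by move=> p pp; have [H _] := Htau p pp.
by move=> p pp; have [_ H] := Htau p pp.
Qed.

Lemma bs_quotient_perp (G : grp (restrict N)) :
  perp (@bs_quotient V M N) G <-> forall p : nat, prime p -> perp (padic (restrict N) p) G.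
Proof.
rewrite bs_quotient_cgrp.
rewrite (@perp_iff _ _ X _ _ (fun p => @Jp _ zfc_N p) (fun p => Enc_Jp p) (fun p => igrp_Jp p) G BA_tfree BA_pinj BA_not_gdvd).
  by split=> H p pp; have := H p pp; rewrite padic_cgrp.
move=> p pp; split; first exact: Jp_tfree.
split; last exact: Jp_not_divisible.
apply: scompact_pure_injective; first exact: Jp_tfree.
by apply: Jp_scompact => //; exact: dF_Jpi.
Qed.
End Main.

Theorem proposition3p4 (V : structure) (M N : V -> Prop)
  (Vext : extensional V) (Vwf : well_founded (@isin V))
  (Mtrans : transitive_class M) (Ntrans : transitive_class N)
  (MN : forall x : V, M x -> N x)
  (MZF : ZF (restrict M)) (NZFC : ZFC (restrict N)) :
  pure_injective (bs_quotient M N) /\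
  (countable_in (@bs_sub V M N) ->
    (exists zero c : restrict N,
       is_empty zero /\ is_continuum c /\
       has_invariants (bs_quotient M N)
         (fun _ _ => zero) (fun _ => c) (fun _ => zero) c) /\
    (forall G : grp (restrict N),
       perp (bs_quotient M N) G <->
       forall p : nat, prime p -> perp (padic (restrict N) p) G)).
Proof.
split=> [|cA]; first exact: bs_quotient_pure_injective.
pose HN := zfc_N Vwf NZFC.
have [o Ho] := @empty_ex (restrict N) (@zfc_zf _ HN).
have [c [cc [kap kapb]]] := @continuum_ex (restrict N) HN.
split; last by move=> G; exact: (bs_quotient_perp Mtrans MN MZF cA kapb).
exists o, c; do 2 (split=> //); split.
  have co : is_cardinal o by exact: empty_cardinal.
  by move=> p pp; split=> [n n0|]; [|split; [exact: cc.1|]].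
split; first exact: cc.1.
exact: (bs_quotient_isomorphic Mtrans MN MZF cA kapb Ho).
Qed.
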